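(* Let $X$ be a smooth, complete and connected curve over a perfect field $k$, such that $k$ is algebraically closed in the function field $\Sigma_X$ and $X$ has a $k$-rational point. Then the topological group $\bar{\mathbb I}_X^1/\Sigma_X^*$ is profinite if and only if $k$ is finite.
   Context: Notation: $x\in X$ always denotes a closed point of $X$. $\Sigma_X$ is the function field; $v_x$ is the normalized discrete valuation at $x$; $\widehat{\mathcal O}_{X,x}$ is the completion of the local ring at $x$, with maximal ideal $\widehat{\mathfrak m}_x$, fraction field $K_x$ and residue field $k(x)$; $\deg(x)=[k(x):k]$. The adele ring is $\mathbb A_X=\prod'_{x}K_x$ (restricted product with respect to the $\widehat{\mathcal O}_{X,x}$), with the ring topology having as neighborhood base of $0$ the subspaces $U_D=\{\alpha\in\mathbb A_X: v_x(\alpha_x)\ge n_x\ \forall x\}$ for divisors $D=\sum n_xx$. The idele group $\mathbb I_X=\mathbb A_X^*$ has the topology induced by $\alpha\mapsto(\alpha,\alpha^{-1})\in\mathbb A_X\times\mathbb A_X$; a basis of neighborhoods of $1$ is given by $V_D=\prod_{x\in\operatorname{supp}D}(1+\widehat{\mathfrak m}_x^{n_x})\times\prod_{x\notin\operatorname{supp}D}\widehat{\mathcal O}_{X,x}^*$ with $D=\sum n_xx$ effective. $\mathbb I_X^1=\{\alpha\in\mathbb I_X : \sum_x\deg(x)v_x(\alpha_x)=0\}$ with the subspace topology. $\bar{\mathbb I}_X^1=\mathbb I_X^1/\prod_{x}(1+\widehat{\mathfrak m}_x)$ with the quotient topology. $\Sigma_X^*$ is embedded diagonally in $\mathbb I_X^1$;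 since $\Sigma_X^*\cap\prod_x(1+\widehat{\mathfrak m}_x)=\{1\}$, it is regarded as a subgroup of $\bar{\mathbb I}_X^1$, and $\bar{\mathbb I}_X^1/\Sigma_X^*$ carries the quotient topology. *)

(* Defs.v *)
From HB Require Import structures.
From mathcomp Require Import all_boot all_order all_algebra separable zify.
From mathcomp Require Import all_classical topology.

Set Implicit Arguments.
Unset Strict Implicit.
Unset Printing Implicit Defensive.
Import Order.TTheory GRing.Theory Num.Theory.
Local Open Scope classical_set_scope.
Local Open Scope ring_scope.

HB.mixin Record isTopologicalGroup G & Topological G & Group G := {
  mulg_continuous : continuous (fun p : G * G => (p.1 * p.2)%g);
  invg_continuous : continuous (fun x : G => (x^-1)%g)
}.

#[short(type="topGroupType")]
HB.structure Definition TopGroup :=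
  {G of Topological G & Group G & isTopologicalGroup G}.

Definition profinite (G : topGroupType) : Prop :=
  [/\ compact [set: G], hausdorff_space G & totally_disconnected [set: G]].

Record subgroup (G : groupType) := Subgroup {
  sg_set :> set G;
  sg1 : sg_set 1%g;
  sgB : forall x y, sg_set x -> sg_set y -> sg_set (x / y)%g
}.

Section SubgroupTheory.
Variables (G : groupType) (H : subgroup G).
Lemma sgV x : sg_set H x -> sg_set H x^-1%g.
Proof. by move=> Hx; rewrite -[x^-1%g]mul1g; apply/sgB/Hx/sg1. Qed.
Lemma sgM x y : sg_set H x -> sg_set H y -> sg_set H (x * y)%g.
Proof. by move=> Hx Hy; rewrite -[y]invgK; apply/sgB/sgV/Hy/Hx. Qed.
End SubgroupTheory.

Section SubgroupType.
Variables (G : groupType) (H : subgroup G).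

Definition subgroup_type := set_type (sg_set H).
HB.instance Definition _ := Choice.on subgroup_type.
HB.instance Definition _ := SubType.on subgroup_type.

Lemma sg_group_closed : group_closed (fun x : G => x \in sg_set H).
Proof.
split; first by rewrite inE; apply: sg1.
by move=> x y; rewrite !inE; apply: sgB.
Qed.
HB.instance Definition _ :=
  SubChoice_isSubGroup.Build G _ subgroup_type sg_group_closed.
End SubgroupType.

Lemma initial_continuousP (S : choiceType) (T U : topologicalType) (f : S -> T)
    (g : U -> initial_topology f) : continuous (f \o g) -> continuous g.
Proof.
move=> cfg; apply/continuousP => A [B oB <-].
by rewrite -comp_preimage; move/continuousP: cfg; apply.
Qed.

Lemma continuous_compT (S T U : topologicalType) (f : S -> T) (g : T -> U) :
  continuous f -> continuous g -> continuous (g \o f).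
Proof. by move=> cf cg x; apply: continuous_comp; [apply: cf|apply: cg]. Qed.

Lemma continuous_fst (S T : topologicalType) : continuous (fst : S * T -> S).
Proof. by move=> x; apply: cvg_fst. Qed.

Lemma continuous_snd (S T : topologicalType) : continuous (snd : S * T -> T).
Proof. by move=> x; apply: cvg_snd. Qed.

Lemma continuous_pair (S T U : topologicalType) (f : S -> T) (g : S -> U) :
  continuous f -> continuous g -> continuous (fun x => (f x, g x)).
Proof. by move=> cf cg x; apply: cvg_pair; [apply: cf|apply: cg]. Qed.

Section SubgroupTop.
Variables (G : topGroupType) (H : subgroup G).
HB.instance Definition _ :=
  Topological.copy (subgroup_type H) (set_type (sg_set H)).

Lemma sg_val_continuous : continuous (val : subgroup_type H -> G).
Proof. exact: (@initial_continuous _ G set_val). Qed.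

Lemma sg_mul_continuous :
  continuous (fun p : subgroup_type H * subgroup_type H => (p.1 * p.2)%g).
Proof.
apply: (@initial_continuousP _ _ _ (set_val : sg_set H -> G)).
apply: (@continuous_compT _ _ _
  (fun p : subgroup_type H * subgroup_type H => (val p.1, val p.2))
  (fun p : G * G => (p.1 * p.2)%g)); last exact: mulg_continuous.
by apply: continuous_pair; apply: continuous_compT sg_val_continuous;
  [apply: continuous_fst|apply: continuous_snd].
Qed.

Lemma sg_inv_continuous : continuous (fun x : subgroup_type H => (x^-1)%g).
Proof.
apply: (@initial_continuousP _ _ _ (set_val : sg_set H -> G)).
apply: (@continuous_compT _ _ _ (val : subgroup_type H -> G) (fun x => x^-1)%g).
  exact: sg_val_continuous.
exact: invg_continuous.
Qed.
HB.instance Definition _ := isTopologicalGroup.Build (subgroup_type H)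
  sg_mul_continuous sg_inv_continuous.
End SubgroupTop.

Record normal_subgroup (G : groupType) := NormalSubgroup {
  ns_sub :> subgroup G;
  nsJ : forall x y, sg_set ns_sub x -> sg_set ns_sub (x ^ y)%g
}.

Local Open Scope quotient_scope.

Section QuotientGroup.
Variables (G : topGroupType) (N : normal_subgroup G).

Definition coset_rel (x y : G) := `[< sg_set N (x^-1 * y)%g >].

Lemma coset_rel_equiv : equiv_class_of coset_rel.
Proof.
split=> [x|x y|y x z].
- by apply/asboolP; rewrite mulVg; apply: sg1.
- by apply/asbool_equiv_eq; split=> /sgV; rewrite invgM invgK.
- move=> /asboolP h1 /asboolP h2; apply/asboolP.
  by have := sgM h1 h2; rewrite mulgA mulgK.
Qed.
Canonical coset_equiv := EquivRelPack coset_rel_equiv.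
Canonical coset_encModRel := defaultEncModRel coset_rel.

Definition quot_group := quotient_topology {eq_quot coset_rel}.
HB.instance Definition _ := Topological.on quot_group.

Definition qpi (x : G) : quot_group := \pi_({eq_quot coset_rel}) x.

Lemma qpiP x y : qpi x = qpi y <-> sg_set N (x^-1 * y)%g.
Proof.
rewrite /qpi; split => [/eqmodP /asboolP //|h].
by apply/eqmodP/asboolP.
Qed.

Lemma qpi_repr c : qpi (repr c) = c. Proof. exact: reprK. Qed.

Lemma qpi_reprV x : sg_set N (x^-1 * repr (qpi x))%g.
Proof. by apply/qpiP; rewrite qpi_repr. Qed.

Lemma qpi_quot x : exists2 n, sg_set N n & repr (qpi x) = (x * n)%g.
Proof. by exists (x^-1 * repr (qpi x))%g; [apply: qpi_reprV|rewrite mulVKg]. Qed.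

Definition qmul (c d : quot_group) := qpi (repr c * repr d)%g.
Definition qone := qpi 1%g.
Definition qinv (c : quot_group) := qpi (repr c)^-1%g.

Lemma qpiM x y : qmul (qpi x) (qpi y) = qpi (x * y)%g.
Proof.
rewrite /qmul; have [n Nn ->] := qpi_quot x; have [m Nm ->] := qpi_quot y.
apply/esym/qpiP.
have -> : ((x * y)^-1 * (x * n * (y * m)) = n ^ y * m)%g.
  by rewrite /conjg invgM !mulgA mulgVK.
exact/sgM/Nm/nsJ.
Qed.

Lemma qpiV x : qinv (qpi x) = qpi x^-1%g.
Proof.
rewrite /qinv; have [n Nn ->] := qpi_quot x; apply/esym/qpiP.
by rewrite invgM -conjgE; apply/nsJ/sgV.
Qed.

Lemma quotW (P : quot_group -> Prop) : (forall x, P (qpi x)) -> forall c, P c.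
Proof. by move=> h c; rewrite -(qpi_repr c). Qed.

Lemma qmulA : associative qmul.
Proof.
by elim/quotW=> x; elim/quotW=> y; elim/quotW=> z; rewrite !qpiM mulgA.
Qed.
Lemma qmul1 : left_id qone qmul.
Proof. by elim/quotW=> x; rewrite qpiM mul1g. Qed.
Lemma qmulr1 : right_id qone qmul.
Proof. by elim/quotW=> x; rewrite qpiM mulg1. Qed.
Lemma qmulV : left_inverse qone qinv qmul.
Proof. by elim/quotW=> x; rewrite qpiV qpiM mulVg. Qed.
Lemma qmulrV : right_inverse qone qinv qmul.
Proof. by elim/quotW=> x; rewrite qpiV qpiM mulgV. Qed.
HB.instance Definition _ :=
  isGroup.Build quot_group qmulA qmul1 qmulr1 qmulV qmulrV.
Let Q := quot_group.

Lemma qpi_continuous : continuous qpi.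
Proof. exact: (@pi_continuous G {eq_quot coset_rel}). Qed.

Lemma qpi_open (A : set G) : open A -> open (qpi @` A).
Proof.
move=> oA; rewrite /open /= /quotient_open.
have -> : qpi @^-1` (qpi @` A) =
    \bigcup_(n in sg_set N) ((fun x => x * n)%g @^-1` A).
  apply/seteqP; split=> [x [a Aa] /qpiP h|x [n Nn /= An]].
    exists (x^-1 * a)%g => /=; last by rewrite mulVKg.
    by have := sgV h; rewrite invgM invgK.
  exists (x * n)%g => //; apply/qpiP.
  by rewrite invgM mulgVK; apply: sgV.
apply: bigcup_open => n _.
have cn : continuous (fun x : G => (x * n)%g).
  apply: (@continuous_compT _ _ _ (fun x : G => (x, n)) (fun p => p.1 * p.2)%g);
    last exact: mulg_continuous.
  by apply: continuous_pair => [x|]; [exact: cvg_id|exact: cst_continuous].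
by move/continuousP: cn; apply.
Qed.

Lemma quot_mul_continuous : continuous (fun p : Q * Q => (p.1 * p.2)%g).
Proof.
move=> [c d] W /=; rewrite -[c]qpi_repr -[d]qpi_repr.
move: (repr c) (repr d) => x y {c d}; rewrite [(_ * _)%g]qpiM => nW.
have [[A B] /= [nA nB] sAB] :
    nbhs (x, y) ((fun p : G * G => (p.1 * p.2)%g) @^-1` (qpi @^-1` W)).
  exact/mulg_continuous/qpi_continuous.
have nq z (C : set G) : nbhs z C -> nbhs (qpi z) (qpi @` C).
  rewrite !nbhsE => -[D [oD Dz] sDC]; exists (qpi @` D).
    by split; [exact: qpi_open|exists z].
  exact: image_subset.
exists (qpi @` A, qpi @` B); first by split; apply: nq.
move=> [_ _] [/= [a Aa <-] [b Bb <-]]; rewrite [(_ * _)%g]qpiM.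
exact: (sAB (a, b)).
Qed.

Lemma quot_inv_continuous : continuous (fun c : Q => (c^-1)%g).
Proof.
apply/(@quotient_continuous G {eq_quot coset_rel} Q).
have -> : (fun c : Q => c^-1)%g \o qpi =
    qpi \o (fun x : G => x^-1)%g by apply/funext => x; exact: qpiV.
exact: (continuous_compT invg_continuous qpi_continuous).
Qed.
HB.instance Definition _ := isTopologicalGroup.Build quot_group
  quot_mul_continuous quot_inv_continuous.
End QuotientGroup.

Local Open Scope ring_scope.

Section DependentProduct.
Variables (I : Type) (R : I -> comPzRingType).

Definition dprod := forall i, R i.
HB.instance Definition _ := gen_eqMixin dprod.
HB.instance Definition _ := gen_choiceMixin dprod.
Implicit Types a b c : dprod.

Definition dadd a b : dprod := fun i => a i + b i.
Definition dmul a b : dprod := fun i => a i * b i.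
Definition dopp a : dprod := fun i => - a i.

Lemma daddA : associative dadd.
Proof. by move=> a b c; apply: functional_extensionality_dep => i; exact: addrA. Qed.
Lemma daddC : commutative dadd.
Proof. by move=> a b; apply: functional_extensionality_dep => i; exact: addrC. Qed.
Lemma dadd0 : left_id (fun i => 0) dadd.
Proof. by move=> a; apply: functional_extensionality_dep => i; exact: add0r. Qed.
Lemma daddN : left_inverse (fun i => 0) dopp dadd.
Proof. by move=> a; apply: functional_extensionality_dep => i; exact: addNr. Qed.
HB.instance Definition _ := GRing.isZmodule.Build dprod daddA daddC dadd0 daddN.

Lemma dmulA : associative dmul.
Proof. by move=> a b c; apply: functional_extensionality_dep => i; exact: mulrA. Qed.
Lemma dmul1 : left_id (fun i => 1) dmul.
Proof. by move=> a; apply: functional_extensionality_dep => i; exact: mul1r. Qed.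
Lemma dmulr1 : right_id (fun i => 1) dmul.
Proof. by move=> a; apply: functional_extensionality_dep => i; exact: mulr1. Qed.
Lemma dmulDl : left_distributive dmul +%R.
Proof. by move=> a b c; apply: functional_extensionality_dep => i; exact: mulrDl. Qed.
Lemma dmulDr : right_distributive dmul +%R.
Proof. by move=> a b c; apply: functional_extensionality_dep => i; exact: mulrDr. Qed.
Lemma dmulC : commutative dmul.
Proof. by move=> a b; apply: functional_extensionality_dep => i; exact: mulrC. Qed.
HB.instance Definition _ :=
  GRing.Zmodule_isPzRing.Build dprod dmulA dmul1 dmulr1 dmulDl dmulDr.
HB.instance Definition _ := GRing.PzRing_hasCommutativeMul.Build dprod dmulC.
End DependentProduct.

(* The integral separated curves of finite type over k with function field F,
   given as in Chevalley and Zariski by the set X of their local rings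
   O_{X,x}, which are k-subalgebras of F. A smooth connected curve is
   integral, so this covers all of them; iota is the embedding of k in F. *)
Section Curve.
Variables (k F : fieldType) (iota : {rmorphism k -> F}).

Record subalg := Subalg {
  subalg_set :> set F;
  sa_const : forall c, subalg_set (iota c);
  saB : forall x y, subalg_set x -> subalg_set y -> subalg_set (x - y);
  saM : forall x y, subalg_set x -> subalg_set y -> subalg_set (x * y)
}.

Section SubalgRing.
Variable A : subalg.
Definition sa_mem (x : F) : bool := x \in subalg_set A.
Definition subalg_type := {x : F | sa_mem x}.
HB.instance Definition _ := SubType.on subalg_type.
HB.instance Definition _ := Choice.on subalg_type.

Lemma sa_subring_closed : subring_closed sa_mem.
Proof.
split.
- by rewrite /sa_mem unfold_in inE -(rmorph1 iota); apply: sa_const.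
- by move=> x y; rewrite /sa_mem !unfold_in !inE; apply: saB.
- by move=> x y; rewrite /sa_mem !unfold_in !inE; apply: saM.
Qed.
HB.instance Definition _ := GRing.isSubringClosed.Build F sa_mem sa_subring_closed.
HB.instance Definition _ := [SubChoice_isSubComNzRing of subalg_type by <:].

Lemma sa_constP c : sa_mem (iota c).
Proof. by rewrite /sa_mem inE; apply: sa_const. Qed.
Definition subalg_scal (c : k) : subalg_type := exist _ (iota c) (sa_constP c).
End SubalgRing.

Definition nonunits (A : set F) : set F :=
  [set f | A f /\ (f = 0 \/ ~ A f^-1)].

Definition valuation_ring (V : subalg) : Prop :=
  forall f, f != 0 -> subalg_set V f \/ subalg_set V f^-1.

Definition dominates (V A : subalg) : Prop :=
  subalg_set A `<=` subalg_set V /\ nonunits A `<=` nonunits V.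

(* The k-algebra k[s]. *)
Definition generated (s : seq F) : set F :=
  [set f | forall A : subalg, (forall a, a \in s -> subalg_set A a) -> subalg_set A f].

Definition fractions_of (A : set F) : set F :=
  [set f | exists a b, [/\ A a, A b, b != 0 & f = a / b]].

Definition prime_of (A p : set F) : Prop :=
  [/\ p `<=` A, p 0, (forall x y, p x -> p y -> p (x - y)),
      (forall a x, A a -> p x -> p (a * x)) &
      ~ p 1 /\ (forall a b, A a -> A b -> p (a * b) -> p a \/ p b)].

Definition localization (A p : set F) : set F :=
  [set f | exists a b, [/\ A a, A b, ~ p b & f = a / b]].

Definition transcendence_degree1 : Prop :=
  exists t, ~ algebraicOver iota t /\
    forall f, exists2 P : {poly {poly k}}, P != 0 &
      (map_poly (fun q => (map_poly iota q).[t]) P).[f] = 0.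

Definition derivation (A : subalg) (M : lmodType (subalg_type A))
    (D : subalg_type A -> M) : Prop :=
  [/\ forall f g, D (f + g) = D f + D g,
      forall f g, D (f * g) = f *: D g + g *: D f &
      forall c, D (subalg_scal A c) = 0].

(* The module of differentials of A over k is free of rank 1: some
   derivation d : A -> A is universal. *)
Definition differentials_free_rank1 (A : subalg) : Prop :=
  exists d : subalg_type A -> (subalg_type A)^o, derivation d /\
    forall (M : lmodType (subalg_type A)) (D : subalg_type A -> M), derivation D ->
      exists! m : M, forall f, D f = (d f : subalg_type A) *: m.

(* X is covered by finitely many affine charts Spec k[s], where k[s] has
   fraction field F; two points whose local rings are dominated by the same
   valuation ring coincide (separatedness); F has transcendence degree 1. *)
Definition curve (X : set subalg) : Prop :=
  [/\ exists charts : seq (seq F),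
        (forall s, s \in charts -> fractions_of (generated s) = setT) /\
        X = [set A | exists s p, [/\ s \in charts, prime_of (generated s) p
                                   & subalg_set A = localization (generated s) p]],
      (forall V A B, valuation_ring V -> X A -> X B ->
         dominates V A -> dominates V B -> A = B) & transcendence_degree1].

(* Valuative criterion of properness. *)
Definition complete_curve (X : set subalg) : Prop :=
  forall V, valuation_ring V -> exists2 A, X A & dominates V A.

(* Smooth of relative dimension 1. *)
Definition smooth_curve (X : set subalg) : Prop :=
  forall A, X A -> differentials_free_rank1 A.

(* Normalized discrete valuations of F, trivial on k. The value at 0, which
   should be infinite, is set to 0; pge n f below says v(f) >= n with the
   right meaning at f = 0. *)
Record place := Place {
  pval :> F -> int;
  pval0 : pval 0 = 0;
  pvalM : forall f g, f != 0 -> g != 0 -> pval (f * g) = pval f + pval g;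
  pvalD : forall f g, f != 0 -> g != 0 -> f + g != 0 ->
    Num.min (pval f) (pval g) <= pval (f + g);
  pval_const : forall c, pval (iota c) = 0;
  pval_normalized : exists t, pval t = 1
}.
HB.instance Definition _ := gen_eqMixin place.
HB.instance Definition _ := gen_choiceMixin place.

Section PlaceTheory.
Variable v : place.

Definition pge (n : int) (f : F) := (f == 0) || (n <= v f).

Lemma pge0 n : pge n 0. Proof. by rewrite /pge eqxx. Qed.

Lemma pval1 : v 1 = 0. Proof. by rewrite -(rmorph1 iota) pval_const. Qed.

Lemma pvalN f : v (- f) = v f.
Proof.
have [->|f0] := eqVneq f 0; first by rewrite oppr0.
by rewrite -mulN1r pvalM ?oppr_eq0 ?oner_eq0// -(rmorph1 iota) -rmorphN
  pval_const add0r.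
Qed.

Lemma pvalV f : v f^-1 = - v f.
Proof.
have [->|f0] := eqVneq f 0; first by rewrite invr0 pval0 oppr0.
by apply/eqP; rewrite -addr_eq0 -pvalM ?invr_eq0// mulVf// pval1.
Qed.

Lemma pgeB n f g : pge n f -> pge n g -> pge n (f - g).
Proof.
rewrite /pge; have [->|f0 /= hf] := eqVneq f 0.
  by rewrite sub0r oppr_eq0 pvalN.
have [->|g0 /= hg] := eqVneq g 0; first by rewrite subr0 hf orbT.
have [//|fg0 /=] := eqVneq (f - g) 0.
have g0' : - g != 0 by rewrite oppr_eq0.
apply: le_trans (@pvalD v _ _ f0 g0' fg0).
by rewrite pvalN le_min hf hg.
Qed.

Lemma pgeM n m f g : pge n f -> pge m g -> pge (n + m) (f * g).
Proof.
rewrite /pge mulf_eq0; have [//|f0 /= hf] := eqVneq f 0.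
by have [//|g0 /= hg] := eqVneq g 0; rewrite pvalM// lerD.
Qed.

Lemma pge_const c : pge 0 (iota c). Proof. by rewrite /pge pval_const orbT. Qed.

Lemma pge0M f g : pge 0 f -> pge 0 g -> pge 0 (f * g).
Proof. exact: (@pgeM 0 0). Qed.

Definition place_ring : subalg := @Subalg (pge 0) pge_const (@pgeB 0) pge0M.
Local Notation O := (subalg_type place_ring).

Lemma O_pge (x : O) : pge 0 (val x).
Proof. by have := valP x; rewrite /sa_mem inE. Qed.

(* max_pow n is the power m^(n+1) of the maximal ideal m. *)
Definition max_pow (n : nat) (x : O) : bool := pge n.+1 (val x).

Lemma max_pow_closed n : idealr_closed (max_pow n).
Proof.
split; rewrite /max_pow ?unfold_in ?pge0 //.
  by rewrite /pge /= oner_eq0 /= pval1.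
move=> a x y; rewrite !unfold_in /= => hx hy.
rewrite -[val y]opprK; apply: pgeB.
  by rewrite -[n.+1%:Z]add0r; apply: pgeM; first exact: O_pge.
by rewrite -sub0r; apply: pgeB; first exact: pge0.
Qed.
HB.instance Definition _ n := isIdealr.Build O (max_pow n) (max_pow_closed n).

Definition max_ideal n : idealr O := max_pow n.
Definition trunc n : Type := {ideal_quot (max_ideal n)}.
HB.instance Definition _ n := GRing.ComNzRing.on (trunc n).
Definition tpi n (x : O) : trunc n := \pi_(trunc n) x.

End PlaceTheory.
End Curve.

Section Completion.
Variables (k F : fieldType) (iota : {rmorphism k -> F}) (v : place iota).
Local Notation O := (subalg_type (place_ring v)).

Lemma pge_le n m f : m <= n -> pge v n f -> pge v m f.
Proof.
by rewrite /pge => mn /orP[->//|nf]; rewrite (le_trans mn nf) orbT.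
Qed.

Lemma tpi_eq n (x y : O) : tpi n x = tpi n y <-> pge v n.+1 (val x - val y).
Proof.
rewrite -[pge v n.+1 _]/(x - y \in max_ideal v n) Quotient.idealrBE.
by split=> [/eqP|/eqP].
Qed.

Lemma tpi_surj n (c : trunc v n) : exists x, c = tpi n x.
Proof. by exists (repr c); rewrite /tpi reprK. Qed.

Lemma tpi_le n m (x y : O) : (m <= n)%N -> tpi n x = tpi n y -> tpi m x = tpi m y.
Proof. by move=> mn /tpi_eq h; apply/tpi_eq; apply: pge_le h. Qed.

Lemma tpiB n (x y : O) : tpi n (x - y) = tpi n x - tpi n y.
Proof. exact: rmorphB. Qed.
Lemma tpiM n (x y : O) : tpi n (x * y) = tpi n x * tpi n y.
Proof. exact: rmorphM. Qed.
Lemma tpi1 n : tpi n (1 : O) = 1.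
Proof. exact: rmorph1. Qed.
Lemma tpi0 n : tpi n (0 : O) = 0.
Proof. exact: rmorph0. Qed.

Definition trunc_prod := dprod (fun n => trunc v n : comPzRingType).

(* The completion of O is the inverse limit of the rings O / m^(n+1). *)
Definition coherent (a : trunc_prod) : bool :=
  `[< forall n (x : O), a n.+1 = tpi n.+1 x -> a n = tpi n x >].

Lemma coherent_subring_closed : subring_closed coherent.
Proof.
split; rewrite ?unfold_in.
- apply/asboolP => n x; rewrite -[(1 : trunc_prod) _](tpi1 n.+1).
  by move=> h; rewrite -[(1 : trunc_prod) _](tpi1 n); apply: tpi_le h.
- move=> a b /asboolP ca /asboolP cb; apply/asboolP => n z.
  have [x ax] := tpi_surj (a n.+1); have [y bx] := tpi_surj (b n.+1).
  have -> : (a - b) n = a n - b n by [].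
  have -> : (a - b) n.+1 = a n.+1 - b n.+1 by [].
  rewrite (ca _ _ ax) (cb _ _ bx) ax bx -!tpiB.
  exact: tpi_le.
- move=> a b /asboolP ca /asboolP cb; apply/asboolP => n z.
  have [x ax] := tpi_surj (a n.+1); have [y bx] := tpi_surj (b n.+1).
  have -> : (a * b) n = a n * b n by [].
  have -> : (a * b) n.+1 = a n.+1 * b n.+1 by [].
  rewrite (ca _ _ ax) (cb _ _ bx) ax bx -!tpiM.
  exact: tpi_le.
Qed.
HB.instance Definition _ :=
  GRing.isSubringClosed.Build trunc_prod coherent coherent_subring_closed.

Definition completion : Type := {a : trunc_prod | coherent a}.
HB.instance Definition _ := SubType.on completion.
HB.instance Definition _ := Choice.on completion.
HB.instance Definition _ :=
  GRing.SubChoice_isSubComPzRing.Build _ _ completion (subringClosedP _).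

Lemma completion_nonzero : (1 : completion) != 0.
Proof.
apply/eqP => /(congr1 (fun a : completion => val a 0%N)) /=.
by apply/eqP; rewrite oner_eq0.
Qed.
HB.instance Definition _ :=
  GRing.PzSemiRing_isNonZero.Build completion completion_nonzero.

Lemma coherent_le (a : completion) n m (x : O) : (m <= n)%N ->
  val a n = tpi n x -> val a m = tpi m x.
Proof.
move=> /subnK <-; elim: (n - m)%N => // i IH h; apply: IH.
by have /asboolP := valP a; apply.
Qed.

(* The valuation of a <> 0: a vanishes in O / m^n but not in O / m^(n+1). *)
Definition completion_val (a : completion) : nat :=
  xget 0%N [set n | val a n != 0 /\ forall m, (m < n)%N -> val a m = 0].

Lemma cvalP (a : completion) : a != 0 ->
  val a (completion_val a) != 0 /\ forall m, (m < completion_val a)%N -> val a m = 0.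
Proof.
move=> a0.
have ex : exists n, val a n != 0.
  apply: contrapT => h; move/eqP: a0; apply; apply: val_inj.
  apply: functional_extensionality_dep => n.
  by apply: contrapT => /eqP h'; apply: h; exists n.
pose P := [set n | val a n != 0 /\ forall m, (m < n)%N -> val a m = 0].
suff : P (completion_val a) by [].
apply: xgetPex; exists (ex_minn ex); case: ex_minnP => n hn hmin; split=> // m.
by rewrite ltnNge => /negP h; apply: contrapT => /eqP /hmin /h.
Qed.

Lemma completion_val_pval (a : completion) n (x : O) : val a n = tpi n x -> val a n != 0 ->
  v (val x) = (completion_val a)%:Z /\ (completion_val a <= n)%N.
Proof.
move=> anx an0; have a0 : a != 0 by apply: contraNneq an0 => ->.
have [h1 h2] := cvalP a0.
have cn : (completion_val a <= n)%N.
  by rewrite leqNgt; apply: contra an0 => /h2 ->.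
split=> //.
have := coherent_le cn anx; move/eqP => e1.
have n1 : ~ pge v (completion_val a).+1 (val x).
  move=> h; have : tpi (completion_val a) x = tpi (completion_val a) 0 by apply/tpi_eq; rewrite subr0.
  by rewrite tpi0 -(eqP e1) => /eqP; apply/negP.
have x0 : val x != 0 by apply: contra_notN n1 => /eqP ->; apply: pge0.
apply/eqP; rewrite eq_le; apply/andP; split.
  have : ~~ ((completion_val a).+1%:Z <= v (val x)).
    by apply: contra_notN n1 => h; rewrite /pge h orbT.
  by rewrite -ltNge -addn1 PoszD ltzD1.
case E : (completion_val a) => [|m].
  by have := O_pge x; rewrite /pge (negPf x0).
have mc : (m < completion_val a)%N by rewrite E.
have := h2 _ mc; rewrite (@coherent_le a n m x _ anx); last exact: ltnW (leq_trans mc cn).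
rewrite -(tpi0 m) => /tpi_eq; rewrite subr0 /pge (negPf x0) /=.
by [].
Qed.

Lemma completion_repr (a : completion) n :
  exists2 x : O, val a n = tpi n x & val a n != 0 -> v (val x) = (completion_val a)%:Z.
Proof.
by have [x ax] := tpi_surj (val a n); exists x => // /(completion_val_pval ax)[].
Qed.

Lemma val_neq0 (a : completion) n : a != 0 -> (completion_val a <= n)%N -> val a n != 0.
Proof.
move=> a0 an; have [h _] := cvalP a0; apply: contra h => /eqP e.
have := e; rewrite -(tpi0 n) => /(coherent_le an) ->; by rewrite tpi0.
Qed.

Lemma tpi_neq0 n (x : O) : val x != 0 -> v (val x) <= n%:Z -> tpi n x != 0.
Proof.
move=> x0 h; apply/eqP; rewrite -(tpi0 n) => /tpi_eq.
rewrite subr0 /pge (negPf x0) /= -addn1 PoszD => h'.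
by have := le_trans h' h; rewrite gerDl.
Qed.

Lemma completion_mul (a b : completion) : a != 0 -> b != 0 ->
  a * b != 0 /\ completion_val (a * b) = (completion_val a + completion_val b)%N.
Proof.
move=> a0 b0; set n := (completion_val a + completion_val b)%N.
have an := val_neq0 a0 (leq_addr (completion_val b) (completion_val a) : (completion_val a <= n)%N).
have bn := val_neq0 b0 (leq_addl (completion_val a) (completion_val b) : (completion_val b <= n)%N).
have [x ax /(_ an) vx] := completion_repr a n.
have [y by_ /(_ bn) vy] := completion_repr b n.
have x0 : val x != 0.
  apply: contraNneq an => e; rewrite ax.
  by have -> : x = 0; [exact: val_inj|rewrite tpi0].
have y0 : val y != 0.
  apply: contraNneq bn => e; rewrite by_.
  by have -> : y = 0; [exact: val_inj|rewrite tpi0].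
have vxy : v (val (x * y)) = n%:Z by rewrite /= pvalM// vx vy.
have e : val (a * b) n = tpi n (x * y) by rewrite tpiM -ax -by_.
have ab0 : val (a * b) n != 0.
  by rewrite e tpi_neq0 ?vxy//= mulf_neq0.
split; first by apply: contraNneq ab0 => ->.
by have [] := completion_val_pval e ab0; rewrite vxy => -[].
Qed.

Lemma completion_integral (a b : completion) : a * b = 0 -> (a == 0) || (b == 0).
Proof.
move=> ab; have [//|a0] := eqVneq a 0; have [//|b0] := eqVneq b 0.
by have [] := completion_mul a0 b0; rewrite ab eqxx.
Qed.

Definition cunit : {pred completion} := fun a => `[< exists b, b * a = 1 >].
Definition cinv (a : completion) : completion :=
  if pselect (exists b, b * a = 1) is left h then projT1 (cid h) else a.
Lemma cmulVr : {in cunit, left_inverse 1 cinv *%R}.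
Proof.
by move=> a /asboolP h; rewrite /cinv; case: pselect => // h'; case: cid.
Qed.
Lemma cunitPl (a b : completion) : b * a = 1 -> cunit a.
Proof. by move=> h; apply/asboolP; exists b. Qed.
Lemma cinv_out : {in [predC cunit], cinv =1 id}.
Proof.
by move=> a /asboolP h; rewrite /cinv; case: pselect.
Qed.
HB.instance Definition _ :=
  GRing.ComNzRing_hasMulInverse.Build completion cmulVr cunitPl cinv_out.
HB.instance Definition _ :=
  GRing.ComUnitRing_isIntegral.Build completion completion_integral.

End Completion.

Notation local_field v := {fraction (completion v)}.

Lemma completion_val_ge (k F : fieldType) (iota : {rmorphism k -> F}) (v : place iota)
    (a : completion v) n : a != 0 ->
  ((n <= completion_val a)%N <-> forall m, (m < n)%N -> val a m = 0).
Proof.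
move=> a0; have [h1 h2] := cvalP a0; split=> [h m mn|h].
  exact/h2/(leq_trans mn).
by rewrite leqNgt; apply: contra h1 => /h ->.
Qed.

Lemma completion_add (k F : fieldType) (iota : {rmorphism k -> F})
    (v : place iota) (a b : completion v) n :
  a != 0 -> b != 0 -> a + b != 0 ->
  (n <= completion_val a)%N -> (n <= completion_val b)%N -> (n <= completion_val (a + b)%R)%N.
Proof.
move=> a0 b0 ab0 /(completion_val_ge _ a0) ha /(completion_val_ge _ b0) hb; apply/(completion_val_ge _ ab0).
move=> m mn; have -> : val (a + b) m = val a m + val b m by [].
by rewrite ha// hb// addr0.
Qed.

Section FractionValuation.
Variables (Ohat : idomainType) (completion_val : Ohat -> nat).
Local Notation K := {fraction Ohat}.
Local Notation "a %:F" := (@FracField.tofrac Ohat a) : ring_scope.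

Lemma fraction_repr (alpha : K) :
  alpha = (\n_(repr alpha))%:F / (\d_(repr alpha))%:F.
Proof.
have d0 := denom_ratioP (repr alpha).
apply: (canRL (mulfK _)); first by rewrite tofrac_eq0.
rewrite -[alpha in LHS]reprK; unlock FracField.tofrac.
rewrite -[LHS]FracField.pi_mul; apply/eqmodP => /=.
rewrite FracField.equivfE /FracField.mulf /= !numden_Ratio ?mulf_neq0 ?oner_eq0//.
by rewrite !mulr1 reprK mulrC.
Qed.

Definition fval (alpha : K) : int :=
  if alpha == 0 then 0
  else (completion_val \n_(repr alpha))%:Z - (completion_val \d_(repr alpha))%:Z.

Hypothesis completion_val_mul : forall a b, a != 0 -> b != 0 ->
  a * b != 0 /\ completion_val (a * b) = (completion_val a + completion_val b)%N.
Hypothesis completion_val_add : forall a b n, a != 0 -> b != 0 -> a + b != 0 ->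
  (n <= completion_val a)%N -> (n <= completion_val b)%N -> (n <= completion_val (a + b)%R)%N.

Lemma completion_val_cross (a b c d : Ohat) : a != 0 -> b != 0 -> c != 0 -> d != 0 ->
  a * d = c * b ->
  (completion_val a)%:Z - (completion_val b)%:Z = (completion_val c)%:Z - (completion_val d)%:Z.
Proof.
move=> a0 b0 c0 d0 h.
have [_ h1] := completion_val_mul a0 d0; have [_ h2] := completion_val_mul c0 b0.
have /(congr1 Posz) : (completion_val a + completion_val d = completion_val c + completion_val b)%N by rewrite -h1 -h2 h.
rewrite !PoszD => h3.
by apply/eqP; rewrite subr_eq addrAC eq_sym subr_eq h3.
Qed.

Lemma fval_eq (al : K) (a b : Ohat) : a != 0 -> b != 0 -> al = a%:F / b%:F ->
  fval al = (completion_val a)%:Z - (completion_val b)%:Z.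
Proof.
move=> a0 b0 ale; have aF : a%:F != 0 by rewrite tofrac_eq0.
have bF : b%:F != 0 by rewrite tofrac_eq0.
have al0 : al != 0.
  rewrite ale. rewrite mulf_eq0. rewrite invr_eq0. rewrite negb_or. rewrite (negPf aF). by rewrite bF.
have d0 := denom_ratioP (repr al).
have dF : (\d_(repr al))%:F != 0 by rewrite tofrac_eq0.
have e := fraction_repr al.
have n0 : \n_(repr al) != 0.
  by apply: contraNneq al0 => h; rewrite e h tofrac0 mul0r.
rewrite /fval (negPf al0); apply: completion_val_cross => //.
apply/eqP; rewrite -tofrac_eq !tofracM -eqr_div//.
by rewrite -e -ale.
Qed.

Lemma fval_frac (a b : Ohat) : a != 0 -> b != 0 ->
  fval (a%:F / b%:F) = (completion_val a)%:Z - (completion_val b)%:Z.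
Proof. by move=> a0 b0; apply: fval_eq. Qed.

Definition fge (n : int) (alpha : K) := (alpha == 0) || (n <= fval alpha).

Lemma fractionP (alpha : K) : alpha != 0 ->
  exists a b, [/\ a != 0, b != 0 & alpha = a%:F / b%:F].
Proof.
move=> al0; exists \n_(repr alpha), \d_(repr alpha); split.
- by apply: contraNneq al0 => h; rewrite (fraction_repr alpha) h tofrac0 mul0r.
- exact: denom_ratioP.
- exact: fraction_repr.
Qed.

Lemma fvalM (al be : K) : al != 0 -> be != 0 -> fval (al * be) = fval al + fval be.
Proof.
move=> /fractionP[a [b [a0 b0 ->]]] /fractionP[c [d [c0 d0 ->]]].
rewrite mulf_div -!tofracM.
have [ac0 acE] := completion_val_mul a0 c0; have [bd0 bdE] := completion_val_mul b0 d0.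
by rewrite !fval_frac// acE bdE !PoszD opprD addrACA.
Qed.

Lemma fval1 : fval 1 = 0.
Proof.
have o0 : (1 : Ohat) != 0 by exact: oner_neq0.
by have := fval_frac o0 o0; rewrite tofrac1 divr1 subrr.
Qed.

Lemma fvalV (al : K) : fval al^-1 = - fval al.
Proof.
have [->|al0] := eqVneq al 0; first by rewrite invr0 /fval eqxx oppr0.
by apply/eqP; rewrite -addr_eq0 -fvalM ?invr_eq0// mulVf// fval1.
Qed.

Lemma fgeD n (al be : K) : fge n al -> fge n be -> fge n (al + be).
Proof.
rewrite /fge; have [->|al0 /= hal] := eqVneq al 0; first by rewrite add0r.
have [->|be0 /= hbe] := eqVneq be 0; first by rewrite addr0 hal orbT.
have [//|s0 /=] := eqVneq (al + be) 0.
have [a [b [a0 b0 ale]]] := fractionP al0.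
have [c [d [c0 d0 bee]]] := fractionP be0.
have bF : b%:F != 0 by rewrite tofrac_eq0.
have dF : d%:F != 0 by rewrite tofrac_eq0.
have [ad0 adE] := completion_val_mul a0 d0; have [cb0 cbE] := completion_val_mul c0 b0.
have [bd0 bdE] := completion_val_mul b0 d0.
have e : al + be = (a * d + c * b)%:F / (b * d)%:F.
  by rewrite ale bee addf_div// tofracD !tofracM.
have t0 : a * d + c * b != 0.
  by apply: contraNneq s0 => h; rewrite e h tofrac0 mul0r.
move: hal hbe; rewrite e ale bee !fval_frac// !lerBrDr bdE => h1 h2.
have [m me] : exists m : int, m = n + (completion_val b + completion_val d)%:Z by eexists.
rewrite -me; case: m me => [m me|m _]; last exact: le_trans (_ : _ <= 0) _.
rewrite lez_nat; apply: completion_val_add => //.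
  rewrite adE -lez_nat me !PoszD addrA lerD2r; exact: h1.
by rewrite cbE -lez_nat me !PoszD [(completion_val b)%:Z + _]addrC addrA lerD2r.
Qed.

Lemma fgeN n (al : K) : fge n (- al) = fge n al.
Proof.
rewrite /fge oppr_eq0; have [//|al0 /=] := eqVneq al 0.
have hN1 : fval (-1) = 0.
  have h : (-1 : K) != 0 by rewrite oppr_eq0 oner_eq0.
  have : fval (-1 * -1) = 0 by rewrite mulrNN mulr1 fval1.
  rewrite fvalM// -mulr2n => /eqP; rewrite mulrn_eq0 /= => /eqP ->//.
by rewrite -mulN1r fvalM ?hN1 ?add0r// oppr_eq0 oner_eq0.
Qed.

Lemma fgeM n m (al be : K) : fge n al -> fge m be -> fge (n + m) (al * be).
Proof.
rewrite /fge mulf_eq0; have [//|a0 /= ha] := eqVneq al 0.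
by have [//|b0 /= hb] := eqVneq be 0; rewrite fvalM// lerD.
Qed.

Lemma fge_le n m (al : K) : m <= n -> fge n al -> fge m al.
Proof.
by rewrite /fge => mn /orP[->//|nf]; rewrite (le_trans mn nf) orbT.
Qed.

Lemma fge_tofrac a : fge 0 a%:F.
Proof.
rewrite /fge tofrac_eq0; have [//|a0 /=] := eqVneq a 0.
have o0 : (1 : Ohat) != 0 by exact: oner_neq0.
have := fval_frac a0 o0; rewrite tofrac1 divr1 => ->.
have -> : completion_val 1 = 0%N.
  have [_] := completion_val_mul o0 o0; rewrite mulr1 => /eqP.
  by rewrite -[X in X == _]addn0 eqn_add2l eq_sym => /eqP.
by rewrite subr0.
Qed.

End FractionValuation.

Section LocalField.
Variables (k F : fieldType) (iota : {rmorphism k -> F}) (v : place iota).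
Local Notation O := (subalg_type (place_ring v)).
Local Notation Ohat := (completion v).
Local Notation K := (local_field v).
Local Notation "a %:F" := (@FracField.tofrac Ohat a) : ring_scope.

Definition integral : set K := [set al | exists a : Ohat, al = a%:F].

Lemma integral_kge al : integral al -> fge (@completion_val _ _ _ v) 0 al.
Proof. by move=> [a ->]; apply/fge_tofrac/(@completion_mul _ _ _ v). Qed.

Definition loc (x : O) : trunc_prod v := fun n => tpi n x.
Lemma loc_coherent x : coherent (loc x).
Proof. by apply/asboolP => n y; apply: tpi_le. Qed.
Definition loc_hat (x : O) : Ohat := exist _ (loc x) (loc_coherent x).

Lemma loc_hatM x y : loc_hat (x * y) = loc_hat x * loc_hat y.
Proof. by apply: val_inj; apply: functional_extensionality_dep => n; exact: tpiM. Qed.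
Lemma loc_hat1 : loc_hat 1 = 1.
Proof. by apply: val_inj; apply: functional_extensionality_dep => n; exact: tpi1. Qed.

(* The embedding of F in the fraction field of the completion. *)
Definition local_emb (f : F) : K :=
  if 0 <= v f then (loc_hat (insubd 0 f))%:F
  else ((loc_hat (insubd 0 f^-1))%:F)^-1.

Lemma loc_hat_eq0 x : (loc_hat x == 0) = (x == 0).
Proof.
apply/eqP/eqP => [h|->]; last first.
  by apply: val_inj; apply: functional_extensionality_dep => n; exact: tpi0.
apply: contrapT => /eqP x0.
have vx0 : val x != 0 by apply: contraNneq x0 => e; apply/eqP/val_inj.
have := O_pge x; rewrite /pge (negPf vx0) /=.
case E : (v (val x)) => [n|//] _.
have : tpi n x != 0 by apply: tpi_neq0 => //; rewrite E.
have -> : tpi n x = val (loc_hat x) n by [].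
by rewrite h eqxx.
Qed.

Lemma insubd_O (f : F) : 0 <= v f -> val (insubd (0 : O) f) = f.
Proof.
move=> vf; rewrite val_insubd.
suff -> : sa_mem (place_ring v) f by [].
by rewrite /sa_mem inE /= /pge vf orbT.
Qed.

Lemma local_emb_frac (f : F) (a b : O) : b != 0 -> f = val a / val b ->
  local_emb f = (loc_hat a)%:F / (loc_hat b)%:F.
Proof.
move=> b0 fab.
have vb0 : val b != 0 by apply: contraNneq b0 => e; apply/eqP/val_inj.
have bF : (loc_hat b)%:F != 0 by rewrite tofrac_eq0 loc_hat_eq0.
rewrite /local_emb; case: ifPn => vf.
  apply: (canRL (mulfK bF)); rewrite -tofracM -loc_hatM; congr (loc_hat _)%:F.
  by apply: val_inj; rewrite /= insubd_O// fab divfK.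
have f0 : f != 0 by apply: contraNneq vf => ->; rewrite pval0.
have a0 : a != 0 by apply: contraNneq f0 => e; rewrite fab e mul0r.
have vf' : 0 <= v f^-1 by rewrite pvalV oppr_ge0 ltW// ltNge.
have aF : (loc_hat a)%:F != 0 by rewrite tofrac_eq0 loc_hat_eq0.
apply: invr_inj; rewrite invrK invf_div.
apply: (canRL (mulfK aF)); rewrite -tofracM -loc_hatM; congr (loc_hat _)%:F.
apply: val_inj; rewrite /= insubd_O// fab invf_div divfK//.
Qed.

Lemma O_fracP (f : F) : exists a b : O, b != 0 /\ f = val a / val b.
Proof.
have [vf|vf] := leP 0 (v f).
  by exists (insubd 0 f), 1; rewrite oner_neq0 insubd_O// divr1.
have f0 : f != 0 by apply: contraTneq vf => ->; rewrite pval0.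
have vf' : 0 <= v f^-1 by rewrite pvalV oppr_ge0 ltW.
exists 1, (insubd 0 f^-1); split; last by rewrite insubd_O// div1r invrK.
apply/eqP => /(congr1 val); rewrite insubd_O//= => /eqP.
by rewrite invr_eq0 (negPf f0).
Qed.

Lemma local_embM f g : local_emb (f * g) = local_emb f * local_emb g.
Proof.
have [a [b [b0 fe]]] := O_fracP f; have [c [d [d0 ge]]] := O_fracP g.
rewrite (local_emb_frac b0 fe) (local_emb_frac d0 ge).
rewrite mulf_div -!tofracM -!loc_hatM; apply: local_emb_frac.
  by rewrite mulf_neq0.
by rewrite fe ge mulf_div.
Qed.

Lemma local_emb1 : local_emb 1 = 1.
Proof.
have o0 : (1 : O) != 0 by exact: oner_neq0.
by rewrite (@local_emb_frac 1 1 1)// ?divr1// loc_hat1 tofrac1 divr1.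
Qed.

Definition residue_field := trunc v 0.
HB.instance Definition _ := GRing.ComNzRing.on residue_field.
Definition residue_scal (c : k) : residue_field := tpi 0 (subalg_scal (place_ring v) c).

(* The dimension of the residue field over k. *)
Definition degree : nat :=
  xget 0%N [set d | exists e : 'I_d -> residue_field,
    forall y, exists! c : {ffun 'I_d -> k},
      y = \sum_i residue_scal (c i) * e i].

Definition rational_place : Prop :=
  forall y : residue_field, exists c, y = residue_scal c.

End LocalField.

Lemma sub_finite_setU (T : Type) (A B C : set T) :
  finite_set B -> finite_set C -> A `<=` B `|` C -> finite_set A.
Proof. by move=> fB fC /sub_finite_set; apply; rewrite finite_setU. Qed.

Lemma mul_sub_mul (R : comPzRingType) (a b c d : R) :
  c * d - a * b = (c - a) * (d - b) + ((c - a) * b + a * (d - b)).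
Proof. by rewrite addrA -mulrDr subrK mulrBl mulrBr addrA subrK. Qed.

Section Units.
Variable R : comPzRingType.

Record units := Units {
  uval : R;
  uinv : R;
  uvalK : uval * uinv = 1
}.
HB.instance Definition _ := gen_eqMixin units.
HB.instance Definition _ := gen_choiceMixin units.

Lemma units_inj (a b : units) : uval a = uval b -> a = b.
Proof.
case: a b => [x x' xx] [y y' yy] /= e; subst y.
have e' : x' = y' by rewrite -[x']mul1r -yy mulrAC xx mul1r.
by subst y'; congr Units; apply: Prop_irrelevance.
Qed.

Lemma units_mulP (a b : units) : uval a * uval b * (uinv a * uinv b) = 1.
Proof. by rewrite mulrACA !uvalK mulr1. Qed.
Definition units_mul a b := Units (units_mulP a b).
Definition units_one := Units (mulr1 (1 : R)).
Lemma units_invP (a : units) : uinv a * uval a = 1.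
Proof. by rewrite mulrC uvalK. Qed.
Definition units_inv a := Units (units_invP a).

Lemma units_mulA : associative units_mul.
Proof. by move=> a b c; apply/units_inj/mulrA. Qed.
Lemma units_mulC : commutative units_mul.
Proof. by move=> a b; apply/units_inj/mulrC. Qed.
Lemma units_mul1 : left_id units_one units_mul.
Proof. by move=> a; apply/units_inj/mul1r. Qed.
Lemma units_mulr1 : right_id units_one units_mul.
Proof. by move=> a; apply/units_inj/mulr1. Qed.
Lemma units_mulV : left_inverse units_one units_inv units_mul.
Proof. by move=> a; apply/units_inj; rewrite /= mulrC uvalK. Qed.
Lemma units_mulrV : right_inverse units_one units_inv units_mul.
Proof. by move=> a; apply/units_inj; rewrite /= uvalK. Qed.
HB.instance Definition _ :=
  isGroup.Build units units_mulA units_mul1 units_mulr1 units_mulV units_mulrV.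
End Units.

Section Adeles.
Variables (k F : fieldType) (iota : {rmorphism k -> F}) (X : set (subalg iota)).

(* On a smooth curve the local ring of a closed point is a discrete valuation
   ring, and the point is encoded by its normalized valuation. *)
Definition closed_point := set_type [set v : place iota | X (place_ring v)].
HB.instance Definition _ := Choice.on closed_point.
Definition place_of (x : closed_point) : place iota := set_val x.
Local Coercion place_of : closed_point >-> place.

Local Notation "x .-K" := (local_field (place_of x)) (at level 2, format "x .-K").
Definition kval (x : closed_point) (al : x.-K) : int := fval (@completion_val _ _ _ x) al.
Definition kge (x : closed_point) (n : int) (al : x.-K) : bool :=
  (al == 0) || (n <= kval al).

Section Kge.
Variable x : closed_point.
Implicit Types (n m : int) (al be : x.-K).
Let cmul := @completion_mul _ _ _ x.
Let cadd := @completion_add _ _ _ x.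

Lemma kge0 n : kge n (0 : x.-K). Proof. by rewrite /kge eqxx. Qed.
Lemma kgeN n al : kge n (- al) = kge n al.
Proof. exact: (fgeN cmul). Qed.
Lemma kgeD n al be : kge n al -> kge n be -> kge n (al + be).
Proof. exact: (fgeD cmul cadd). Qed.
Lemma kgeB n al be : kge n al -> kge n be -> kge n (al - be).
Proof.
move=> h1 h2.
apply: kgeD.
exact: h1.
rewrite kgeN.
exact: h2.
Qed.
Lemma kgeM n m al be : kge n al -> kge m be -> kge (n + m) (al * be).
Proof. exact: (fgeM cmul). Qed.
Lemma kge_le n m al : m <= n -> kge n al -> kge m al.
Proof. exact: fge_le. Qed.
Lemma integral_kge0 al : integral al -> kge 0 al.
Proof. exact: integral_kge. Qed.
Lemma kvalM al be : al != 0 -> be != 0 -> kval (al * be) = kval al + kval be.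
Proof. exact: (fvalM cmul). Qed.
Lemma kval1 : kval (1 : x.-K) = 0.
Proof. exact: (fval1 cmul). Qed.
Lemma kvalV al : kval al^-1 = - kval al.
Proof. exact: (fvalV cmul). Qed.
End Kge.

Definition adele_prod := dprod (fun x : closed_point => x.-K : comPzRingType).

Definition almost_integral (a : adele_prod) : bool :=
  `[< finite_set [set x | ~ integral (a x)] >].

Lemma almost_integral_closed : subring_closed almost_integral.
Proof.
split; rewrite ?unfold_in.
- apply/asboolP; rewrite (_ : [set x | _] = set0)//.
  by apply/seteqP; split=> // x []; exists 1; rewrite tofrac1.
- move=> a b /asboolP fa /asboolP fb; apply/asboolP.
  apply: (sub_finite_setU fa fb).
  move=> x /= h; apply: contrapT => /not_orP[/contrapT[a' ae] /contrapT[b' be]].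
  by apply: h; exists (a' - b'); rewrite tofracB -ae -be.
- move=> a b /asboolP fa /asboolP fb; apply/asboolP.
  apply: (sub_finite_setU fa fb).
  move=> x /= h; apply: contrapT => /not_orP[/contrapT[a' ae] /contrapT[b' be]].
  by apply: h; exists (a' * b'); rewrite tofracM -ae -be.
Qed.
HB.instance Definition _ :=
  GRing.isSubringClosed.Build adele_prod almost_integral almost_integral_closed.

Definition adele : Type := {a : adele_prod | almost_integral a}.
HB.instance Definition _ := SubType.on adele.
HB.instance Definition _ := Choice.on adele.
HB.instance Definition _ :=
  GRing.SubChoice_isSubComPzRing.Build _ _ adele (subringClosedP _).

Definition divisor (D : closed_point -> int) : Prop :=
  finite_set [set x | D x != 0].

Definition adele_ball (D : closed_point -> int) (a : adele) : set adele :=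
  [set b | forall x, kge (D x) (val b x - val a x)].

(* The sets adele_ball D 0 are the basic neighborhoods U_D of 0. *)
Definition adele_open (A : set adele) : Prop :=
  forall a, A a -> exists2 D, divisor D & adele_ball D a `<=` A.

Lemma adele_openT : adele_open setT.
Proof.
move=> a _; exists (fun=> 0) => //.
by rewrite /divisor (_ : [set x | _] = set0)// -subset0 => x /negP; apply.
Qed.

Lemma kge_max (x : closed_point) n m (al : x.-K) :
  kge (Num.max n m) al -> kge n al /\ kge m al.
Proof. by move=> h; split; apply: kge_le h; rewrite le_max lexx ?orbT. Qed.

Lemma divisor2 (f : int -> int -> int) D E : f 0 0 = 0 ->
  divisor D -> divisor E -> divisor (fun x => f (D x) (E x)).
Proof.
move=> f0 fD fE; apply: (sub_finite_setU fD fE) => x /= h; apply: contrapT => /not_orP[/negP/negPn/eqP Dx /negP/negPn/eqP Ex].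
by move: h; rewrite Dx Ex f0 eqxx.
Qed.

Lemma adele_openI : setI_closed adele_open.
Proof.
move=> A B oA oB a [/oA[D fD sDA] /oB[E fE sEB]].
exists (fun x => Num.max (D x) (E x)); first exact: (@divisor2 Num.max).
by move=> b h; split; [apply: sDA|apply: sEB] => x; have [] := kge_max (h x).
Qed.

Lemma adele_open_bigU (I : Type) (f : I -> set adele) :
  (forall i, adele_open (f i)) -> adele_open (\bigcup_i f i).
Proof.
move=> of_ a [i _ /of_[D fD sDA]]; exists D => // b /sDA; by exists i.
Qed.

HB.instance Definition _ :=
  isOpenTopological.Build adele adele_openT adele_openI adele_open_bigU.

Lemma adele_openE A : open A = adele_open A. Proof. by []. Qed.

Lemma adele_ball_open D a : divisor D -> open (adele_ball D a).
Proof.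
move=> fD; rewrite adele_openE => b hb; exists D; first exact: fD.
move=> c hc x.
have -> : val c x - val a x = (val c x - val b x) + (val b x - val a x).
  by rewrite addrA subrK.
apply: kgeD; [exact: hc|exact: hb].
Qed.

Lemma adele_ball_nbhs D a : divisor D -> nbhs a (adele_ball D a).
Proof.
move=> fD; apply: open_nbhs_nbhs; split; first exact: adele_ball_open.
by move=> x; rewrite subrr; apply: kge0.
Qed.

Lemma adele_nbhsP (a : adele) A :
  nbhs a A -> exists2 D, divisor D & adele_ball D a `<=` A.
Proof.
rewrite nbhsE => -[B [oB Ba] sBA]; rewrite adele_openE in oB; have [D fD sDB] := oB a Ba.
by exists D => //; apply: subset_trans sBA.
Qed.

Definition pole_bound (a : adele) (x : closed_point) : int :=
  if kge 0 (val a x) then 0 else `|kval (val a x)|.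

Lemma pole_bound_divisor a : divisor (pole_bound a).
Proof.
have /asboolP fa := valP a; apply: sub_finite_set fa => x /= h hi.
by move: h; rewrite /pole_bound integral_kge0// eqxx.
Qed.

Lemma pole_bound_ge0 a x : 0 <= pole_bound a x.
Proof. by rewrite /pole_bound; case: ifP. Qed.

Lemma pole_boundP a x : kge (- pole_bound a x) (val a x).
Proof.
rewrite /pole_bound; case: ifPn => [|_]; first by rewrite oppr0.
by rewrite /kge lerNl -normrN ler_norm orbT.
Qed.

Lemma adele_mul_continuous : continuous (fun p : adele * adele => p.1 * p.2).
Proof.
move=> [a b] W /= /adele_nbhsP[D fD sDW].
pose E x := `|D x| + (pole_bound a x + pole_bound b x).
have fE : divisor E.
  apply: (@divisor2 (fun n m => `|n| + m)) => //.
  by apply: (@divisor2 +%R) => //; exact: pole_bound_divisor.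
exists (adele_ball E a, adele_ball E b).
  by split; apply: adele_ball_nbhs.
move=> [a' b'] [/= ha hb]; apply: sDW => x /=.
have -> : val (a' * b') x - val (a * b) x =
    (val a' x - val a x) * (val b' x - val b x) +
    ((val a' x - val a x) * val b x + val a x * (val b' x - val b x)).
  exact: mul_sub_mul.
have pa := pole_bound_ge0 a x; have pb := pole_bound_ge0 b x.
have dD := ler_norm (D x); have d0 : 0 <= `|D x| by [].
apply: kgeD; last apply: kgeD.
- apply: kge_le (kgeM (ha x) (hb x)); rewrite /E; lia.
- apply: kge_le (kgeM (ha x) (pole_boundP b x)); rewrite /E; lia.
- apply: kge_le (kgeM (pole_boundP a x) (hb x)); rewrite /E; lia.
Qed.

Definition idele := units adele.
HB.instance Definition _ := Group.on idele.

Definition idele_emb (u : idele) : adele * adele := (uval u, uinv u).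
HB.instance Definition _ := Topological.copy idele (initial_topology idele_emb).

Lemma idele_emb_continuous : continuous idele_emb.
Proof. exact: initial_continuous. Qed.

Lemma uval_continuous : continuous (fun u : idele => uval u).
Proof.
exact: (continuous_compT idele_emb_continuous (@continuous_fst adele adele)).
Qed.

Lemma uinv_continuous : continuous (fun u : idele => uinv u).
Proof.
exact: (continuous_compT idele_emb_continuous (@continuous_snd adele adele)).
Qed.

Lemma idele_mul_continuous : continuous (fun p : idele * idele => (p.1 * p.2)%g).
Proof.
have c1 := @continuous_fst idele idele; have c2 := @continuous_snd idele idele.
apply: (@initial_continuousP _ _ _ idele_emb).
apply: (@continuous_pair _ _ _ (fun p : idele * idele => uval p.1 * uval p.2)
  (fun p : idele * idele => uinv p.1 * uinv p.2)).
- have cp := continuous_pair (continuous_compT c1 uval_continuous)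
    (continuous_compT c2 uval_continuous).
  exact: (continuous_compT cp adele_mul_continuous).
- have cp := continuous_pair (continuous_compT c1 uinv_continuous)
    (continuous_compT c2 uinv_continuous).
  exact: (continuous_compT cp adele_mul_continuous).
Qed.

Lemma idele_inv_continuous : continuous (fun u : idele => (u^-1)%g).
Proof.
apply: (@initial_continuousP _ _ _ idele_emb).
exact: (continuous_pair uinv_continuous uval_continuous).
Qed.
HB.instance Definition _ :=
  isTopologicalGroup.Build idele idele_mul_continuous idele_inv_continuous.

Definition idele_comp (u : idele) (x : closed_point) : x.-K := val (uval u) x.

Lemma idele_compM u w x : idele_comp (u * w)%g x = idele_comp u x * idele_comp w x.
Proof. by []. Qed.
Lemma idele_comp1 x : idele_comp 1%g x = 1.
Proof. by []. Qed.
Lemma idele_comp_mulV u x : idele_comp u x * idele_comp u^-1%g x = 1.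
Proof. by rewrite -idele_compM mulgV. Qed.
Lemma idele_comp_neq0 u x : idele_comp u x != 0.
Proof.
apply/eqP => h; have := idele_comp_mulV u x; rewrite h mul0r => /esym/eqP.
by rewrite oner_eq0.
Qed.
Lemma idele_compV u x : idele_comp u^-1%g x = (idele_comp u x)^-1.
Proof.
by apply: (mulfI (idele_comp_neq0 u x)); rewrite idele_comp_mulV mulfV ?idele_comp_neq0.
Qed.
Lemma idele_compB u w x : idele_comp (u / w)%g x = idele_comp u x / idele_comp w x.
Proof. by rewrite idele_compM idele_compV. Qed.

Lemma idele_val_divisor u : divisor (fun x => kval (idele_comp u x)).
Proof.
have /asboolP f1 := valP (uval u); have /asboolP f2 := valP (uinv u).
apply: (sub_finite_setU f1 f2) => x /= h.
apply: contrapT => /not_orP[/contrapT h1 /contrapT h2].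
have := integral_kge0 h1; have := integral_kge0 h2.
rewrite -/(idele_comp u x) -[val (uinv u) x]/(idele_comp u^-1%g x) idele_compV.
rewrite /kge invr_eq0 (negPf (idele_comp_neq0 u x)) /= kvalV oppr_ge0 => h3 h4.
by move/eqP: h; apply; apply/eqP; rewrite eq_le h3 h4.
Qed.

Definition idele_degree (u : idele) : int :=
  \sum_(x \in [set: closed_point]) (degree (place_of x))%:Z * kval (idele_comp u x).

Lemma idele_degreeB u w :
  idele_degree (u / w)%g = idele_degree u - idele_degree w.
Proof.
pose P := [set x | kval (idele_comp u x) != 0] `|` [set x | kval (idele_comp w x) != 0].
have fP : finite_set P.
  by rewrite finite_setU; split; exact: idele_val_divisor.
have E (t : idele) : (forall x, ~ P x -> kval (idele_comp t x) = 0) ->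
    idele_degree t = \sum_(x \in P) (degree (place_of x))%:Z * kval (idele_comp t x).
  move=> h; apply/esym/fsbig_widen => // x [_ Px] /=.
  by rewrite h// mulr0.
have nP x : ~ P x -> kval (idele_comp u x) = 0 /\ kval (idele_comp w x) = 0.
  by move=> /not_orP[/negP/negPn/eqP ux /negP/negPn/eqP wx]; split.
have hu : idele_degree u = \sum_(x \in P) (degree (place_of x))%:Z * kval (idele_comp u x).
  by apply: E => x /nP[].
have hw : idele_degree w = \sum_(x \in P) (degree (place_of x))%:Z * kval (idele_comp w x).
  by apply: E => x /nP[].
have kB x : kval (idele_comp (u / w)%g x) = kval (idele_comp u x) - kval (idele_comp w x).
  by rewrite idele_compB kvalM ?invr_eq0 ?idele_comp_neq0// kvalV.
have huw : idele_degree (u / w)%g =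
    \sum_(x \in P) (degree (place_of x))%:Z * kval (idele_comp (u / w)%g x).
  by apply: E => x /nP[ux wx]; rewrite kB ux wx subrr.
pose f y x := (degree (place_of x))%:Z * kval (idele_comp y x).
have key : \sum_(x \in P) f u x = \sum_(x \in P) (f (u / w)%g x + f w x).
  by apply: eq_fsbigr => x _; rewrite /f kB -mulrDr subrK.
have key2 := @fsbig_split _ _ _ (+%R : Monoid.com_law 0) P (f (u / w)%g) (f w) fP.
apply: (addIr (idele_degree w)); rewrite subrK.
apply: (etrans (congr2 +%R huw hw)); apply: (etrans (esym key2)).
exact: (etrans (esym key) (esym hu)).
Qed.

Lemma idele_degree1 : idele_degree 1%g = 0.
Proof. by rewrite -(@mulgV idele 1%g) idele_degreeB subrr. Qed.

Lemma idele_degree0B u w : idele_degree u = 0 -> idele_degree w = 0 ->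
  idele_degree (u / w)%g = 0.
Proof. by move=> hu hw; rewrite idele_degreeB hu hw subrr. Qed.

Definition idele_degree0 : subgroup idele :=
  @Subgroup idele [set u | idele_degree u = 0] idele_degree1 idele_degree0B.
Definition idele1 := subgroup_type idele_degree0.
HB.instance Definition _ := TopGroup.on idele1.

Definition idele1_comp (u : idele1) (x : closed_point) : x.-K := idele_comp (val u) x.

Lemma one_unit_inv (x : closed_point) (al : x.-K) :
  kge 1 (al - 1) -> kge 0 al^-1.
Proof.
move=> h; rewrite /kge invr_eq0 kvalV oppr_ge0.
have [->//|al0 /=] := eqVneq al 0; rewrite leNgt; apply/negP => hal.
have : kge 1 (al - (al - 1)).
  by apply: kgeB; [rewrite /kge -gtz0_ge1 hal orbT|exact: h].
by rewrite opprB addrC subrK /kge kval1 oner_eq0.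
Qed.

(* The product of the groups 1 + m_x. *)
Definition one_units_set : set idele1 :=
  [set u | forall x, kge 1 (idele1_comp u x - 1)].

Lemma one_units1 : one_units_set 1%g.
Proof. by move=> x; rewrite subrr; apply: kge0. Qed.

Lemma one_unitsB u w : one_units_set u -> one_units_set w ->
  one_units_set (u / w)%g.
Proof.
move=> hu hw x.
have -> : idele1_comp (u / w)%g x = idele1_comp u x / idele1_comp w x by exact: idele_compB.
have w0 : idele1_comp w x != 0 by exact: idele_comp_neq0.
have -> : idele1_comp u x / idele1_comp w x - 1 =
    ((idele1_comp u x - 1) - (idele1_comp w x - 1)) * (idele1_comp w x)^-1.
  by rewrite opprB addrA subrK mulrBl divff.
have h1 := kgeB (hu x) (hw x); have h2 := one_unit_inv (hw x).
by have := kgeM h1 h2; rewrite addr0.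
Qed.

Definition one_units_sub : subgroup idele1 :=
  @Subgroup idele1 one_units_set one_units1 one_unitsB.

Lemma idele1_mulC (u w : idele1) : (u * w = w * u)%g.
Proof. by apply/val_inj/units_mulC. Qed.

Lemma one_unitsJ u w : one_units_set u -> one_units_set (u ^ w)%g.
Proof. by rewrite conjgE (idele1_mulC u w) mulKg. Qed.

Definition one_units : normal_subgroup idele1 :=
  @NormalSubgroup idele1 one_units_sub one_unitsJ.

Definition idele1_bar := quot_group one_units.
HB.instance Definition _ := TopGroup.on idele1_bar.

(* The image of F^* embedded diagonally. On a complete curve every f <> 0
   contributes, since the principal ideles have degree 0. *)
Definition principal_set : set idele1_bar :=
  [set c | exists (f : F) (u : idele1), [/\ f != 0,
     forall x, idele1_comp u x = local_emb (place_of x) f & c = qpi one_units u]].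

Lemma principal1 : principal_set 1%g.
Proof.
exists 1, 1%g; split; [exact: oner_neq0| |by []].
by move=> x; rewrite local_emb1.
Qed.

Lemma principalB c d : principal_set c -> principal_set d ->
  principal_set (c / d)%g.
Proof.
move=> [f [u [f0 hu ->]]] [g [w [g0 hw ->]]].
exists (f / g), (u / w)%g; split; first by rewrite mulf_neq0 ?invr_eq0.
  move=> x; have -> : idele1_comp (u / w)%g x = idele1_comp u x / idele1_comp w x by exact: idele_compB.
  have w0 : idele1_comp w x != 0 by exact: idele_comp_neq0.
  apply: (mulIf w0); rewrite divfK// hu hw -local_embM divfK//.
by rewrite -[RHS](qpiM one_units u w^-1%g) -[qpi _ w^-1%g]qpiV.
Qed.

Definition principal_sub : subgroup idele1_bar :=
  @Subgroup idele1_bar principal_set principal1 principalB.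

Lemma idele1_bar_mulC (c d : idele1_bar) : (c * d = d * c)%g.
Proof.
elim/quotW: c => u; elim/quotW: d => w.
apply: (etrans (qpiM one_units u w)).
by apply: (etrans _ (esym (qpiM one_units w u))); rewrite idele1_mulC.
Qed.

Lemma principalJ c d : principal_set c -> principal_set (c ^ d)%g.
Proof. by rewrite conjgE (idele1_bar_mulC c d) mulKg. Qed.

Definition principal : normal_subgroup idele1_bar :=
  @NormalSubgroup idele1_bar principal_sub principalJ.

Definition idele1_bar_mod_principal : topGroupType := quot_group principal.

Definition rational_point (x : closed_point) : Prop :=
  forall y : residue_field (place_of x), exists c, y = residue_scal (place_of x) c.

End Adeles.

Definition perfect_field (k : fieldType) : Prop :=
  forall p : {poly k}, irreducible_poly p -> separable_poly p.

Definition algebraically_closed_in (k F : fieldType) (iota : {rmorphism k -> F}) :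
    Prop :=
  forall f, algebraicOver iota f -> exists c, f = iota c.

(* Main.v *)
(** The group in question is always Hausdorff and zero-dimensional: two idele
    classes are separated by the open-closed set of classes congruent to the
    first one, up to principal ideles, modulo the units that are one-units on a
    finite set S of points.

    If the group is compact, a nonconstant function with a zero at P has a pole
    at some x <> P.  For c in k^* let a_c be the idele equal to c at x and to 1
    elsewhere.  If a_c and a_d are congruent for S = {P, x}, the comparing function
    is regular everywhere, hence constant, equal to 1 at P and to c / d at x, so
    that c = d.  The congruence classes are open, so k is finite.

    If k is finite, every degree-zero divisor D satisfies: D + cP is equivalent
    to an effective divisor, for a constant c independent of D (Riemann).  There
    are only finitely many effective divisors of degree c, so the group is a
    finite union of translates of the image of the product of the residue
    groups k(x)^*, which is compact by Tychonoff.

    That the local rings are discrete valuation rings comes from smoothness: if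
    L is a coefficient algebra of A modulo m^2, the projection of A = L + m onto
    m/m^2 is a derivation, so that the freeness of the differentials makes m/m^2
    cyclic, and m is principal by Nakayama's lemma. *)

Require Import Defs.
From HB Require Import structures.
From mathcomp Require Import all_boot all_order all_algebra separable finmap zify ring.
From mathcomp Require Import all_classical topology.

Set Implicit Arguments.
Unset Strict Implicit.
Unset Printing Implicit Defensive.
Import Order.TTheory GRing.Theory Num.Theory.
Local Open Scope classical_set_scope.
Local Open Scope quotient_scope.
Local Open Scope ring_scope.

(** Transcendence degree one enters through one consequence: for transcendental b, every y satisfies
    Q(y) = b r with Q a nonzero polynomial over k and r in any algebra containing b and y. This
    makes k[s]/b and A/bA finite-dimensional, which gives the finite generation of m for Nakayama's
    lemma, and it makes repeated division by a generator of m terminate. Perfectness makes residues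
    separable, so that a Newton step modulo m^2 lifts them and builds L.

    Regular functions are constant by Chevalley's argument: for transcendental f, a subalgebra
    maximal among those containing f^-1 and not f is a valuation ring; by completeness it dominates
    a local ring of X, and f has a pole there.

    For finite k, dimensions of Riemann-Roch spaces become cardinalities, bounded by powers of q =
    |k|. Lower bounds come from expansions in powers of a function t, whose digits are residues
    along the poles of t. Compared with upper bounds for all powers of t, they show that t has as
    many zeros as poles; for one fixed t they yield the constant c, the degree of a divisor bounding
    the poles of the digits. *)

Local Notation "x \inS A" := (subalg_set A x) (at level 70).

(** * Fields of transcendence degree one *)

Section AlgebraicDependence.
Variables (k F : fieldType) (iota : {rmorphism k -> F}).

Definition ev (z : F) (p : {poly k}) : F := (map_poly iota p).[z].
HB.instance Definition _ z := GRing.RMorphism.copy (ev z) (horner_eval z \o map_poly iota).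

Arguments ev : simpl never.

Lemma evE z p : ev z p = (map_poly iota p).[z]. Proof. by []. Qed.
Lemma evX z : ev z 'X = z. Proof. by rewrite evE map_polyX hornerX. Qed.
Lemma evC z c : ev z c%:P = iota c. Proof. by rewrite evE map_polyC hornerC. Qed.

Lemma evMXaddC z p c : ev z (p * 'X + c%:P) = ev z p * z + iota c.
Proof. by rewrite rmorphD rmorphM /= evX evC. Qed.

Section RationalFunctions.
Variable z : F.

(** The field k(z) inside F; it becomes the [fieldType] [ratfun] below, so that algebraicity and
    integrality over k(z) can be expressed. *)
Definition ratfun_mem : {pred F} :=
  fun f => `[< exists p q, ev z q != 0 /\ f = ev z p / ev z q >].

Lemma ratfun_closed : divring_closed ratfun_mem.
Proof.
split.
- by apply/asboolP; exists 1, 1; rewrite !rmorph1 oner_eq0 divr1.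
- move=> f g /asboolP[p [q [q0 ->]]] /asboolP[p' [q' [q0' ->]]].
  apply/asboolP; exists (p * q' - p' * q), (q * q').
  rewrite rmorphB !rmorphM mulf_neq0//; split=> //.
  by rewrite -[ev z p' * _]opprK -mulNr opprK -(addf_div _ (- ev z p') q0 q0') mulNr.
- move=> f g /asboolP[p [q [q0 ->]]] /asboolP[p' [q' [q0' ->]]].
  have [p0'|p0'] := eqVneq (ev z p') 0.
    by apply/asboolP; exists 0, 1; rewrite p0' rmorph0 rmorph1 oner_eq0 !(mul0r, invr0, mulr0).
  apply/asboolP; exists (p * q'), (q * p').
  by rewrite !rmorphM mulf_neq0//; split=> //; rewrite invf_div mulf_div.
Qed.
HB.instance Definition _ := GRing.isDivringClosed.Build F ratfun_mem ratfun_closed.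

Definition ratfun := {f : F | ratfun_mem f}.
HB.instance Definition _ := SubType.on ratfun.
HB.instance Definition _ := Choice.on ratfun.
HB.instance Definition _ := [SubChoice_isSubIntegralDomain of ratfun by <:].
HB.instance Definition _ := [SubIntegralDomain_isSubField of ratfun by <:].

Definition ratfun_val : ratfun -> F := val.
Arguments ratfun_val : simpl never.
HB.instance Definition _ := GRing.RMorphism.copy ratfun_val (val : ratfun -> F).

Lemma ev_ratfun p : ev z p \in ratfun_mem.
Proof. by apply/asboolP; exists p, 1; rewrite rmorph1 oner_eq0 divr1. Qed.

Definition ratfun_of p : ratfun := exist _ (ev z p) (ev_ratfun p).

(** One common denominator is carried along the coefficients; clearing it turns a relation over k(z)
    into one over k[z]. *)
Lemma ratfun_clear_denominators (p : {poly ratfun}) : exists d U,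
  ev z d != 0 /\ map_poly (ev z) U = ev z d *: map_poly ratfun_val p.
Proof.
elim/poly_ind: p => [|p c [d [U [d0 e]]]].
  by exists 1, 0; rewrite !rmorph1 !map_poly0 scaler0 oner_eq0.
have /asboolP[a [b [b0 ce]]] := valP c; rewrite -[val c]/(ratfun_val c) in ce.
exists (d * b), (U * 'X * b%:P + (a * d)%:P).
rewrite rmorphM mulf_neq0//; split=> //.
have -> : map_poly (ev z) (U * 'X * b%:P + (a * d)%:P) =
    map_poly (ev z) U * 'X * (ev z b)%:P + (ev z a * ev z d)%:P.
  by rewrite rmorphD !rmorphM /= map_polyX !map_polyC.
have -> : map_poly ratfun_val (p * 'X + c%:P) = map_poly ratfun_val p * 'X + (ev z a / ev z b)%:P.
  by rewrite rmorphD rmorphM /= map_polyX map_polyC /= ce.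
rewrite e rmorphM -!mul_polyC !polyCM /=; have : (ev z b)%:P * ((ev z b)^-1)%:P = 1.
  by rewrite -polyCM divff.
move: (_%:P) (ev z b)%:P (ev z b)^-1%:P (ev z a)%:P (map_poly _ _) => D B B' A p' h.
rewrite mulrDr; congr (_ + _); first by ring.
by rewrite -[LHS]mulr1 -h; ring.
Qed.
End RationalFunctions.

(** A relation U(z, a) = 0 in two variables: the coefficients of U are evaluated at z, its outer
    variable at a. *)
Definition dependent (z a : F) : Prop :=
  exists2 U : {poly {poly k}}, U != 0 & (map_poly (ev z) U).[a] = 0.

Lemma ev_eval2 z a (U : {poly {poly k}}) :
  (map_poly (ev z) U).[a] = (map_poly (map_poly iota) U).[a%:P].[z].
Proof.
have -> : map_poly (ev z) U = map_poly (horner_eval z) (map_poly (map_poly iota) U).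
  by rewrite -map_poly_comp.
by rewrite -[a in LHS](hornerC a z) -[(a%:P).[z]]/(horner_eval z a%:P) horner_map.
Qed.

Lemma ev_swapXY z a (U : {poly {poly k}}) :
  (map_poly (ev z) (swapXY U)).[a] = (map_poly (ev a) U).[z].
Proof. by rewrite !ev_eval2 -(swapXY_map iota) horner2_swapXY. Qed.

Lemma dependent_sym z a : dependent z a -> dependent a z.
Proof.
by move=> [U U0 e]; exists (swapXY U); rewrite ?swapXY_eq0 ?ev_swapXY.
Qed.

Lemma dependent_algebraic z a : dependent z a -> ~ algebraicOver iota z ->
  algebraicOver (@ratfun_val z) a.
Proof.
move=> [U U0 e] nz.
have evz p : (ev z p == 0) = (p == 0).
  apply/idP/idP => [h|/eqP->]; last by rewrite rmorph0.
  by apply: contra_notT nz => p0; exists p.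
pose f (p : {poly k}) : ratfun z := ratfun_of z p.
have fE p : ratfun_val (f p) = ev z p by [].
have f0 : f 0 = 0 by apply: val_inj; apply: (rmorph0 (ev z)).
exists (map_poly f U).
  apply: contraNneq U0 => h; apply/eqP/polyP => i; rewrite coef0.
  have := congr1 (fun p : {poly _} => ratfun_val p`_i) h; rewrite coef_map_id0// fE coef0 rmorph0 => /eqP.
  by rewrite evz => /eqP.
rewrite /root -map_poly_comp_id0//; apply/eqP; rewrite -[RHS]e.
by congr (_.[_]); apply: eq_map_poly.
Qed.

Lemma algebraic_dependent z a :
  algebraicOver (@ratfun_val z) a -> dependent z a.
Proof.
move=> [p p0 /eqP pa]; have [d [U [d0 e]]] := ratfun_clear_denominators p.
exists U; last by rewrite e hornerZ pa mulr0.
apply: contraNneq p0 => U0; move: e; rewrite U0 rmorph0 => /esym/eqP.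
by rewrite scaler_eq0 (negPf d0) /= map_poly_eq0.
Qed.

(** Transitivity of integrality over the field k(z): t is integral over it, hence so are the
    coefficients U_i(t), and a is a root of a nonzero polynomial with these coefficients. *)
Lemma dependent_trans z t a : ~ algebraicOver iota z -> ~ algebraicOver iota t ->
  dependent z t -> dependent t a -> dependent z a.
Proof.
move=> nz nt zt [U U0 e]; apply/algebraic_dependent/integral_algebraic.
have /integral_algebraic tz := dependent_algebraic zt nz.
apply: (@integral_root _ _ _ (map_poly (ev t) U)).
- apply: contraNneq U0 => h; apply/eqP/polyP => i; rewrite coef0.
  have := congr1 (fun p : {poly _} => p`_i) h; rewrite coef_map/= coef0 => h'.
  by apply: contra_notP nt => /eqP Ui0; exists U`_i => //; apply/eqP.
- exact/eqP.
apply/integral_poly => i; rewrite coef_map /= evE.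
apply: integral_horner => //; apply/integral_poly => j.
have -> : (map_poly iota U`_i)`_j = ev z (U`_i`_j)%:P by rewrite coef_map evC.
rewrite -[ev z _]/(ratfun_val (ratfun_of z (U`_i`_j)%:P)).
exact: integral_id.
Qed.

Lemma ev0_notin z : ~ algebraicOver iota z -> forall p, p != 0 -> ev z p != 0.
Proof. by move=> nz p p0; apply: contra_notN nz => e; exists p. Qed.

Section SubalgTheory.
Variable A : subalg iota.

Lemma sa0 : 0 \inS A. Proof. by rewrite -(rmorph0 iota); apply: sa_const. Qed.
Lemma sa1 : 1 \inS A. Proof. by rewrite -(rmorph1 iota); apply: sa_const. Qed.
Lemma saN x : x \inS A -> - x \inS A.
Proof. by rewrite -sub0r; apply/saB/sa0. Qed.
Lemma saD x y : x \inS A -> y \inS A -> x + y \inS A.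
Proof. by move=> Ax Ay; rewrite -[y]opprK; apply/saB/saN. Qed.
Lemma saX x n : x \inS A -> x ^+ n \inS A.
Proof. by move=> Ax; elim: n => [|n IH]; rewrite ?exprS; [apply: sa1|apply: saM]. Qed.
Lemma sa_sum (I : Type) (r : seq I) (f : I -> F) :
  (forall i, f i \inS A) -> \sum_(i <- r) f i \inS A.
Proof. by move=> h; apply: big_ind => //; [apply: sa0|apply: saD]. Qed.
Lemma sa_horner (p : {poly F}) x : (forall i, p`_i \inS A) -> x \inS A -> p.[x] \inS A.
Proof.
by move=> hp Ax; rewrite horner_coef; apply: sa_sum => i; apply: saM => //; apply: saX.
Qed.
Lemma sa_ev x p : x \inS A -> ev x p \inS A.
Proof. by apply: sa_horner => i; rewrite coef_map; apply: sa_const. Qed.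
End SubalgTheory.

(** Since b != 0, powers of the outer variable can be removed from U until its constant coefficient
    Q is nonzero; the relation then shows Q(y) to be b times a polynomial in b and y. Q is chosen
    before the algebra A. *)
Lemma dependent_div (b y : F) (U : {poly {poly k}}) : b != 0 -> U != 0 ->
  (map_poly (ev y) U).[b] = 0 ->
  exists2 Q, Q != 0 & forall A : subalg iota, b \inS A -> y \inS A ->
    exists2 r, r \inS A & ev y Q = b * r.
Proof.
move=> b0; elim/poly_ind: U => [|U c IH]; first by rewrite eqxx.
have [->|c0] := eqVneq c 0.
  rewrite addr0 mulf_eq0 negb_or => /andP[U0 _].
  rewrite rmorphM/= map_polyX hornerM hornerX => /eqP.
  by rewrite mulf_eq0 (negPf b0) orbF => /eqP; apply: IH.
move=> _; rewrite rmorphD rmorphM/= map_polyX map_polyC hornerD hornerM hornerX hornerC => e.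
exists c => // A Ab Ay; exists (- (map_poly (ev y) U).[b]); last first.
  by rewrite mulrN mulrC; apply/eqP; rewrite -addr_eq0 addrC; apply/eqP.
by apply/saN/sa_horner => // i; rewrite coef_map; apply: sa_ev.
Qed.

Section TranscendenceDegree1.
Hypothesis tr1 : transcendence_degree1 iota.

Lemma trdeg1_dependent z a : ~ algebraicOver iota z -> dependent z a.
Proof.
case: tr1 => t [nt ht] nz.
have dt f : dependent t f by have [U U0 e] := ht f; exists U.
exact/(dependent_trans nz nt)/dt/dependent_sym/dt.
Qed.

(** The form in which transcendence degree one is used from here on: modulo a transcendental b,
    every y is algebraic over k. *)
Lemma trdeg1_div (b y : F) : ~ algebraicOver iota b ->
  exists2 Q, Q != 0 & forall A : subalg iota, b \inS A -> y \inS A ->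
    exists2 r, r \inS A & ev y Q = b * r.
Proof.
move=> nb; have [U U0 e] := dependent_sym (trdeg1_dependent y nb).
apply: dependent_div U0 e; apply: contra_notN nb => /eqP->; exact: algebraic0.
Qed.
End TranscendenceDegree1.

End AlgebraicDependence.

(** * Linear algebra over k modulo a subspace of F *)

Section SpanModulo.
Variables (k F : fieldType) (iota : {rmorphism k -> F}).
Implicit Types (E : seq F) (I W : set F).

(** Membership in I plus the k-span of E, with the coefficients peeled off one at a time so that
    proofs go by induction on E. *)
Fixpoint spanmod E I (f : F) : Prop :=
  if E is e :: E' then exists c, spanmod E' I (f - iota c * e) else I f.

Definition subspace W : Prop :=
  [/\ W 0, forall x y, W x -> W y -> W (x - y) & forall c x, W x -> W (iota c * x)].

Lemma subspaceD W x y : subspace W -> W x -> W y -> W (x + y).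
Proof.
by move=> [W0 WB _] Wx Wy; rewrite -[y]opprK -[- y]sub0r; apply: (WB) => //; apply: WB.
Qed.

Lemma spanmod_subspace E I : subspace I -> subspace (spanmod E I).
Proof.
move=> hI; elim: E => [//|e E [h0 hB hZ]]; split=> /=.
- by exists 0; rewrite rmorph0 mul0r subr0.
- move=> x y [c hc] [d hd]; exists (c - d).
  suff -> : x - y - iota (c - d) * e = (x - iota c * e) - (y - iota d * e) by apply: hB.
  by rewrite rmorphB; ring.
- move=> d x [c hc]; exists (d * c).
  by rewrite rmorphM -mulrA -mulrBr; apply: hZ.
Qed.

Lemma sub_spanmod E I : subspace I -> I `<=` spanmod E I.
Proof.
move=> hI; elim: E => [//|e E IH] f If /=.
by exists 0; rewrite rmorph0 mul0r subr0; apply: IH.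
Qed.

Lemma mem_spanmod E I e : subspace I -> e \in E -> spanmod E I e.
Proof.
move=> hI; elim: E => [//|e' E IH]; rewrite inE => /predU1P[->|/IH h] /=.
  by exists 1; rewrite rmorph1 mul1r subrr; case: (spanmod_subspace E hI).
by exists 0; rewrite rmorph0 mul0r subr0.
Qed.

Lemma spanmod_min E I W : subspace W -> I `<=` W -> (forall e, e \in E -> W e) ->
  spanmod E I `<=` W.
Proof.
move=> hW IW; elim: E => [_|e E IH hE] /= f; first exact: IW.
move=> [c] /IH h; rewrite -(subrK (iota c * e) f); apply: subspaceD => //.
  by apply: h => e' e'E; apply: hE; rewrite inE e'E orbT.
by case: hW => _ _; apply; apply: hE; rewrite inE eqxx.
Qed.

Lemma spanmod_sub E I J : I `<=` J -> spanmod E I `<=` spanmod E J.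
Proof. by move=> IJ; elim: E => [//|e E IH] f /= [c /IH h]; exists c. Qed.

(** Gaussian elimination: if some a in W involves the first generator e, subtracting a multiple of a
    from any other element of W cancels e and leaves an element of W in the span of the remaining
    generators. *)
Lemma spanmod_finite_dim E I W : subspace I -> subspace W -> I `<=` W ->
  W `<=` spanmod E I ->
  exists2 E', (forall e, e \in E' -> W e) & W `<=` spanmod E' I.
Proof.
move=> hI; elim: E W => [|e E IH] W hW IW WE; first by exists [::].
have [W0 WB WZ] := hW; have [S0 SB SZ] := spanmod_subspace E hI.
pose W' := W `&` spanmod E I.
have hW' : subspace W'.
  split; first by split.
    by move=> x y [? ?] [? ?]; split; [apply: WB|apply: SB].
  by move=> c x [? ?]; split; [apply: WZ|apply: SZ].
have [||E' hE' WE'] := IH W' hW'.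
- by move=> f If; split; [apply: IW|apply: sub_spanmod].
- by move=> f [].
have [ex|nex] := pselect (exists2 a, W a & ~ spanmod E I a); last first.
  exists E' => [e' /hE'[]//|f Wf]; apply: WE'; split=> //.
  by apply: contrapT => h; apply: nex; exists f.
have [a Wa na] := ex; exists (a :: E').
  by move=> e'; rewrite inE => /predU1P[->//|/hE'[]].
move=> f Wf; have [/= c hc] := WE _ Wa; have [/= d hd] := WE _ Wf.
have c0 : c != 0 by apply: contra_notN na => /eqP c0; move: hc; rewrite c0 rmorph0 mul0r subr0.
exists (d / c); apply: WE'; split; first by apply: WB => //; apply: WZ.
have -> : f - iota (d / c) * a = (f - iota d * e) - iota (d / c) * (a - iota c * e).
  rewrite mulrBr mulrA -rmorphM divfK//; ring.
by apply: SB => //; apply: SZ.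
Qed.
End SpanModulo.

(** * Finiteness of k[s] modulo a transcendental element *)

Section FiniteQuotients.
Variables (k F : fieldType) (iota : {rmorphism k -> F}).
Local Notation spanmod := (@spanmod k F iota).
Local Notation subspace := (@subspace k F iota).

Definition scaled (b : F) (A : set F) : set F := [set f | exists2 r, A r & f = b * r].

Lemma scaled_subspace b (A : subalg iota) : subspace (scaled b A).
Proof.
split.
- by exists 0; rewrite ?mulr0//; apply: sa0.
- by move=> x y [r Ar ->] [t At ->]; exists (r - t); rewrite ?mulrBr//; apply: saB.
- move=> c x [r Ar ->]; exists (iota c * r); last by rewrite mulrCA.
  by apply: saM => //; apply: sa_const.
Qed.

Lemma generated_const (s : seq F) c : generated iota s (iota c).
Proof. by move=> A _; apply: sa_const. Qed.
Lemma generatedB (s : seq F) x y :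
  generated iota s x -> generated iota s y -> generated iota s (x - y).
Proof. by move=> hx hy A hA; apply: saB; [apply: hx|apply: hy]. Qed.
Lemma generatedM (s : seq F) x y :
  generated iota s x -> generated iota s y -> generated iota s (x * y).
Proof. by move=> hx hy A hA; apply: saM; [apply: hx|apply: hy]. Qed.
Definition gen_subalg s : subalg iota :=
  Subalg (@generated_const s) (@generatedB s) (@generatedM s).

Arguments gen_subalg : simpl never.

Lemma mem_gen s y : y \in s -> y \inS gen_subalg s.
Proof. by move=> ys A; apply. Qed.

Hypothesis tr1 : transcendence_degree1 iota.

(* Each generator is a root, modulo b, of a polynomial over k, so finitely many
   monomials in the generators suffice. *)
Lemma monomials_mod_finite (R : subalg iota) (s : seq F) b :
  b \inS R -> ~ algebraicOver iota b -> (forall y, y \in s -> y \inS R) ->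
  exists E : seq F, [/\ (forall e, e \in E -> e \inS R), spanmod E (scaled b R) 1 &
    forall y, y \in s -> forall f,
      spanmod E (scaled b R) f -> spanmod E (scaled b R) (f * y)].
Proof.
move=> Rb nb; set I := scaled b R.
have hI : subspace I by apply: scaled_subspace.
have IM x y : I x -> y \inS R -> I (x * y).
  by move=> [r Rr ->] Ry; exists (r * y); rewrite ?mulrA//; apply: saM.
elim: s => [_|y s' IH hs].
  exists [:: 1]; split=> //; last by apply: mem_spanmod; rewrite ?inE.
  by move=> e; rewrite inE => /eqP ->; apply: sa1.
have [|E [hE E1 ME]] := IH.
  by move=> t ts; apply: hs; rewrite inE ts orbT.
have Ry : y \inS R by apply: hs; rewrite inE eqxx.
have [Q Q0 /(_ R Rb Ry)[r Rr e]] := trdeg1_div tr1 y nb.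
pose d := (size Q).-1.
pose E' := [seq x * y ^+ i | x <- E, i <- seq.iota 0 d].
have hE' e' : e' \in E' -> e' \inS R.
  by move=> /allpairsP[[x i] /= [xE _ ->]]; apply: saM; [apply: hE|apply: saX].
have [W0 WB WZ] := spanmod_subspace E' hI.
have Epow : forall j x, x \in E -> spanmod E' I (x * y ^+ j).
  elim/ltn_ind => j IHj x xE; have [jd|dj] := ltnP j d.
    apply: mem_spanmod => //; apply/allpairsP; exists (x, j); split=> //.
    by rewrite mem_iota.
  have lQ : iota (lead_coef Q) != 0 by rewrite fmorph_eq0 lead_coef_eq0.
  have sQ : size Q = d.+1 by rewrite prednK // size_poly_gt0.
  (* L collects the lower terms of Q(y) x y^(j-d). Solving Q(y) = b r for its leading term expresses
     x y^j by smaller powers of y and an element of I. *)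
  pose L := \sum_(i < d) iota Q`_i * (x * y ^+ (i + (j - d))).
  have -> : x * y ^+ j = iota (lead_coef Q)^-1 * (b * (r * (x * y ^+ (j - d))) - L).
    apply: (mulfI lQ); rewrite fmorphV mulVKf// mulrA -e mulrCA.
    rewrite evE horner_coef size_map_poly sQ big_ord_recr /= coef_map mulrDl.
    rewrite [X in _ = X + _ - _]mulr_suml [X in _ = X + _ - _](_ : _ = L).
      rewrite addrAC subrr add0r -[in LHS](subnKC dj) exprD /lead_coef -/d; ring.
    apply: eq_bigr => i _; rewrite coef_map exprD; ring.
  apply: (WZ); apply: (WB).
    apply: sub_spanmod => //; exists (r * (x * y ^+ (j - d))) => //.
    by apply: saM => //; apply: saM; [apply: hE|apply: saX].
  rewrite /L; apply: big_ind => // [u v hu hv|i _].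
    exact: (subspaceD (spanmod_subspace E' hI)).
  by apply: WZ; apply: IHj => //; have := ltn_ord i; lia.
have WM f j : spanmod E I f -> spanmod E' I (f * y ^+ j).
  apply: (@spanmod_min _ _ _ E I [set f | spanmod E' I (f * y ^+ j)]).
  - split=> [|u v hu hv|c u hu] /=; first by rewrite mul0r.
      by rewrite mulrBl; apply: WB.
    by rewrite -mulrA; apply: WZ.
  - by move=> u Iu /=; apply: sub_spanmod => //; apply: IM => //; apply: saX.
  - by move=> u uE /=; apply: Epow.
exists E'; split=> //; first by rewrite -[1]mulr1 -{2}(expr0 y); apply: WM.
move=> t; rewrite inE => ts f.
apply: (@spanmod_min _ _ _ E' I [set f | spanmod E' I (f * t)]).
- split=> [|u v hu hv|c u hu] /=; first by rewrite mul0r.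
    by rewrite mulrBl; apply: WB.
  by rewrite -mulrA; apply: WZ.
- move=> u Iu /=; apply: sub_spanmod => //; apply: IM => //; apply: hs.
  by rewrite inE.
- move=> _ /allpairsP[[x i] /= [xE _ ->]] /=.
  case/predU1P: ts => [->|ts]; first by rewrite -mulrA -exprSr; apply: Epow.
  rewrite mulrAC; apply: WM; apply: ME => //.
  exact: mem_spanmod.
Qed.

Lemma gen_mod_finite (s : seq F) b : b \inS gen_subalg s -> ~ algebraicOver iota b ->
  exists2 E : seq F, (forall e, e \in E -> e \inS gen_subalg s) &
    subalg_set (gen_subalg s) `<=` spanmod E (scaled b (gen_subalg s)).
Proof.
move=> Rb nb; have [E [hE E1 ME]] := monomials_mod_finite Rb nb (@mem_gen s).
set I := scaled b _ in E1 ME *.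
have hI : subspace I by apply: scaled_subspace.
exists E => // f Rf.
have [W0 WB WZ] := spanmod_subspace E hI.
(* The multipliers N preserving the span form a subalgebra that contains s, hence all of k[s]; f is
   then its own product with 1. *)
pose N := [set g | forall w, spanmod E I w -> spanmod E I (w * g)].
have Nc c : N (iota c) by move=> w hw; rewrite mulrC; apply: WZ.
have NB u v : N u -> N v -> N (u - v).
  by move=> hu hv w hw; rewrite mulrBr; apply: WB; [apply: hu|apply: hv].
have NM u v : N u -> N v -> N (u * v).
  by move=> hu hv w hw; rewrite mulrA; apply/hv/hu.
rewrite -[f]mul1r; apply: (Rf (Subalg Nc NB NM)) => // y ys w; exact: ME.
Qed.
End FiniteQuotients.

(** * Local rings of a smooth curve are discrete valuation rings *)

Section LocalRings.
Variables (k F : fieldType) (iota : {rmorphism k -> F}).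

Section Nonunits.
Variable A : subalg iota.
Local Notation m := (nonunits (subalg_set A)).

Definition local_subalg : Prop := forall x y, m x -> m y -> m (x - y).

Lemma nonunits0 : m 0. Proof. by split; [apply: sa0|left]. Qed.
Lemma nonunits_sub x : m x -> x \inS A. Proof. by case. Qed.

Lemma nonunitPn x : x \inS A -> ~ m x -> x != 0 /\ x^-1 \inS A.
Proof.
move=> Ax nx; split.
  by apply: contra_notN nx => /eqP ->; apply: nonunits0.
by apply: contrapT => h; apply: nx; split=> //; right.
Qed.

Lemma unit_nonunit x : x != 0 -> x^-1 \inS A -> ~ m x.
Proof. by move=> x0 Ax [_ [/eqP|//]]; rewrite (negPf x0). Qed.

Lemma nonunits1 : ~ m 1.
Proof. by apply: unit_nonunit; rewrite ?oner_eq0// invr1; apply: sa1. Qed.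

Lemma nonunitsM a x : a \inS A -> m x -> m (a * x).
Proof.
move=> Aa [Ax hx]; split; first exact: saM.
have [->|ax0] := eqVneq (a * x) 0; first by left.
right => h; case: hx => [x0|]; first by rewrite x0 mulr0 eqxx in ax0.
have [a0 x0] : a != 0 /\ x != 0 by apply/andP; rewrite -mulf_eq0_neq0 || (move: ax0; rewrite mulf_eq0 negb_or).
by apply; have := saM Aa h; rewrite invfM mulVKf.
Qed.

Lemma nonunits_prime a b : a \inS A -> b \inS A -> m (a * b) -> m a \/ m b.
Proof.
move=> Aa Ab h; apply: contrapT => /not_orP[/(nonunitPn Aa)[a0 Aa'] /(nonunitPn Ab)[b0 Ab']].
by move: h; apply: unit_nonunit; rewrite ?mulf_neq0// invfM; apply: saM.
Qed.

Hypothesis loc : local_subalg.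

Lemma nonunitsD x y : m x -> m y -> m (x + y).
Proof.
by move=> hx hy; rewrite -[y]opprK; apply: loc => //; rewrite -sub0r; apply: loc => //; apply: nonunits0.
Qed.

Lemma nonunits_subspace : subspace iota m.
Proof.
split; [exact: nonunits0|exact: loc|].
by move=> c x; apply: nonunitsM; apply: sa_const.
Qed.

Lemma one_add_nonunit x : m x -> ~ m (1 + x).
Proof. by move=> hx /loc/(_ hx); rewrite addrK; apply: nonunits1. Qed.

End Nonunits.

Lemma nonunit_transcendental (A : subalg iota) x : algebraically_closed_in iota ->
  nonunits (subalg_set A) x -> x != 0 -> ~ algebraicOver iota x.
Proof.
move=> ac mx x0 /ac[c xc]; apply: unit_nonunit mx => //.
by rewrite xc -fmorphV; apply: sa_const.
Qed.

Section Charts.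
Variables (A : subalg iota) (s : seq F) (p : set F).
Hypotheses (hp : prime_of (generated iota s) p)
  (hA : subalg_set A = localization (generated iota s) p)
  (tr1 : transcendence_degree1 iota) (ac : algebraically_closed_in iota).
Local Notation R := (gen_subalg iota s).
Local Notation m := (nonunits (subalg_set A)).

Lemma chart_sub x : x \inS R -> x \inS A.
Proof.
move=> Rx; rewrite hA; exists x, 1; split=> //; last by rewrite divr1.
  exact: (@sa1 _ _ _ R).
by case: hp => _ _ _ _ [].
Qed.

(** The prime p is recovered from the local ring as the intersection of k[s] with m; points of one
    chart are compared in this way. *)
Lemma prime_nonunit x : x \inS R -> p x <-> m x.
Proof.
have [pR p0 pB pM [p1 pP]] := hp.
move=> Rx; split=> [px|[_ hx]].
  split; first exact: chart_sub.
  have [->|x0] := eqVneq x 0; first by left.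
  right; rewrite hA => -[a [b [Ra Rb npb e]]]; apply: npb.
  have b0 : b != 0.
    apply: contraTneq x0 => b0; move: e; rewrite b0 invr0 mulr0 => /eqP.
    by rewrite invr_eq0 negbK.
  have -> : b = a * x by apply: (mulIf (x := x^-1)); rewrite ?invr_eq0// mulfK// e mulrC divfK.
  exact: pM.
apply: contrapT => npx; case: hx => [x0|]; first by rewrite x0 in npx.
by apply; rewrite hA; exists 1, x; split=> //; [exact: (@sa1 _ _ _ R)|rewrite div1r].
Qed.

Lemma chart_fraction x : x \inS A -> exists a b,
  [/\ a \inS R, b \inS R, b != 0, ~ p b & x = a / b].
Proof.
rewrite hA => -[a [b [Ra Rb npb ->]]]; exists a, b; split=> //.
by apply: contra_notN npb => /eqP ->; case: hp.
Qed.

Lemma chart_inv b : b \inS R -> ~ p b -> b^-1 \inS A.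
Proof. by move=> Rb npb; rewrite hA; exists 1, b; split=> //; [exact: (@sa1 _ _ _ R)|rewrite div1r]. Qed.

Lemma chart_local : local_subalg A.
Proof.
have [pR p0 pB pM [p1 pP]] := hp.
move=> x y hx hy.
have [a [b [Ra Rb b0 pb xe]]] := chart_fraction (nonunits_sub hx).
have [c [d [Rc Rd d0 pd ye]]] := chart_fraction (nonunits_sub hy).
have pa : p a.
  by apply/prime_nonunit => //; rewrite -(divfK b0 a) -xe mulrC; apply: nonunitsM => //; apply: chart_sub.
have pc : p c.
  by apply/prime_nonunit => //; rewrite -(divfK d0 c) -ye mulrC; apply: nonunitsM => //; apply: chart_sub.
have -> : x - y = (b * d)^-1 * (a * d - c * b).
  rewrite xe ye; field; exact/andP.
apply: nonunitsM; first by rewrite invfM; apply: saM; apply: chart_inv.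
apply/prime_nonunit; first by apply: saB; apply: saM.
by apply: pB; rewrite mulrC; apply: pM.
Qed.

(** Writing b = a / u with u a unit of A gives bA = aA with a in k[s]. The quotient k[s]/a is
    finite-dimensional, and modulo aA each inverse v^-1 of an element outside p agrees with an
    element of k[s], so A has no further classes. *)
Lemma chart_mod_finite b : m b -> b != 0 ->
  exists2 E : seq F, (forall e, e \in E -> e \inS A) &
    subalg_set A `<=` spanmod iota E (scaled b A).
Proof.
move=> mb b0; have [a [u [Ra Ru u0 pu be]]] := chart_fraction (nonunits_sub mb).
have bA : scaled b A = scaled a A.
  apply/seteqP; split=> _ [r Ar ->].
    by exists (u^-1 * r); [apply: saM => //; apply: chart_inv|rewrite be mulrA].
  exists (u * r); first by apply: saM => //; apply: chart_sub.
  by rewrite be mulrA divfK.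
have hI := scaled_subspace a A; have [I0 IB IZ] := hI.
have IM x y : scaled a A x -> y \inS A -> scaled a A (x * y).
  by move=> [r Ar ->] Ay; exists (r * y); rewrite ?mulrA//; apply: saM.
have IN x : scaled a A x -> scaled a A (- x).
  by move=> hx; rewrite -sub0r; apply: IB.
rewrite bA.
have ae : a = u * b by rewrite be mulrC divfK.
have na : ~ algebraicOver iota a.
  apply: (nonunit_transcendental (A := A)) => //; rewrite ae ?mulf_neq0//.
  by apply: nonunitsM => //; apply: chart_sub.
have [E hE RE] := gen_mod_finite tr1 Ra na.
exists E => [e /hE /chart_sub//|f /chart_fraction[r [v [Rr Rv v0 pv ->]]]].
have Av := chart_inv Rv pv.
(* Q(v) lies in aA. A zero constant term is removed by dividing by the unit v; once it is some c !=
   0, the congruence reads v^-1 = - c^-1 (Q(v) - c) / v modulo aA, a polynomial in v. *)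
have [w Rw [t At e]] : exists2 w, w \inS R & scaled a A (v^-1 - w).
  have [Q Q0 /(_ R Ra Rv)[t Rt]] := trdeg1_div tr1 v na.
  have {Rt} : t \inS A by apply: chart_sub.
  elim/poly_ind: Q t Q0 => [t|Q c IH t]; first by rewrite eqxx.
  rewrite evMXaddC.
  have [->|c0] := eqVneq c 0.
    rewrite addr0 mulf_eq0 negb_or rmorph0 addr0 => /andP[Q0 _] At e.
    apply: (IH (t / v)) => //; first exact: saM.
    by rewrite mulrA -e mulfK.
  move=> _ At e; have ic : iota c != 0 by rewrite fmorph_eq0.
  exists (iota (- c^-1) * ev iota v Q).
    by apply: saM; [apply: sa_const|apply: sa_ev].
  exists (iota c^-1 * (t / v)); first by apply: saM; [apply: sa_const|apply: saM].
  apply: (mulIf v0); rewrite -!mulrA mulVf// mulr1 mulrBl mulVf// rmorphN fmorphV.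
  apply: (mulfI ic); rewrite mulrCA mulVKf// -e; by field.
have -> : r / v = r * w + a * (r * t) by rewrite mulrCA -e mulrBr addrC subrK.
apply: subspaceD; first exact: spanmod_subspace.
  apply: (@spanmod_sub _ _ _ E (scaled a R)); last by apply: RE; apply: saM.
  by move=> _ [x Rx ->]; exists x => //; apply: chart_sub.
apply: sub_spanmod => //; exists (r * t) => //.
by apply: saM => //; apply: chart_sub.
Qed.

End Charts.
End LocalRings.

(** * Polynomials with coefficients in a subalgebra *)

Section Adjoin.
Variables (k F : fieldType) (iota : {rmorphism k -> F}) (L : subalg iota) (y : F).

Definition coefs_in (P : {poly F}) : Prop := forall i, P`_i \inS L.

Lemma coefs_inB P Q : coefs_in P -> coefs_in Q -> coefs_in (P - Q).
Proof. by move=> hP hQ i; rewrite coefB; apply: saB. Qed.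

Lemma coefs_inM P Q : coefs_in P -> coefs_in Q -> coefs_in (P * Q).
Proof. by move=> hP hQ i; rewrite coefM; apply: sa_sum => j; apply: saM. Qed.

Lemma coefs_inC c : c \inS L -> coefs_in c%:P.
Proof. by move=> Lc i; rewrite coefC; case: ifP => // _; apply: sa0. Qed.

Lemma coefs_inXn n : coefs_in 'X^n.
Proof. by move=> i; rewrite coefXn; case: eqP => _; [apply: sa1|apply: sa0]. Qed.

Lemma coefs_in_map (p : {poly k}) : coefs_in (map_poly iota p).
Proof. by move=> i; rewrite coef_map; apply: sa_const. Qed.

Lemma coefs_in_deriv P : coefs_in P -> coefs_in P^`().
Proof. by move=> hP i; rewrite coef_deriv -mulr_natr -(rmorph_nat iota); apply/saM/sa_const. Qed.

Definition adjoin_set : set F := [set f | exists2 P, coefs_in P & f = P.[y]].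

Lemma adjoin_const c : adjoin_set (iota c).
Proof. by exists (iota c)%:P; rewrite ?hornerC//; apply/coefs_inC/sa_const. Qed.
Lemma adjoinB f g : adjoin_set f -> adjoin_set g -> adjoin_set (f - g).
Proof.
by move=> [P hP ->] [Q hQ ->]; exists (P - Q); rewrite ?hornerD ?hornerN//; apply: coefs_inB.
Qed.
Lemma adjoinM f g : adjoin_set f -> adjoin_set g -> adjoin_set (f * g).
Proof.
by move=> [P hP ->] [Q hQ ->]; exists (P * Q); rewrite ?hornerM//; apply: coefs_inM.
Qed.
Definition adjoin : subalg iota := Subalg adjoin_const adjoinB adjoinM.

Lemma mem_adjoin : y \inS adjoin.
Proof. by exists 'X; rewrite ?hornerX// -['X]expr1; apply: coefs_inXn. Qed.
Lemma sub_adjoin x : x \inS L -> x \inS adjoin.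
Proof. by move=> Lx; exists x%:P; rewrite ?hornerC//; apply: coefs_inC. Qed.

(** Long division by a monic g only multiplies and subtracts coefficients, so quotient and remainder
    stay over the subalgebra L. *)
Lemma coefs_in_monic_divP (g P : {poly F}) : g \is monic -> coefs_in g -> coefs_in P ->
  exists Q R, [/\ coefs_in Q, coefs_in R, P = Q * g + R & (size R < size g)%N].
Proof.
move=> gm Lg; have [n] := ubnP (size P); elim: n P => // n IH P sP LP.
have [sPg|sPg] := ltnP (size P) (size g).
  exists 0, P; rewrite mul0r add0r; split=> //.
  by move=> i; rewrite coef0; apply: sa0.
pose Q0 := (lead_coef P)%:P * 'X^(size P - size g).
have LQ0 : coefs_in Q0 by apply: coefs_inM; [apply: coefs_inC; apply: LP|apply: coefs_inXn].
have [||Q [R [LQ LR e sR]]] := IH (P - Q0 * g).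
- have g0 := monic_neq0 gm; have [P0|P0] := eqVneq P 0.
    by move: sPg; rewrite P0 size_poly0 leqn0 size_poly_eq0 (negPf g0).
  rewrite ltnS in sP; apply: leq_trans sP; rewrite -[X in (_ < X)%N](prednK (n := size P)) ?size_poly_gt0//.
  rewrite ltnS; apply/leq_sizeP => j hj; rewrite coefB /Q0 -mulrA coefCM mulrC coefXnM.
  have sg : (0 < size g)%N by rewrite size_poly_gt0.
  have sP0 : (0 < size P)%N by rewrite size_poly_gt0.
  have aux a b : (a.-1 <= j -> 0 < b -> b <= a -> a - b <= j /\
      (j = a.-1 -> j - (a - b) = b.-1) /\ (j <> a.-1 -> a <= j /\ b <= j - (a - b)))%N.
    by clear; lia.
  have [h1 [h2 h3]] := aux _ _ hj sg sPg.
  rewrite ltnNge h1 /=; have [ej|/eqP nj] := eqVneq j (size P).-1.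
    by rewrite h2// -/(lead_coef g) (monicP gm) mul1r ej subrr.
  by have [? ?] := h3 nj; rewrite !nth_default ?mul0r ?subr0.
- by apply/coefs_inB/coefs_inM.
exists (Q0 + Q), R; split=> //; last by rewrite mulrDl -addrA -e addrC subrK.
by move=> i; rewrite coefD; apply: saD.
Qed.

Lemma coefs_in_taylor P e : coefs_in P -> y \inS L -> e \inS L ->
  exists2 r, r \inS L & P.[y + e] = P.[y] + P^`().[y] * e + e ^+ 2 * r.
Proof.
move=> + Ly Le; elim/poly_ind: P => [|P c IH] LP.
  by exists 0; rewrite ?deriv0 ?horner0 ?mul0r ?mulr0 ?addr0//; apply: sa0.
have LP' : coefs_in P.
  by move=> i; have := LP i.+1; rewrite coefD coefMX coefC /= addr0.
have [r Lr IHe] := IH LP'; exists (r * (y + e) + P^`().[y]).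
  apply: saD; first by apply/saM/saD.
  by apply: sa_horner => //; apply: coefs_in_deriv.
by rewrite derivD derivC derivM derivX mulr1 addr0 !hornerE IHe; ring.
Qed.

End Adjoin.

(** * Coefficient algebras modulo the square of the maximal ideal *)

Section CoefficientAlgebra.
Variables (k F : fieldType) (iota : {rmorphism k -> F}) (A : subalg iota).
Hypotheses (loc : local_subalg A) (tr1 : transcendence_degree1 iota)
  (ac : algebraically_closed_in iota) (perf : perfect_field k).
Local Notation m := (nonunits (subalg_set A)).

(** The ideal m^2 as the least additive subgroup containing the products of two nonunits; membership
    is its own induction principle. *)
Definition msq : set F := [set f | forall W : set F, W 0 ->
  (forall x y, W x -> W y -> W (x - y)) -> (forall x y, m x -> m y -> W (x * y)) -> W f].

Lemma msq0 : msq 0. Proof. by []. Qed.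
Lemma msqB x y : msq x -> msq y -> msq (x - y).
Proof. by move=> hx hy W W0 WB WM; apply: (WB); [apply: hx|apply: hy]. Qed.
Lemma msqD x y : msq x -> msq y -> msq (x + y).
Proof.
by move=> hx hy; rewrite -[y]opprK -[- y]sub0r; apply: msqB => //; apply: msqB.
Qed.
Lemma msq_mul x y : m x -> m y -> msq (x * y).
Proof. by move=> mx my W _ _; apply. Qed.
Lemma msqM a x : a \inS A -> msq x -> msq (a * x).
Proof.
move=> Aa hx; apply: (hx [set x | msq (a * x)]) => /=.
- by rewrite mulr0.
- by move=> u v hu hv; rewrite mulrBr; apply: msqB.
- by move=> u v mu mv; rewrite mulrA; apply: msq_mul => //; apply: nonunitsM.
Qed.
Lemma msq_sub x : msq x -> m x.
Proof.
apply; [exact: nonunits0|exact: loc|].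
by move=> u v mu mv; apply: nonunitsM => //; apply: nonunits_sub mu.
Qed.

Variable b0 : F.
Hypotheses (mb0 : m b0) (b0_neq0 : b0 != 0).

Let nb0 : ~ algebraicOver iota b0.
Proof. exact: nonunit_transcendental ac mb0 b0_neq0. Qed.
Let Ab0 : b0 \inS A := nonunits_sub mb0.

Lemma residue_algebraic y : y \inS A -> exists2 Q, Q != 0 & m (ev iota y Q).
Proof.
move=> Ay; have [Q Q0 /(_ A Ab0 Ay)[r Ar e]] := trdeg1_div tr1 y nb0.
by exists Q => //; rewrite e mulrC; apply: nonunitsM.
Qed.

(** As m is prime, one factor of a vanishing polynomial vanishes too; nonzero constants are units,
    so the descent stops at an irreducible factor. *)
Lemma residue_irreducible y : y \inS A ->
  exists2 h : {poly k}, irreducible_poly h & m (ev iota y h).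
Proof.
move=> Ay; have [Q] := residue_algebraic Ay.
have [n] := ubnP (size Q); elim: n Q => // n IH Q sQ Q0 mQ.
have sQ1 : (1 < size Q)%N.
  rewrite ltnNge; apply/negP => /size1_polyC e.
  move: mQ Q0; rewrite e evC polyC_eq0 => h c0; apply: unit_nonunit h.
    by rewrite fmorph_eq0.
  by rewrite -fmorphV; apply: sa_const.
have [irr|nirr] := pselect (irreducible_poly Q); first by exists Q.
have [q [sq1 qQ nq]] : exists q : {poly k}, [/\ size q != 1%N, q %| Q & ~~ (q %= Q)].
  apply: contrapT => h; apply: nirr; split=> // q sq1 qQ.
  by apply: contrapT => /negP nq; apply: h; exists q.
have /dvdpP[r Qe] := qQ.
have [r0 q0] : r != 0 /\ q != 0.
  by apply/andP; move: Q0; rewrite Qe mulf_eq0 negb_or.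
have sq : (size q < size Q)%N.
  by rewrite ltn_neqAle dvdp_leq// andbT (dvdp_size_eqp qQ).
have sr : (size r < size Q)%N.
  have sq0 : (0 < size q)%N by rewrite size_poly_gt0.
  have sr0 : (0 < size r)%N by rewrite size_poly_gt0.
  have aux a b : (b != 1 -> 0 < b -> 0 < a -> a < (a + b).-1)%N by clear; lia.
  by rewrite Qe size_mul//; apply: aux.
have := mQ; rewrite Qe rmorphM => /nonunits_prime[||h|h].
- exact: sa_ev.
- exact: sa_ev.
- by apply: (IH r) => //; apply: leq_trans sr _.
- by apply: (IH q) => //; apply: leq_trans sq _.
Qed.

(** Perfectness makes the irreducible h coprime to its derivative; a Bezout identity evaluated at y
    would put 1 in m if h'(y) were in m as well. *)
Lemma residue_separable y : y \inS A ->
  exists2 h : {poly k}, m (ev iota y h) & ~ m (ev iota y h^`()).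
Proof.
move=> Ay; have [h irr mh] := residue_irreducible Ay; exists h => // mh'.
have := perf irr; rewrite unlock => /Bezout_eq1_coprimepP[[u v] /= e].
apply: (@nonunits1 _ _ _ A); rewrite -(rmorph1 (ev iota y)) -e rmorphD !rmorphM.
by apply: nonunitsD => //; apply: nonunitsM => //; apply: sa_ev.
Qed.

(* A subalgebra of A that contains m^2 and meets m in m^2: modulo m^2 it is a
   field that maps injectively to the residue field. *)
Definition coef_algebra (L : subalg iota) : Prop :=
  [/\ (forall x, x \inS L -> x \inS A), (forall x, msq x -> x \inS L) &
      (forall x, x \inS L -> m x -> msq x)].

(** The starting algebra k + m^2. *)
Definition coef_algebra0_set : set F := [set f | exists c, msq (f - iota c)].

Lemma coef_algebra0_const c : coef_algebra0_set (iota c).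
Proof. by exists c; rewrite subrr. Qed.
Lemma coef_algebra0B x y : coef_algebra0_set x -> coef_algebra0_set y ->
  coef_algebra0_set (x - y).
Proof.
move=> [c hc] [d hd]; exists (c - d); rewrite rmorphB.
by rewrite (_ : _ - _ = (x - iota c) - (y - iota d)); [apply: msqB|ring].
Qed.
Lemma coef_algebra0_sub x : coef_algebra0_set x -> x \inS A.
Proof.
move=> [c hc]; rewrite -(subrK (iota c) x); apply/saD/sa_const.
exact/nonunits_sub/msq_sub.
Qed.
Lemma coef_algebra0M x y : coef_algebra0_set x -> coef_algebra0_set y ->
  coef_algebra0_set (x * y).
Proof.
move=> hx hy; have Ay := coef_algebra0_sub hy.
move: hx hy => [c hc] [d hd]; exists (c * d); rewrite rmorphM.
rewrite (_ : _ - _ = y * (x - iota c) + iota c * (y - iota d)); last by ring.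
by apply: msqD; apply: msqM => //; apply: sa_const.
Qed.
Definition coef_algebra0 := Subalg coef_algebra0_const coef_algebra0B coef_algebra0M.

Lemma coef_algebra0P : coef_algebra coef_algebra0.
Proof.
split=> [|x hx|x [c hc] mx]; first exact: coef_algebra0_sub.
  by exists 0; rewrite rmorph0 subr0.
have mc : m (iota c).
  by rewrite -(subKr x (iota c)); apply: loc => //; apply: msq_sub.
have [c0|c0] := eqVneq c 0; first by move: hc; rewrite c0 rmorph0 subr0.
by case: (@unit_nonunit _ _ _ A (iota c)) => //; rewrite ?fmorph_eq0// -fmorphV; apply: sa_const.
Qed.

Section Step.
Variables (L : subalg iota) (y : F).
Hypotheses (hL : coef_algebra L) (Ay : y \inS A).

Let LA x : x \inS L -> x \inS A. Proof. by case: hL => h _ _; apply: h. Qed.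
Let Lsq x : msq x -> x \inS L. Proof. by case: hL => _ h _; apply: h. Qed.
Let Lm x : x \inS L -> m x -> msq x. Proof. by case: hL => _ _ h; apply: h. Qed.

Let coefsA P : coefs_in L P -> coefs_in A P. Proof. by move=> hP i; apply: LA. Qed.

(** L modulo m^2 is a field: r has a relation Q(r) in m, hence in m^2 because Q(r) is in L, and
    after removing powers of r the nonzero constant term of Q yields the inverse. *)
Lemma coef_algebra_inv r : r \inS L -> ~ m r -> exists2 w, w \inS L & msq (w * r - 1).
Proof.
move=> Lr nr; have [Q] := residue_algebraic (LA Lr).
elim/poly_ind: Q => [|Q c IH]; first by rewrite eqxx.
rewrite evMXaddC; have [->|c0] := eqVneq c 0.
  rewrite addr0 mulf_eq0 negb_or rmorph0 addr0 => /andP[Q0 _].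
  by move=> /nonunits_prime[||/(IH Q0)|//]; [apply/sa_ev/LA|apply: LA|].
move=> _ h; have ic : iota c != 0 by rewrite fmorph_eq0.
have Lw : ev iota r Q \inS L by apply: sa_ev.
exists (- iota c^-1 * ev iota r Q).
  by apply: saM => //; rewrite -rmorphN; apply: sa_const.
have -> : - iota c^-1 * ev iota r Q * r - 1 = - iota c^-1 * (ev iota r Q * r + iota c).
  by rewrite fmorphV; field.
apply: msqM; first by rewrite -rmorphN; apply: sa_const.
by apply: Lm => //; apply/saD/sa_const/saM.
Qed.

(** For g of least degree, this is the minimal polynomial of the residue of y over the field L /
    m^2. *)
Definition residual_monic (g : {poly F}) : Prop := [/\ g \is monic, coefs_in L g & m g.[y]].

(** A leading coefficient outside m could be made 1 modulo m^2, giving a monic polynomial smaller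
    than g. So it lies in m and in L, thus in m^2, and can be removed. *)
Lemma small_residual_coefs (g : {poly F}) : (forall g', residual_monic g' -> (size g <= size g')%N) ->
  forall R : {poly F}, coefs_in L R -> (size R < size g)%N -> m R.[y] -> forall i, msq R`_i.
Proof.
move=> gmin R; have [n] := ubnP (size R); elim: n R => // n IH R sR LR sRg mR.
have [R0|R0] := eqVneq R 0; first by move=> i; rewrite R0 coef0.
pose l := (size R).-1; pose r := lead_coef R; pose R' := R - r%:P * 'X^l.
have sRS : size R = l.+1 by rewrite prednK// size_poly_gt0.
have LR' : coefs_in L R'.
  apply: coefs_inB => //; apply: coefs_inM; last exact: coefs_inXn.
  by apply: coefs_inC; apply: LR.
have sR' : (size R' <= l)%N.
  apply/leq_sizeP => j hj; rewrite coefB coefCM coefXn.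
  have [->|nj] := eqVneq j l; first by rewrite mulr1 subrr.
  by rewrite mulr0 subr0 nth_default// sRS; lia.
have [mr|nr] := pselect (m r).
  have hr : msq r by apply: Lm => //; apply: LR.
  have mR' : m R'.[y].
    rewrite hornerD hornerN hornerCM hornerXn; apply: loc => //.
    by rewrite mulrC; apply: nonunitsM => //; apply: saX.
  have h := IH R' _ LR' _ mR'; move=> i.
  have -> : R`_i = R'`_i + r * ('X^l)`_i by rewrite -coefCM -coefD subrK.
  apply: msqD; first by apply: h; lia.
  by rewrite mulrC; apply: msqM => //; apply: (@coefs_inXn _ _ _ A).
have [w Lw hw] := coef_algebra_inv (LR _ : r \inS L) nr.
have sX : (size (w%:P * R')%R < size ('X^l : {poly F})%R)%N.
  rewrite size_polyXn ltnS mul_polyC; exact: leq_trans (size_scale_leq _ _) sR'.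
have /gmin : residual_monic ('X^l + w%:P * R').
  split.
  - by rewrite monicE lead_coefDl// lead_coefXn.
  - move=> i; rewrite coefD; apply: saD; first exact: coefs_inXn.
    by rewrite coefCM; apply: saM.
  rewrite hornerD hornerCM hornerXn hornerD hornerN hornerCM hornerXn.
  have -> : y ^+ l + w * (R.[y] - r * y ^+ l) = w * R.[y] - y ^+ l * (w * r - 1) by ring.
  apply: loc; first by apply: nonunitsM => //; apply: LA.
  by apply: nonunitsM; [apply: saX|apply: msq_sub].
by rewrite size_polyDl// size_polyXn leqNgt -sRS sRg.
Qed.

(** Newton's method: y' = y - g(y) / g'(y) has the residue of y and satisfies g(y') in m^2. An
    element P(y') of L[y'] lying in m is reduced modulo g to R(y') with R shorter than g; then R(y)
    is in m as well, so the coefficients of R are in m^2. *)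
Lemma coef_algebra_step : exists L', [/\ coef_algebra L',
  (forall x, x \inS L -> x \inS L') & exists2 y', y' \inS L' & m (y - y')].
Proof.
have [h mh mh'] := residue_separable Ay.
have h0 : h != 0 by apply: contra_notN mh' => /eqP ->; rewrite deriv0 rmorph0; apply: nonunits0.
pose S n := `[< exists2 g, residual_monic g & size g = n >].
have exS : exists n, S n.
  exists (size (map_poly iota ((lead_coef h)^-1 *: h))); apply/asboolP.
  exists (map_poly iota ((lead_coef h)^-1 *: h)) => //; split.
  - by rewrite map_monic monicE lead_coefZ mulVf// lead_coef_eq0.
  - exact: coefs_in_map.
  rewrite map_polyZ hornerZ; apply: nonunitsM => //; exact: sa_const.
case: (ex_minnP exS) => n /asboolP[g [gm Lg mg] sg] nmin.
have gmin (g' : {poly F}) : residual_monic g' -> (size g <= size g')%N.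
  by move=> hg'; rewrite sg; apply: nmin; apply/asboolP; exists g'.
have small := small_residual_coefs gmin.
(* Dividing h by the minimal g leaves a remainder with coefficients in m^2. If g'(y) were in m,
   differentiating h = Q g + R at y would put h'(y) in m. *)
have ng' : ~ m g^`().[y].
  have [Q [R [LQ LR e sR]]] := coefs_in_monic_divP gm Lg (coefs_in_map L h).
  have mR : m R.[y].
    have -> : R = map_poly iota h - Q * g by rewrite e addrC addKr.
    rewrite hornerD hornerN hornerM; apply: loc => //.
    by apply: nonunitsM => //; apply: sa_horner => // i; apply: LA.
  have Rsq := small R LR sR mR.
  apply: contra_not mh' => mg'; rewrite evE -deriv_map e derivD derivM !hornerE.
  apply: nonunitsD => //; first apply: nonunitsD => //.
  - by apply: nonunitsM => //; apply: sa_horner => // i; apply/LA/coefs_in_deriv.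
  - by apply: nonunitsM => //; apply: sa_horner => // i; apply/LA.
  rewrite horner_coef; apply: big_ind; [exact: nonunits0|exact: nonunitsD|].
  move=> i _; rewrite coef_deriv -mulr_natl -mulrA; apply: nonunitsM; last first.
    by rewrite mulrC; apply: nonunitsM; [apply: saX|apply: msq_sub].
  by rewrite -(rmorph_nat iota); apply: sa_const.
have Agy' : g^`().[y] \inS A by apply: sa_horner => // i; apply/LA/coefs_in_deriv.
have [gy0 Agi] := nonunitPn Agy' ng'.
pose e := g.[y] / g^`().[y].
have me : m e by rewrite /e mulrC; apply: nonunitsM.
have Ae : - e \inS A by apply/saN/nonunits_sub.
pose y' := y - e.
have Ay' : y' \inS A by apply: saD.
have gy' : msq g.[y'].
  (* The linear term of the Taylor expansion cancels g(y), and the rest is a multiple of e^2 with e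
     in m. *)
  have [r Ar ->] := coefs_in_taylor (coefsA Lg) Ay Ae.
  rewrite /e mulrN [_ * (_ / _)]mulrCA divff// mulr1 subrr add0r sqrrN mulrC.
  by apply: msqM => //; apply: msq_mul.
exists (adjoin L y'); split; last first.
- exists y'; first exact: mem_adjoin.
  by rewrite /y' opprB addrC subrK.
- by move=> x; apply: sub_adjoin.
split.
- by move=> _ [P LP ->]; apply: sa_horner => // i; apply: LA.
- by move=> x hx; apply/sub_adjoin/Lsq.
move=> _ [P LP ->] mP.
have [Q [R [LQ LR eP sR]]] := coefs_in_monic_divP gm Lg LP.
have AQ : Q.[y'] \inS A by apply: sa_horner => // i; apply: LA.
have mR' : m R.[y'].
  have -> : R = P - Q * g by rewrite eP addrC addKr.
  rewrite hornerD hornerN hornerM; apply: loc => //.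
  by apply/nonunitsM/msq_sub.
have mR : m R.[y].
  have [||r Ar] := coefs_in_taylor (y := y') (e := e) (coefsA LR) => //.
    exact: nonunits_sub me.
  rewrite /y' subrK -/y' => ->; rewrite -addrA; apply: nonunitsD => //.
  apply: nonunitsD => //; first apply: nonunitsM => //.
    by apply: sa_horner => // i; apply/LA/coefs_in_deriv.
  by rewrite mulrC; apply: nonunitsM => //; apply/nonunitsM/me/nonunits_sub.
have Rsq := small R LR sR mR.
rewrite eP hornerD hornerM; apply: msqD; first exact: msqM.
rewrite horner_coef; apply: big_ind => [//||i _]; first exact: msqD.
by rewrite mulrC; apply: msqM => //; apply: saX.
Qed.
End Step.

Lemma coef_algebra_exists (E : seq F) : (forall e, e \in E -> e \inS A) ->
  exists2 L, coef_algebra L & forall e, e \in E -> exists2 l, l \inS L & m (e - l).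
Proof.
elim: E => [_|e E IH hE]; first by exists coef_algebra0 => //; apply: coef_algebra0P.
have [|L hL LE] := IH; first by move=> x xE; apply: hE; rewrite inE xE orbT.
have [|L' [hL' LL' [l Ll ml]]] := coef_algebra_step hL (y := e).
  by apply: hE; rewrite inE eqxx.
exists L' => // x; rewrite inE => /predU1P[->|/LE[l' Ll' ml']]; first by exists l.
by exists l' => //; apply: LL'.
Qed.

End CoefficientAlgebra.

(** * The module A/m^2 and the projection onto m/m^2 as a derivation *)

Section SquareQuotient.
Variables (k F : fieldType) (iota : {rmorphism k -> F}) (A : subalg iota).
Local Notation O := (subalg_type A).

Definition msq_pred (x : O) : bool := `[< msq A (val x) >].

Lemma msq_pred_closed : zmod_closed msq_pred.
Proof.
split; first by apply/asboolP; apply: msq0.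
by move=> x y /asboolP hx /asboolP hy; apply/asboolP; apply: msqB.
Qed.
HB.instance Definition _ := GRing.isZmodClosed.Build O msq_pred msq_pred_closed.

Definition msq_ideal : zmodClosed O := GRing.ZmodClosed.clone O msq_pred _.
(** The derivation below takes its values in m/m^2; A/m^2 is used as its target, since it carries
    the A-module structure without passing to a submodule. *)
Definition sq_quot : Type := Quotient.quot msq_ideal.
HB.instance Definition _ := GRing.Zmodule.on sq_quot.
Definition sqpi (x : O) : sq_quot := \pi_(Quotient.quot msq_ideal) x.

Lemma sqpi_eq x y : sqpi x = sqpi y <-> msq A (val x - val y).
Proof.
rewrite /sqpi; split=> [/eqP|h].
  by rewrite -Quotient.idealrBE => /asboolP.
by apply/eqP; rewrite -Quotient.idealrBE; apply/asboolP.
Qed.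

Lemma sqpiB x y : sqpi (x - y) = sqpi x - sqpi y.
Proof. exact: raddfB. Qed.
Lemma sqpiD x y : sqpi (x + y) = sqpi x + sqpi y.
Proof. exact: raddfD. Qed.
Lemma sqpi_repr c : sqpi (repr c) = c. Proof. exact: reprK. Qed.
Lemma sqpiW (P : sq_quot -> Prop) : (forall x, P (sqpi x)) -> forall c, P c.
Proof. by move=> h c; rewrite -(sqpi_repr c). Qed.

Definition sq_scale (a : O) (c : sq_quot) : sq_quot := sqpi (a * repr c).

Lemma O_mem (x : O) : val x \inS A.
Proof. by have := valP x; rewrite /sa_mem inE. Qed.

Lemma sq_scaleE a x : sq_scale a (sqpi x) = sqpi (a * x).
Proof.
apply/sqpi_eq; rewrite [val _ - val _](_ : _ = val a * (val (repr (sqpi x)) - val x)).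
  by apply: msqM; [apply: O_mem|apply/sqpi_eq; rewrite sqpi_repr].
by rewrite mulrBr.
Qed.

Lemma sq_scaleA a b c : sq_scale a (sq_scale b c) = sq_scale (a * b) c.
Proof. by elim/sqpiW: c => x; rewrite !sq_scaleE mulrA. Qed.
Lemma sq_scale1 : left_id 1 sq_scale.
Proof. by elim/sqpiW=> x; rewrite sq_scaleE mul1r. Qed.
Lemma sq_scaleDr : right_distributive sq_scale +%R.
Proof.
move=> a; elim/sqpiW=> x; elim/sqpiW=> y.
by rewrite -sqpiD !sq_scaleE mulrDr sqpiD.
Qed.
Lemma sq_scaleDl c : {morph sq_scale^~ c : a b / a + b}.
Proof. by move=> a b; elim/sqpiW: c => x; rewrite !sq_scaleE mulrDl sqpiD. Qed.
HB.instance Definition _ := GRing.Zmodule_isLmodule.Build O sq_quot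
  sq_scaleA sq_scale1 sq_scaleDr sq_scaleDl.

Lemma sqpiZ (a x : O) : a *: sqpi x = sqpi (a * x). Proof. exact: sq_scaleE. Qed.
End SquareQuotient.

Section CotangentSpace.
Variables (k F : fieldType) (iota : {rmorphism k -> F}) (A : subalg iota).
Hypotheses (loc : local_subalg A) (smooth : differentials_free_rank1 A).
Variable L : subalg iota.
Hypotheses (hL : coef_algebra A L)
  (AL : forall a, a \inS A -> exists2 l, l \inS L & nonunits (subalg_set A) (a - l)).
Local Notation O := (subalg_type A).
Local Notation m := (nonunits (subalg_set A)).

Let LA x : x \inS L -> x \inS A. Proof. by case: hL => h _ _; apply: h. Qed.
Let Lm x : x \inS L -> m x -> msq A x. Proof. by case: hL => _ _ h; apply: h. Qed.

Definition inA (x : F) : O := insubd (0 : O) x.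
Lemma inAE x : x \inS A -> val (inA x) = x.
Proof. by move=> Ax; rewrite insubdK// unfold_in /sa_mem inE. Qed.

Arguments inA : simpl never.
Lemma inAL x : x \inS L -> val (inA x) = x. Proof. by move=> /LA/inAE. Qed.

Definition coef_proj (a : O) : F := sval (cid2 (AL (O_mem a))).
Lemma coef_projP a : coef_proj a \inS L /\ m (val a - coef_proj a).
Proof. by rewrite /coef_proj; case: cid2. Qed.

Definition sq_der (a : O) : sq_quot A := sqpi (a - inA (coef_proj a)).

(** Two components in L of the same element differ by an element of L and m, hence of m^2, so the
    choice made in [coef_proj] is immaterial. *)
Lemma sq_derP a l : l \inS L -> m (val a - l) -> sq_der a = sqpi (a - inA l).
Proof.
move=> Ll ml; have [Lp mp] := coef_projP a; apply/sqpi_eq.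
rewrite [val _ - val _](_ : _ = l - coef_proj a); last first.
  by rewrite /= !inAL//; ring.
apply: Lm; first exact: saB.
by rewrite (_ : _ - _ = (val a - coef_proj a) - (val a - l)); [apply: loc|ring].
Qed.

Lemma sq_der_derivation : derivation sq_der.
Proof.
split=> [a b|a b|c].
- have [La ma] := coef_projP a; have [Lb mb] := coef_projP b.
  rewrite (@sq_derP _ (coef_proj a + coef_proj b)); first last.
  + rewrite [X in m X](_ : _ = (val a - coef_proj a) + (val b - coef_proj b)).
      exact: nonunitsD.
    by rewrite /=; ring.
  + exact: saD.
  rewrite -sqpiD; congr sqpi; apply: val_inj.
  by rewrite /= (inAL (saD La Lb)) (inAL La) (inAL Lb); ring.
- have [La ma] := coef_projP a; have [Lb mb] := coef_projP b.
  rewrite (@sq_derP _ (coef_proj a * coef_proj b)); first last.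
  + rewrite [X in m X](_ : _ = val a * (val b - coef_proj b) + coef_proj b * (val a - coef_proj a)).
      by apply: nonunitsD => //; apply: nonunitsM => //; [apply: O_mem|apply: LA].
    by rewrite /=; ring.
  + exact: saM.
  rewrite !sqpiZ -sqpiD; apply/sqpi_eq.
  (* The defect in the Leibniz rule is minus the product of the two m-components. *)
  rewrite [val _ - val _](_ : _ = - ((val a - coef_proj a) * (val b - coef_proj b))).
    by rewrite -sub0r; apply: msqB => //; apply: msq_mul.
  by rewrite /= (inAL (saM La Lb)) (inAL La) (inAL Lb); ring.
- rewrite (@sq_derP _ (iota c)); last 2 first.
  + exact: sa_const.
  + by rewrite /= subrr; apply: nonunits0.
  have -> : subalg_scal A c - inA (iota c) = 0 - 0.
    by apply: val_inj; rewrite subrr /= (inAL (sa_const L c)) subrr.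
  by rewrite sqpiB subrr.
Qed.

(* The projection of A = L + m onto m/m^2 is a derivation, hence a multiple of
   the universal one. *)
Lemma cotangent_generator : exists2 z, m z & forall f, m f ->
  exists2 a, a \inS A & msq A (f - a * z).
Proof.
have [d [der_d univ]] := smooth.
have [mu [hmu _]] := univ _ _ sq_der_derivation.
have Lsq x : msq A x -> x \inS L by case: hL => _ h _; apply: h.
(* On m the derivation is the residue map itself, the component in L being 0. *)
have hf f : m f -> msq A (f - val (d (inA f) : O) * val (repr mu)).
  move=> mf; have Af := nonunits_sub mf.
  have L0 : 0 \inS L := sa0 L.
  have := hmu (inA f); rewrite (@sq_derP _ 0)//; last by rewrite inAE ?subr0.
  rewrite -[mu in RHS]sqpi_repr sqpiZ => /sqpi_eq /=.
  by rewrite (inAE Af) (inAL L0) subr0.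
(* If some d(a) is a unit, then d(a) mu, which is congruent to an element of m modulo m^2, forces
   the representative of mu into m, where it serves as generator. *)
have [[a na]|hd] := pselect (exists a, ~ m (val (d a : O))).
  exists (val (repr mu)); last first.
    by move=> f /hf h; exists (val (d (inA f) : O)) => //; apply: O_mem.
  have [La ma] := coef_projP a; have := hmu a.
  rewrite -[mu in RHS]sqpi_repr sqpiZ => /sqpi_eq /=; rewrite (inAL La) => h.
  have : m (val (d a : O) * val (repr mu)).
    rewrite -(subKr (val a - coef_proj a) (_ * _)); apply: loc => //.
    exact: msq_sub.
  by case/nonunits_prime => //; apply: O_mem.
(* Otherwise d maps A into m. For f in m, both 0 and the class of f in A/m^2 then represent the zero
   derivation, so uniqueness gives f in m^2, and z = 0 works. *)
exists 0; first exact: nonunits0.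
move=> f mf; exists 0; first exact: sa0.
have der0 : @derivation _ _ iota A (sq_quot A) (fun=> 0).
  by split=> // *; rewrite ?scaler0 addr0.
have [nu [_ nu_uniq]] := univ _ _ der0.
have nu0 : nu = 0 by apply: nu_uniq => a; rewrite scaler0.
have nuf : nu = sqpi (inA f).
  apply: nu_uniq => a; rewrite sqpiZ -(subrr (sqpi 0)) -sqpiB subr0.
  apply/sqpi_eq; rewrite sub0r /= (inAE (nonunits_sub mf)) -mulNr -[X in X * _]sub0r.
  apply: msq_mul => //; apply: loc; first exact: nonunits0.
  by apply: contrapT => h; apply: hd; exists a.
move: nuf; rewrite nu0 -(subrr (sqpi 0)) -sqpiB subr0 => /sqpi_eq.
rewrite sub0r /= (inAE (nonunits_sub mf)) mul0r subr0 -[X in _ -> msq A X]opprK.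
by move=> h; rewrite -sub0r; apply: msqB.
Qed.
End CotangentSpace.

(** * Nakayama's lemma *)

Section Nakayama.
Variables (k F : fieldType) (iota : {rmorphism k -> F}) (A : subalg iota).
Hypothesis loc : local_subalg A.
Local Notation m := (nonunits (subalg_set A)).

Definition submodule (I : set F) : Prop :=
  [/\ I 0, forall x y, I x -> I y -> I (x - y) & forall a x, a \inS A -> I x -> I (a * x)].

Lemma submoduleD I x y : submodule I -> I x -> I y -> I (x + y).
Proof.
by move=> [I0 IB _] Ix Iy; rewrite -[y]opprK -[- y]sub0r; apply: (IB) => //; apply: IB.
Qed.

Fixpoint modgen (G : seq F) (I : set F) (f : F) : Prop :=
  if G is g :: G' then exists2 a, a \inS A & modgen G' I (f - a * g) else I f.

Lemma modgen_submodule G I : submodule I -> submodule (modgen G I).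
Proof.
move=> hI; elim: G => [//|g G [h0 hB hM]]; split=> /=.
- by exists 0; [apply: sa0|rewrite mul0r subr0].
- move=> x y [a Aa ha] [b Ab hb]; exists (a - b); first exact: saB.
  by rewrite (_ : _ - _ = (x - a * g) - (y - b * g)); [apply: hB|ring].
- move=> c x Ac [a Aa ha]; exists (c * a); first exact: saM.
  by rewrite -mulrA -mulrBr; apply: hM.
Qed.

Lemma sub_modgen G I : I `<=` modgen G I.
Proof.
elim: G => [//|g G IH] f If /=.
by exists 0; [apply: sa0|rewrite mul0r subr0; apply: IH].
Qed.

(** Generators are discarded one at a time. If J is generated by I and the others, then m^2 is
    contained in m g + J, so g = mu g modulo J with mu in m; the invertible factor 1 - mu puts g in
    J. *)
Lemma nakayama G I : submodule I -> (forall g, g \in G -> m g) ->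
  m `<=` modgen G I -> (forall f, m f -> exists2 i, I i & msq A (f - i)) -> m `<=` I.
Proof.
move=> hI; elim: G => [//|g G IH] hG mG mI; apply: IH => //.
  by move=> x xG; apply: hG; rewrite inE xG orbT.
have hJ := modgen_submodule G hI; have [J0 JB JM] := hJ.
have mg : m g by apply: hG; rewrite inE eqxx.
have msqJ x : msq A x -> exists2 mu, m mu & modgen G I (x - mu * g).
  move=> hx; apply: (hx [set x | exists2 mu, m mu & modgen G I (x - mu * g)]) => /=.
  - by exists 0; [apply: nonunits0|rewrite mul0r subr0].
  - move=> u v [mu hmu hu] [nu hnu hv]; exists (mu - nu); first exact: loc.
    by rewrite (_ : _ - _ = (u - mu * g) - (v - nu * g)); [apply: JB|ring].
  - move=> u v mu /mG[a Aa ha]; exists (a * u); first exact: nonunitsM.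
    rewrite (_ : _ - _ = u * (v - a * g)); last by ring.
    by apply: JM => //; apply: nonunits_sub mu.
have Jg : modgen G I g.
  have [i Ii /msqJ[mu mmu hmu]] := mI _ mg.
  have nmu : ~ m (1 - mu).
    rewrite -[- mu]mulN1r; apply: one_add_nonunit => //; apply: nonunitsM => //.
    by apply: saN; apply: sa1.
  have [u0 Au] := nonunitPn (saB (sa1 A) (nonunits_sub mmu)) nmu.
  rewrite -[g](mulKf u0); apply: JM => //.
  rewrite (_ : _ * _ = (g - i - mu * g) + i); last by ring.
  by apply: submoduleD => //; apply: sub_modgen.
move=> f /mG[a Aa ha]; rewrite -(subrK (a * g) f).
by apply: submoduleD => //; apply: JM.
Qed.
End Nakayama.

Section PrincipalMaximalIdeal.
Variables (k F : fieldType) (iota : {rmorphism k -> F}) (A : subalg iota).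
Hypotheses (tr1 : transcendence_degree1 iota) (ac : algebraically_closed_in iota)
  (perf : perfect_field k) (loc : local_subalg A) (smooth : differentials_free_rank1 A).
Local Notation m := (nonunits (subalg_set A)).
Variable b0 : F.
Hypotheses (mb0 : m b0) (b0_neq0 : b0 != 0).
Variable E : seq F.
Hypotheses (hE : forall e, e \in E -> e \inS A)
  (AE : subalg_set A `<=` spanmod iota E (scaled b0 A)).

Lemma scaled_submodule z : submodule A (scaled z A).
Proof.
split.
- by exists 0; [apply: sa0|rewrite mulr0].
- by move=> x y [r Ar ->] [t At ->]; exists (r - t); rewrite ?mulrBr//; apply: saB.
- by move=> a x Aa [r Ar ->]; exists (a * r); [apply: saM|rewrite mulrCA].
Qed.

Lemma submodule_subspace I : submodule A I -> subspace iota I.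
Proof.
by move=> [I0 IB IM]; split=> // c x; apply: IM; apply: sa_const.
Qed.

Lemma mem_modgen G I g : submodule A I -> g \in G -> modgen A G I g.
Proof.
move=> hI; elim: G => [//|h G IH]; rewrite inE => /predU1P[->|/IH hg] /=.
  by exists 1; [apply: sa1|rewrite mul1r subrr; case: (modgen_submodule G hI)].
by exists 0; [apply: sa0|rewrite mul0r subr0].
Qed.

(** Finite dimension of A/b0 is used twice: it gives finitely many generators of m, and finitely
    many residues to lift, so that A = L + m for a coefficient algebra L. *)
Lemma principal_maximal_ideal : exists z, [/\ m z, z != 0 & m `<=` scaled z A].
Proof.
have mS := nonunits_subspace loc.
have bS := scaled_subspace b0 A.
have bm : scaled b0 A `<=` m by move=> _ [r Ar ->]; rewrite mulrC; apply: nonunitsM.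
have [|E' hE' mE'] := spanmod_finite_dim bS mS bm (E := E).
  by move=> f mf; apply/AE/nonunits_sub.
have [L hL LE] := coef_algebra_exists loc tr1 ac perf mb0 b0_neq0 hE.
have [LA _ _] := hL.
have AL a : a \inS A -> exists2 l, l \inS L & m (a - l).
  move/AE; apply: (@spanmod_min _ _ _ _ _ [set a | exists2 l, l \inS L & m (a - l)]).
  - split=> [|x y [l Ll ml] [l' Ll' ml']|c x [l Ll ml]] /=.
    + by exists 0; [apply: sa0|rewrite subrr; apply: nonunits0].
    + exists (l - l'); first exact: saB.
      by rewrite (_ : _ - _ = (x - l) - (y - l')); [apply: loc|ring].
    + exists (iota c * l); first by apply: saM => //; apply: sa_const.
      by rewrite -mulrBr; apply: nonunitsM => //; apply: sa_const.
  - by move=> x /bm mx; exists 0; [apply: sa0|rewrite subr0].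
  - exact: LE.
have [z mz mgen] := cotangent_generator loc smooth hL AL.
have mz' : m `<=` scaled z A.
  apply: (@nakayama _ _ _ _ loc (b0 :: E')).
  - exact: scaled_submodule.
  - by move=> g; rewrite inE => /predU1P[->//|/hE'].
  - move=> f /mE'; have hz := scaled_submodule z.
    have hmod := modgen_submodule (b0 :: E') hz.
    apply: spanmod_min; first exact: submodule_subspace.
      move=> _ [r Ar ->]; rewrite mulrC; case: hmod => _ _; apply => //.
      by apply: mem_modgen => //; rewrite inE eqxx.
    by move=> e eE'; apply: mem_modgen => //; rewrite inE eE' orbT.
  - move=> f /mgen[a Aa h]; exists (a * z) => //.
    by exists a => //; rewrite mulrC.
exists z; split=> //.
by apply: contraNneq b0_neq0 => z0; have [r _ ->] := mz' _ mb0; rewrite z0 mul0r.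
Qed.
End PrincipalMaximalIdeal.

(** * The valuation defined by a principal maximal ideal *)

Section DiscreteValuation.
Variables (k F : fieldType) (iota : {rmorphism k -> F}) (A : subalg iota).
Hypotheses (tr1 : transcendence_degree1 iota) (ac : algebraically_closed_in iota)
  (loc : local_subalg A) (fracA : fractions_of (subalg_set A) = setT).
Local Notation m := (nonunits (subalg_set A)).
Variable z : F.
Hypotheses (mz : m z) (z0 : z != 0) (mgen : m `<=` scaled z A).

Definition sunit (u : F) : Prop := u \inS A /\ ~ m u.

Lemma sunit1 : sunit 1. Proof. by split; [apply: sa1|apply: nonunits1]. Qed.
Lemma sunitP u : sunit u <-> [/\ u != 0, u \inS A & u^-1 \inS A].
Proof.
split=> [[Au nu]|[u0 Au Aui]]; last by split=> //; apply: unit_nonunit.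
by have [] := nonunitPn Au nu.
Qed.
Lemma sunitM u w : sunit u -> sunit w -> sunit (u * w).
Proof.
move=> /sunitP[u0 Au Aui] /sunitP[w0 Aw Awi]; apply/sunitP.
by rewrite mulf_neq0// invfM; split=> //; apply: saM.
Qed.
Lemma sunitV u : sunit u -> sunit u^-1.
Proof.
by move=> /sunitP[u0 Au Aui]; apply/sunitP; rewrite invr_eq0 u0 invrK.
Qed.

(** Each factor z stripped from f lowers j; at j = 0 the element f divides a unit. *)
Lemma dvr_factor_dvd j f r u : f \inS A -> r \inS A -> sunit u -> f * r = z ^+ j * u ->
  exists i w, sunit w /\ f = z ^+ i * w.
Proof.
elim: j f r => [|j IH] f r Af Ar hu e.
  exists 0%N, f; rewrite mul1r; split=> //; split=> // mf.
  have [_ nu] := hu; apply: nu; rewrite -[u]mul1r -(expr0 z) -e mulrC.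
  exact: nonunitsM.
have [mf|nf] := pselect (m f); last by exists 0%N, f; rewrite mul1r.
have [f' Af' fe] := mgen mf.
have [|i [w [hw fe']]] := IH f' r Af' Ar hu.
  by apply: (mulfI z0); rewrite mulrA -fe e exprS mulrA.
by exists i.+1, w; split=> //; rewrite exprS -mulrA -fe'.
Qed.

(** Some nonzero Q(z) is a multiple of f, and Q(z) is z^j times a unit, with j the order of Q at 0.
    Hence f can be divided by z only finitely often. *)
Lemma dvr_factor f : f \inS A -> f != 0 -> exists i u, sunit u /\ f = z ^+ i * u.
Proof.
move=> Af f0; have [mf|nf] := pselect (m f); last by exists 0%N, f; rewrite mul1r.
have nf := nonunit_transcendental ac mf f0.
have Az := nonunits_sub mz.
have [Q + /(_ A Af Az)] := trdeg1_div tr1 z nf.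
suff : forall Q, Q != 0 -> exists j u, sunit u /\ ev iota z Q = z ^+ j * u.
  by move=> h /h[j [u [hu ->]]] [r Ar /esym]; apply: dvr_factor_dvd.
elim/poly_ind => [|P c IH]; first by rewrite eqxx.
rewrite evMXaddC; have [->|c0] := eqVneq c 0.
  rewrite addr0 mulf_eq0 negb_or rmorph0 addr0 => /andP[/IH[j [u [hu ->]]] _].
  by exists j.+1, u; rewrite exprSr mulrAC.
move=> _; exists 0%N, (ev iota z P * z + iota c); rewrite mul1r; split=> //.
split; first by apply/saD/sa_const/saM => //; apply: sa_ev.
move=> h; apply: (@unit_nonunit _ _ _ A (iota c)); rewrite ?fmorph_eq0//.
  by rewrite -fmorphV; apply: sa_const.
rewrite -[iota c](addKr (ev iota z P * z)) addrC; apply: loc => //.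
by apply: nonunitsM => //; apply: sa_ev.
Qed.

Lemma dvr_fraction f : f != 0 -> exists n u, sunit u /\ f = z ^ n * u.
Proof.
move=> f0; have [a [b [Aa Ab b0 fe]]] : fractions_of (subalg_set A) f by rewrite fracA.
have a0 : a != 0 by apply: contraNneq f0 => a0; rewrite fe a0 mul0r.
have [i [u [hu ae]]] := dvr_factor Aa a0; have [j [w [hw be]]] := dvr_factor Ab b0.
have /sunitP[w0 _ _] := hw.
exists (i%:Z - j%:Z), (u / w); split; first exact/sunitM/sunitV.
rewrite fe ae be expfzDr// -invr_expz -!exprnP; field.
by rewrite w0 expf_neq0.
Qed.

Lemma sunit_expz n u w : sunit u -> z ^ n * u = w -> w \inS A -> 0 <= n.
Proof.
move=> /sunitP[u0 Au Aui] e Aw; rewrite leNgt; apply/negP.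
case: n e => [n _ //|n e _]; have /unit_nonunit : z != 0 by []; apply; last exact: mz.
have -> : z^-1 = z ^+ n * (u^-1 * w).
  rewrite -e mulrCA [u^-1 * _]mulrC; rewrite NegzE -invr_expz -exprnP exprS.
  by field; rewrite z0 u0 expf_neq0.
by apply: saM; [apply/saX/nonunits_sub/mz|apply: saM].
Qed.

Lemma dvr_unique n n' u u' : sunit u -> sunit u' -> z ^ n * u = z ^ n' * u' -> n = n'.
Proof.
wlog : n n' u u' / n <= n' => [h hu hu' e|nn' hu hu' e].
  case: (leP n n') => [nn'|/ltW nn']; first exact: h nn' hu hu' e.
  by rewrite (h _ _ _ _ nn' hu' hu (esym e)).
apply/eqP; rewrite eq_le nn' -subr_ge0.
have /sunitP[u0 _ _] := hu.
have zn : z ^ n' != 0 by rewrite expfz_neq0.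
have [Aw _] := sunitM hu' (sunitV hu).
apply: (@sunit_expz (n - n') 1 (u' / u)) => //; first exact: sunit1.
rewrite mulr1 expfzDr// -invr_expz.
by apply: (mulIf u0); apply: (mulIf zn); rewrite mulrAC divfK// e divfK// mulrC.
Qed.

Definition dvr_val (f : F) : int :=
  if pselect (f != 0) is left f0 then projT1 (cid (dvr_fraction f0)) else 0.

Lemma dvr_valP f : f != 0 -> exists2 u, sunit u & f = z ^ dvr_val f * u.
Proof.
by move=> f0; rewrite /dvr_val; case: pselect => // h; case: cid => n [u []] /=; exists u.
Qed.

Lemma dvr_val_eq f n u : sunit u -> f = z ^ n * u -> dvr_val f = n.
Proof.
move=> hu e; have [u0 _ _] := (iffLR (sunitP u) hu).
have /dvr_valP[w hw] : f != 0 by rewrite e mulf_neq0// expfz_neq0.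
by rewrite {1}e => /esym; apply: dvr_unique.
Qed.

Lemma dvr_val0 : dvr_val 0 = 0.
Proof. by rewrite /dvr_val; case: pselect => // h; exfalso; move: h; rewrite eqxx. Qed.

Lemma dvr_valM f g : f != 0 -> g != 0 -> dvr_val (f * g) = dvr_val f + dvr_val g.
Proof.
move=> /dvr_valP[u hu fe] /dvr_valP[w hw ge].
apply: (@dvr_val_eq _ _ (u * w)); first exact: sunitM.
by rewrite {1}fe {1}ge expfzDr//; ring.
Qed.

Lemma dvr_val_ge0 f : f != 0 -> 0 <= dvr_val f <-> f \inS A.
Proof.
move=> f0; split=> [|Af].
  have [u [Au _] fe] := dvr_valP f0; rewrite {2}fe; case: (dvr_val f) => // n _.
  by apply: saM => //; rewrite -exprnP; apply/saX/nonunits_sub.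
have [i [u [hu fe]]] := dvr_factor Af f0.
by rewrite (@dvr_val_eq f i%:Z u).
Qed.

Lemma dvr_valD f g : f != 0 -> g != 0 -> f + g != 0 ->
  Num.min (dvr_val f) (dvr_val g) <= dvr_val (f + g).
Proof.
wlog fg : f g / dvr_val f <= dvr_val g => [h f0 g0 s0|f0 g0 s0].
  case: (leP (dvr_val f) (dvr_val g)) => [fg|/ltW gf].
    by have := h f g fg f0 g0 s0; rewrite min_l.
  by have := h g f gf g0 f0; rewrite addrC min_l//; apply.
rewrite min_l//.
have [u [Au _] fe] := dvr_valP f0; have [w [Aw _] ge] := dvr_valP g0.
have zn : z ^ dvr_val f != 0 by rewrite expfz_neq0.
have t0 : (f + g) / z ^ dvr_val f != 0 by rewrite mulf_neq0// invr_eq0.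
have tz : z ^ dvr_val f * ((f + g) / z ^ dvr_val f) = f + g by rewrite mulrC divfK.
rewrite -tz dvr_valM// (@dvr_val_eq (z ^ dvr_val f) (dvr_val f) 1) ?mulr1//; last exact: sunit1.
rewrite lerDl; apply/dvr_val_ge0 => //.
have -> : (f + g) / z ^ dvr_val f = u + z ^ (dvr_val g - dvr_val f) * w.
  apply: (mulIf zn); rewrite divfK// mulrDl {1}fe {1}ge mulrAC -expfzDr// subrK mulrC.
  by congr (_ + _); rewrite mulrC.
apply: saD => //; apply: saM => //.
move: fg; rewrite -subr_ge0; case: (_ - _) => // n _.
by rewrite -exprnP; apply/saX/nonunits_sub.
Qed.

Lemma dvr_val_const c : dvr_val (iota c) = 0.
Proof.
have [->|c0] := eqVneq c 0; first by rewrite rmorph0 dvr_val0.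
apply: (@dvr_val_eq _ _ (iota c)); last by rewrite expr0z mul1r.
apply/sunitP; rewrite fmorph_eq0 c0 -fmorphV; split=> //; exact: sa_const.
Qed.

Lemma dvr_val_normalized : exists t, dvr_val t = 1.
Proof. by exists z; apply: (@dvr_val_eq _ _ 1); [apply: sunit1|rewrite mulr1 expr1z]. Qed.

Definition dvr_place : place iota :=
  Place dvr_val0 dvr_valM dvr_valD dvr_val_const dvr_val_normalized.

Lemma dvr_place_ring : subalg_set (place_ring dvr_place) = A.
Proof.
apply/seteqP; split=> f /=; rewrite /pge.
  have [->|f0 /= h] := eqVneq f 0; first by move=> _; apply: sa0.
  exact/dvr_val_ge0.
by have [->//|f0 /= Af] := eqVneq f 0; apply/dvr_val_ge0.
Qed.
End DiscreteValuation.

(** * Places and everywhere regular functions *)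

Section PlacesOfCurve.
Variables (k F : fieldType) (iota : {rmorphism k -> F}).

Lemma subalg_ext (A B : subalg iota) : subalg_set A = subalg_set B -> A = B.
Proof.
case: A B => [A a1 a2 a3] [B b1 b2 b3] /= e; subst B.
by congr Subalg; apply: Prop_irrelevance.
Qed.

Lemma place_ext (v w : place iota) : pval v = pval w -> v = w.
Proof.
case: v w => [v a1 a2 a3 a4 a5] [w b1 b2 b3 b4 b5] /= e; subst w.
by congr Place; apply: Prop_irrelevance.
Qed.

Lemma pvalX (v : place iota) f n : v (f ^+ n) = v f *+ n.
Proof.
have [->|f0] := eqVneq f 0.
  case: n => [|n]; first by rewrite expr0 pval1 mulr0n.
  by rewrite expr0n /= pval0 mul0rn.
elim: n => [|n IH]; first by rewrite expr0 pval1 mulr0n.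
by rewrite exprS pvalM ?expf_neq0// IH mulrS.
Qed.

Lemma pvalZ (v : place iota) f (n : int) : v (f ^ n) = v f * n.
Proof.
case: n => n; first by rewrite -exprnP pvalX -mulr_natr natz.
by rewrite NegzE -invr_expz pvalV -exprnP pvalX -mulr_natr natz mulrN.
Qed.

(** Units of the first ring are units of the second, so w is the multiple w(t) v for a uniformizer t
    of v; both valuations being normalized, w(t) = 1. *)
Lemma place_ring_le_eq (v w : place iota) :
  place_ring v `<=` place_ring w -> v = w.
Proof.
move=> vw; have h0 f : f != 0 -> 0 <= v f -> 0 <= w f.
  move=> f0 vf; have := vw f; rewrite /= /pge (negPf f0) /=; exact.
have h1 f : f != 0 -> v f = 0 -> w f = 0.
  move=> f0 vf; apply/eqP; rewrite eq_le h0 ?vf// andbT.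
  by rewrite -oppr_ge0 -pvalV h0 ?invr_eq0// pvalV vf oppr0.
have [t vt] := pval_normalized v.
have t0 : t != 0 by apply/eqP => t0; move: vt; rewrite t0 pval0.
have ht f : f != 0 -> w f = w t * v f.
  move=> f0; have ft : f / t ^ v f != 0 by rewrite mulf_neq0// invr_eq0 expfz_neq0.
  have := h1 _ ft; rewrite !pvalM ?invr_eq0 ?expfz_neq0// !pvalV !pvalZ vt mul1r subrr.
  by move=> /(_ erefl)/eqP; rewrite subr_eq0 => /eqP.
have wt : w t = 1.
  have [s ws] := pval_normalized w.
  have s0 : s != 0 by apply/eqP => s0; move: ws; rewrite s0 pval0.
  have := h0 t t0; rewrite vt ler01 => /(_ isT) wt0.
  have := ht _ s0; rewrite ws => e.
  apply/eqP; rewrite eq_le -[1 <= _]gtz0_ge1 lt_neqAle wt0 andbT leNgt.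
  apply/andP; split; [apply/negP => h|apply/negP => /eqP w0]; last by move: e; rewrite -w0 mul0r.
  have vs : 0 < v s by rewrite -(pmulr_rgt0 _ (lt_trans ltr01 h)) -e ltr01.
  by move: vs; rewrite gtz0_ge1 -(ler_pM2l (lt_trans ltr01 h)) mulr1 -e leNgt h.
apply: place_ext; apply/funext => f; have [->|f0] := eqVneq f 0; first by rewrite !pval0.
by rewrite (ht f f0) wt mul1r.
Qed.

Variable X : set (subalg iota).
Hypotheses (perf : perfect_field k) (curveX : curve X) (smoothX : smooth_curve X)
  (completeX : complete_curve X) (ac : algebraically_closed_in iota).

Let tr1 : transcendence_degree1 iota. Proof. by case: curveX. Qed.

Lemma curve_chart A : X A -> exists s p,
  [/\ fractions_of (generated iota s) = setT, prime_of (generated iota s) p &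
      subalg_set A = localization (generated iota s) p].
Proof.
case: curveX => -[charts [hc ->]] _ _ [s [p [sc pp hA]]].
by exists s, p; split=> //; apply: hc.
Qed.

Lemma curve_fractions A : X A -> fractions_of (subalg_set A) = setT.
Proof.
move=> /curve_chart[s [p [fr pp hA]]]; apply/seteqP; split=> // f _.
have [a [b [Ra Rb b0 ->]]] : fractions_of (generated iota s) f by rewrite fr.
by exists a, b; split=> //; apply: (chart_sub pp hA).
Qed.

(** The condition on A excludes the generic point, whose local ring is F. Any other A has a nonzero
    nonunit: a denominator of a function outside A. *)
Lemma curve_local_ring_dvr A : X A -> subalg_set A <> setT -> exists v, place_ring v = A.
Proof.
move=> XA nA; have [s [p [fr pp hA]]] := curve_chart XA.
have frA := curve_fractions XA.
have loc := chart_local pp hA.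
have [b mb b0] : exists2 b, nonunits (subalg_set A) b & b != 0.
  have [f nf] : exists f, ~ f \inS A.
    apply: contrapT => h; apply: nA; apply/seteqP; split=> // f _.
    by apply: contrapT => nf; apply: h; exists f.
  have [a [b [Aa Ab b0 fe]]] : fractions_of (subalg_set A) f by rewrite frA.
  exists b => //; split=> //; right => Abi; apply: nf.
  by rewrite fe; apply: saM.
have [E hE AE] := chart_mod_finite pp hA tr1 ac mb b0.
have [z [mz z0 mgen]] := principal_maximal_ideal tr1 ac perf loc (smoothX XA) mb b0 hE AE.
exists (dvr_place tr1 ac loc frA mz z0 mgen).
exact/subalg_ext/dvr_place_ring.
Qed.

(** * Chevalley's extension theorem *)

Section Chevalley.
Variable f : F.
Hypothesis nf : ~ algebraicOver iota f.

Let f0 : f != 0.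
Proof. by apply: contra_notN nf => /eqP ->; apply: algebraic0. Qed.

Definition poly_ring_set : set F := [set x | exists p, x = ev iota f^-1 p].
Lemma poly_ring_const c : poly_ring_set (iota c).
Proof. by exists c%:P; rewrite evC. Qed.
Lemma poly_ringB x y : poly_ring_set x -> poly_ring_set y -> poly_ring_set (x - y).
Proof. by move=> [p ->] [q ->]; exists (p - q); rewrite rmorphB. Qed.
Lemma poly_ringM x y : poly_ring_set x -> poly_ring_set y -> poly_ring_set (x * y).
Proof. by move=> [p ->] [q ->]; exists (p * q); rewrite rmorphM. Qed.
Definition poly_ring : subalg iota := Subalg poly_ring_const poly_ringB poly_ringM.

Definition avoiding (B : subalg iota) : Prop := f^-1 \inS B /\ ~ f \inS B.

(** If f = p(f^-1), then f^-1 is a root of X p - 1, whose constant term is -1, contradicting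
    transcendence. *)
Lemma poly_ring_avoiding : avoiding poly_ring.
Proof.
split; first by exists 'X; rewrite evX.
move=> [p fe]; apply: nf; rewrite -[f]invrK; apply: algebraic_inv.
exists ('X * p - 1).
  apply/eqP => /(congr1 (fun q : {poly k} => q`_0)).
  by rewrite coefB coefXM coef1 coef0 sub0r => /eqP; rewrite oppr_eq0 oner_eq0.
by rewrite /root -evE rmorphB rmorphM rmorph1 /= evX -fe mulVf// subrr.
Qed.

Lemma maximal_avoiding : exists V : subalg iota, avoiding V /\
  forall B : subalg iota, subalg_set V `<=` B -> ~ f \inS B -> subalg_set B `<=` V.
Proof.
pose T := {B : subalg iota | avoiding B}.
pose R (s t : T) := `[< subalg_set (sval s) `<=` sval t >].
have [||C totC|[V hV] Vmax] := @ZL_preorder T (exist _ _ poly_ring_avoiding) R.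
- by move=> t; apply/asboolP.
- by move=> r s t /asboolP rs /asboolP st; apply/asboolP; apply: subset_trans st.
- have [[t0 Ct0]|nC] := pselect (exists t, C t); last first.
    by exists (exist _ _ poly_ring_avoiding) => s Cs; case: nC; exists s.
  pose U : set F := [set x | exists2 t, C t & x \inS sval t].
  have U2 (P : F -> F -> F) : (forall (B : subalg iota) x y, x \inS B -> y \inS B -> P x y \inS B) ->
      forall x y, U x -> U y -> U (P x y).
    move=> hP x y [s Cs sx] [t Ct ty].
    have [/asboolP st|/asboolP ts] := totC _ _ Cs Ct.
      by exists t => //; apply: hP => //; apply: st.
    by exists s => //; apply: hP => //; apply: ts.
  have Uc c : U (iota c) by exists t0 => //; apply: sa_const.
  pose BU := Subalg Uc (U2 _ (@saB _ _ _)) (U2 _ (@saM _ _ _)).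
  have hBU : avoiding BU.
    split; first by exists t0 => //; case: (svalP t0).
    by move=> [t _]; case: (svalP t).
  exists (exist _ _ hBU) => s Cs; apply/asboolP => x sx; exists s => //.
- exists V; split=> // B VB nB.
  have hB : avoiding B by split=> //; apply: VB; exact: (proj1 hV).
  by have /(_ _)/asboolP := Vmax (exist _ _ hB); apply; apply/asboolP.
Qed.

Section Maximal.
Variable V : subalg iota.
Hypotheses (hV : avoiding V)
  (Vmax : forall B : subalg iota, subalg_set V `<=` B -> ~ f \inS B -> subalg_set B `<=` V).
Local Notation I := (scaled f^-1 V).

Let I1 : ~ I 1.
Proof.
move=> [r Vr e]; case: hV => _; apply; rewrite (_ : f = r)//.
by rewrite -[LHS]mulr1 e mulVKf.
Qed.

(** By maximality it suffices that V[(1-q)^-1] avoids f. Otherwise f (1-q)^n lies in V for some n;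
    since (1-q)^n = 1 - f^-1 t with t in V, this puts f - t, hence f, in V. *)
Lemma avoiding_unit q : I q -> 1 - q != 0 /\ (1 - q)^-1 \inS V.
Proof.
move=> Iq; have u0 : 1 - q != 0.
  by apply/eqP => /eqP; rewrite subr_eq0 => /eqP e; apply: I1; rewrite e.
split=> //; apply: (Vmax (B := adjoin V (1 - q)^-1)); last exact: mem_adjoin.
  by move=> x; apply: sub_adjoin.
move=> [P VP fP].
have Vq : q \inS V by have [r Vr ->] := Iq; apply: saM => //; case: hV.
have Vu : 1 - q \inS V by apply: saB => //; apply: sa1.
have Vfu : f * (1 - q) ^+ (size P) \inS V.
  rewrite fP horner_coef mulr_suml; apply: sa_sum => i.
  rewrite -mulrA; apply: saM => //.
  rewrite -[X in _ * _ ^+ X](subnK (ltnW (ltn_ord i))) exprD mulrCA -exprMn mulVf//.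
  by rewrite expr1n mulr1; apply: saX.
have [t Vt ut] : exists2 t, t \inS V & (1 - q) ^+ (size P) = 1 - f^-1 * t.
  have [r Vr qe] := Iq; elim: (size P) => [|n [t Vt IH]].
    by exists 0; [apply: sa0|rewrite mulr0 subr0].
  exists (r + t * (1 - q)); first by apply: saD => //; apply: saM.
  by rewrite exprSr IH qe; ring.
case: hV => _; apply; rewrite -(subrK t f); apply: saD => //.
by move: Vfu; rewrite ut mulrBr mulr1 mulVKf.
Qed.

Definition ideal_coefs (P : {poly F}) : Prop := forall i, I P`_i.

(** The relation for x^-1, multiplied by x^l and divided by the unit 1 - Q_0, expresses x^l by lower
    powers of x; substituting this for the leading power in P shortens it. *)
Lemma avoiding_shorten x P Q : x != 0 -> ideal_coefs P -> ideal_coefs Q ->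
  P.[x] = 1 -> Q.[x^-1] = 1 -> (size Q <= size P)%N ->
  exists P', [/\ ideal_coefs P', P'.[x] = 1 & (size P' < size P)%N].
Proof.
move=> x0 IP IQ Px Qx sQP.
have [I0 IB IZ] := scaled_subspace f^-1 V.
have IM a b : I a -> b \inS V -> I (a * b).
  by move=> [r Vr ->] Vb; exists (r * b); [apply: saM|rewrite mulrA].
have sP : (1 < size P)%N.
  rewrite ltnNge; apply/negP => /size1_polyC Pc; apply: I1.
  by rewrite -Px Pc hornerC.
pose l := (size P).-1.
have sPl : size P = l.+1 by rewrite prednK// ltnW.
have [u0 Vu] := avoiding_unit (IQ 0%N).
pose T := \sum_(j < l) (Q`_j.+1 / (1 - Q`_0)) *: 'X^(l - j.+1).
have Tx : T.[x] = x ^+ l.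
  apply: (mulIf u0); rewrite /T horner_sum mulr_suml.
  have e : 1 - Q`_0 = \sum_(j < l) Q`_j.+1 * x^-1 ^+ j.+1.
    rewrite -Qx (@horner_coef_wide _ l.+1) -?sPl// sPl big_ord_recl /= expr0 mulr1.
    by rewrite addrC addrA addNr add0r.
  rewrite [in RHS]e mulr_sumr; apply: eq_bigr => j _; rewrite hornerZ hornerXn mulrAC divfK//.
  rewrite mulrCA; congr (_ * _); rewrite -[X in _ = x ^+ X * _](subnK (ltn_ord j)) exprD.
  by rewrite -mulrA -exprMn mulfV// expr1n mulr1.
have TV i : T`_i \inS V.
  rewrite /T coef_sum; apply: sa_sum => j; rewrite coefZ; apply: saM.
    apply: saM => //; have [r Vr ->] := IQ j.+1.
    by apply: saM => //; case: hV.
  exact: coefs_inXn.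
have sT : (size T <= l)%N.
  apply: leq_trans (size_sum _ _ _) _; apply/bigmax_leqP => j _.
  apply: leq_trans (size_scale_leq _ _) _; rewrite size_polyXn.
  by rewrite -subSn//; apply: leq_subr.
pose P0 := P - (lead_coef P)%:P * 'X^l.
have sP0 : (size P0 <= l)%N.
  apply/leq_sizeP => j hj; rewrite coefB coefCM coefXn.
  have [->|nj] := eqVneq j l; first by rewrite mulr1 subrr.
  rewrite mulr0 subr0 nth_default// sPl ltn_neqAle eq_sym nj; exact: hj.
exists (P0 + (lead_coef P)%:P * T); split.
- move=> i; rewrite coefD coefB !coefCM.
  have h : I (P`_i - lead_coef P * 'X^l`_i).
    by apply: (IB); [apply: IP|apply: IM; [apply: IP|apply: coefs_inXn]].
  apply: (subspaceD (scaled_subspace f^-1 V)) => //; apply: IM => //; exact: IP.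
- rewrite hornerD hornerD hornerN !hornerCM hornerXn Tx subrK; exact: Px.
rewrite sPl ltnS; apply: leq_trans (size_polyD _ _) _; rewrite geq_max sP0 /=.
by rewrite mul_polyC; apply: leq_trans (size_scale_leq _ _) _.
Qed.

Lemma avoiding_no_relations x P Q : x != 0 -> ideal_coefs P -> ideal_coefs Q ->
  P.[x] = 1 -> Q.[x^-1] = 1 -> False.
Proof.
have [n] := ubnP (size P + size Q)%N; elim: n x P Q => // n IH x P Q sPQ x0 IP IQ Px Qx.
have [sQP|/ltnW sPQ'] := leqP (size Q) (size P).
  have [P' [IP' Px' sP']] := avoiding_shorten x0 IP IQ Px Qx sQP.
  apply: (IH x P' Q) => //; rewrite ltnS in sPQ; apply: leq_trans sPQ.
  by rewrite ltn_add2r.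
have xi0 : x^-1 != 0 by rewrite invr_eq0.
have Px' : P.[x^-1^-1] = 1 by rewrite invrK.
have [Q' [IQ' Qx' sQ']] := avoiding_shorten xi0 IQ IP Qx Px' sPQ'.
apply: (IH x P Q') => //; rewrite ltnS in sPQ; apply: leq_trans sPQ.
by rewrite ltn_add2l.
Qed.

(** If x is not in V, maximality puts f in V[x]; dividing f = P(x) by f gives a relation with value
    1 and coefficients in f^-1 V. Shortening excludes such relations for both x and x^-1. *)
Lemma avoiding_valuation_ring : valuation_ring V.
Proof.
have rel x : ~ x \inS V -> exists2 P, ideal_coefs P & P.[x] = 1.
  move=> nx; have : f \inS adjoin V x.
    apply: contrapT => h; apply: nx; apply: (Vmax (B := adjoin V x)) => //.
      by move=> y; apply: sub_adjoin.
    exact: mem_adjoin.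
  move=> [P VP fP]; exists (f^-1 *: P).
    by move=> i; rewrite coefZ; exists P`_i.
  by rewrite hornerZ -fP mulVf.
move=> x x0; apply: contrapT => /not_orP[/rel[P IP Px] /rel[Q IQ Qx]].
exact: avoiding_no_relations Px Qx.
Qed.
End Maximal.

Lemma valuation_ring_avoiding : exists2 V : subalg iota, valuation_ring V & ~ f \inS V.
Proof.
have [V [hV Vmax]] := maximal_avoiding.
by exists V; [exact: avoiding_valuation_ring|case: hV].
Qed.
End Chevalley.

(** The valuation ring avoiding f dominates a local ring of X, which therefore misses f; being
    different from F, it is the ring of a place. *)
Lemma exists_pole f : ~ algebraicOver iota f -> exists x : closed_point X, place_of x f < 0.
Proof.
move=> nf; have [V vV nfV] := valuation_ring_avoiding nf.
have [A XA [AV _]] := completeX vV.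
have nA : ~ f \inS A by move=> /AV.
have [|v vA] := curve_local_ring_dvr XA.
  by move=> AT; apply: nA; rewrite AT.
have Xv : [set v : place iota | X (place_ring v)] v by rewrite /= vA.
exists (SigSub (mem_set Xv)); rewrite /place_of /set_val /=.
rewrite ltNge; apply/negP => vf; apply: nA; rewrite -vA /= /pge.
by rewrite vf orbT.
Qed.

Lemma everywhere_regular f : (forall x : closed_point X, 0 <= place_of x f) ->
  exists c, f = iota c.
Proof.
move=> h; apply: ac; apply: contrapT => /exists_pole[x].
by rewrite ltNge h.
Qed.
End PlacesOfCurve.

(** * Completions and idele classes *)

Section ValuedField.
Variables (K : fieldType) (w : K -> int).
Implicit Types (a b r s : K) (n m : int).

Definition wge n a : bool := (a == 0) || (n <= w a).

Hypotheses (wM : forall a b, a != 0 -> b != 0 -> w (a * b) = w a + w b)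
  (wgeD : forall n a b, wge n a -> wge n b -> wge n (a + b)).

Lemma wge0 n : wge n 0. Proof. by rewrite /wge eqxx. Qed.
Lemma wgeE n a : a != 0 -> wge n a = (n <= w a).
Proof. by rewrite /wge => /negPf ->. Qed.
Lemma w1 : w 1 = 0.
Proof.
have := wM (oner_neq0 K) (oner_neq0 K); rewrite mulr1 => e.
by apply: (addrI (w 1)); rewrite addr0 -e.
Qed.
Lemma wV a : a != 0 -> w a^-1 = - w a.
Proof. by move=> a0; apply/eqP; rewrite -addr_eq0 -wM ?invr_eq0// mulVf// w1. Qed.
Lemma wN1 : w (-1) = 0.
Proof.
have h : (-1 : K) != 0 by rewrite oppr_eq0 oner_eq0.
by have := wM h h; rewrite mulrNN mulr1 w1 => e; lia.
Qed.
Lemma wgeN n a : wge n (- a) = wge n a.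
Proof.
rewrite /wge oppr_eq0; have [//|a0 /=] := eqVneq a 0.
by rewrite -mulN1r wM ?wN1 ?add0r// oppr_eq0 oner_eq0.
Qed.
Lemma wgeB n a b : wge n a -> wge n b -> wge n (a - b).
Proof. by move=> h1 h2; apply: wgeD => //; rewrite wgeN. Qed.
Lemma wgeM n m a b : wge n a -> wge m b -> wge (n + m) (a * b).
Proof.
have [->|a0] := eqVneq a 0; first by rewrite mul0r !wge0.
have [->|b0] := eqVneq b 0; first by rewrite mulr0 !wge0.
by rewrite (wgeE _ a0) (wgeE _ b0) (wgeE _ (mulf_neq0 a0 b0)) wM//; apply: lerD.
Qed.
Lemma wge_le n m a : m <= n -> wge n a -> wge m a.
Proof. by rewrite /wge => mn /orP[->//|na]; rewrite (le_trans mn na) orbT. Qed.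
Lemma wge01 : wge 0 1. Proof. by rewrite wgeE ?oner_eq0// w1. Qed.

Lemma w_close n a b : a != 0 -> wge n (a - b) -> w a < n -> b != 0 /\ w b = w a.
Proof.
move=> a0 h wn; have b0 : b != 0.
  by apply: contraTneq wn => b0; move: h; rewrite b0 subr0 wgeE// -leNgt.
split=> //; apply/eqP; rewrite eq_le; apply/andP; split.
  rewrite leNgt; apply/negP => hlt.
  have : wge (w a + 1) a.
    rewrite -{2}(subrK b a); apply: wgeD; first by apply: wge_le h; lia.
    by rewrite wgeE//; lia.
  by rewrite wgeE//; lia.
rewrite -wgeE// -(subKr a b); apply: wgeB; first by rewrite wgeE.
exact: wge_le (ltW wn) h.
Qed.

(** The difference is (b (a - x) - a (b - y)) / (b y), and the denominator has value 2 w(b): this is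
    the precision lost by dividing. *)
Lemma wge_div n N a b x y : b != 0 -> wge 0 a -> wge 0 b ->
  wge N (a - x) -> wge N (b - y) -> n + 2 * w b <= N -> w b < N ->
  wge n (a / b - x / y).
Proof.
move=> b0 ha hb hx hy nN wN; have [y0 wy] := w_close b0 hy wN.
have -> : a / b - x / y = (b * (a - x) - a * (b - y)) * (b * y)^-1.
  by field; rewrite b0 y0.
have by0 : b * y != 0 by rewrite mulf_neq0.
rewrite -(addrK (2 * w b) n); apply: wgeM; last first.
  by rewrite wgeE ?invr_eq0// wV// wM// wy; lia.
by apply: wgeB; apply: (wge_le nN); rewrite -[N]add0r; apply: wgeM.
Qed.

(* For [n = 0] and [r != 0] this says that [w r = 0]. *)
Definition near1 n r : Prop := wge n (r - 1) /\ wge n (r^-1 - 1).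

Lemma near1_1 n : near1 n 1.
Proof. by rewrite /near1 invr1 subrr; split; apply: wge0. Qed.
Lemma near1V n r : near1 n r -> near1 n r^-1.
Proof. by case; split=> //; rewrite invrK. Qed.
Lemma near1_le m n r : m <= n -> near1 n r -> near1 m r.
Proof. by move=> mn [h1 h2]; split; apply: wge_le mn _. Qed.
Lemma wge_sub1 n r : 0 <= n -> wge n (r - 1) -> wge 0 r.
Proof.
by move=> n0 h; rewrite -(subrK 1 r); apply: wgeD; [exact: wge_le h|exact: wge01].
Qed.
Lemma near1M n r s : 0 <= n -> near1 n r -> near1 n s -> near1 n (r * s).
Proof.
have mul a b : 0 <= n -> wge n (a - 1) -> wge n (b - 1) -> wge n (a * b - 1).
  move=> n0 ha hb; have -> : a * b - 1 = (a - 1) * b + (b - 1) by ring.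
  by apply: wgeD => //; rewrite -[n]addr0; apply: wgeM => //; apply: wge_sub1 hb.
by move=> n0 [r1 r2] [s1 s2]; split; rewrite ?invfM; apply: mul.
Qed.
Lemma near1_of_wge r : wge 1 (r - 1) -> near1 1 r.
Proof.
move=> h; split=> //.
have r0 : r != 0.
  by apply: contraTneq h => ->; rewrite sub0r wgeN wgeE ?oner_eq0// w1.
have [_ wr] : r != 0 /\ w r = w 1.
  apply: (@w_close 1); rewrite ?oner_eq0 ?w1//.
  by rewrite -opprB wgeN.
have -> : r^-1 - 1 = - ((r - 1) * r^-1) by field.
rewrite wgeN -[1 : int]addr0; apply: wgeM => //.
by rewrite wgeE ?invr_eq0// wV// wr w1.
Qed.
Lemma near1_0P r : r != 0 -> near1 0 r <-> w r = 0.
Proof.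
move=> r0; split=> [[h1 h2]|e].
  have := wge_sub1 (lexx 0) h1; have := wge_sub1 (lexx 0) h2.
  by rewrite !wgeE ?invr_eq0// wV//; lia.
by split; apply: wgeB wge01; rewrite wgeE ?invr_eq0// ?wV// e.
Qed.
Lemma near1_div_val n a b : 0 <= n -> a != 0 -> b != 0 -> near1 n (a / b) -> w a = w b.
Proof.
move=> n0 a0 b0 /(near1_le n0) /near1_0P; rewrite mulf_neq0 ?invr_eq0// => /(_ isT).
by rewrite wM ?invr_eq0// wV//; lia.
Qed.
Lemma wge_sub_trans n a b c : wge n (a - b) -> wge n (b - c) -> wge n (a - c).
Proof. by move=> h1 h2; rewrite -(subrK b a) -addrA; apply: wgeD. Qed.
Lemma near1_of_close r s : r != 0 -> w r = 0 -> wge 1 (r - s) ->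
  [/\ s != 0, w s = 0 & near1 1 (r / s)].
Proof.
move=> r0 wr h; have [|s0 ws] := w_close r0 h; first by rewrite wr.
split=> //; first by rewrite ws.
apply: near1_of_wge; have -> : r / s - 1 = (r - s) * s^-1 by field.
rewrite -[1 : int]addr0; apply: wgeM => //.
by rewrite wgeE ?invr_eq0// wV// ws wr.
Qed.
End ValuedField.

(** * Density of F in its completions *)

Section LocalEmbedding.
Variables (k F : fieldType) (iota : {rmorphism k -> F}) (v : place iota).
Local Notation O := (subalg_type (place_ring v)).
Local Notation Ohat := (completion v).
Local Notation K := (local_field v).
Local Notation emb := (@local_emb _ _ _ v).
Local Notation val_ge n al := (fge (@completion_val _ _ _ v) n al).
Local Notation "a %:F" := (@FracField.tofrac Ohat a) : ring_scope.

Let cmul := @completion_mul _ _ _ v.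
Let cadd := @completion_add _ _ _ v.

Lemma loc_hatD (x y : O) : loc_hat (x + y) = loc_hat x + loc_hat y.
Proof.
by apply: val_inj; apply: functional_extensionality_dep => n; exact: rmorphD.
Qed.

Lemma local_embD f g : emb (f + g) = emb f + emb g.
Proof.
have [a [b [b0 fe]]] := O_fracP v f; have [c [d [d0 ge]]] := O_fracP v g.
have vb0 : val b != 0 by apply: contraNneq b0 => e; apply/eqP/val_inj.
have vd0 : val d != 0 by apply: contraNneq d0 => e; apply/eqP/val_inj.
rewrite (local_emb_frac b0 fe) (local_emb_frac d0 ge).
have bd0 : b * d != 0 by rewrite mulf_neq0.
rewrite addf_div ?tofrac_eq0 ?loc_hat_eq0// -!tofracM -tofracD -!loc_hatM -loc_hatD.
by apply: local_emb_frac => //; rewrite fe ge addf_div.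
Qed.

Lemma local_emb0 : emb 0 = 0.
Proof. by apply: (addrI (emb 0)); rewrite -local_embD !addr0. Qed.
Lemma local_embN f : emb (- f) = - emb f.
Proof. by apply: (addrI (emb f)); rewrite -local_embD !subrr local_emb0. Qed.
Lemma local_embB f g : emb (f - g) = emb f - emb g.
Proof. by rewrite local_embD local_embN. Qed.

Lemma loc_hat_val (a : O) : a != 0 -> v (val a) = (completion_val (loc_hat a))%:Z.
Proof.
move=> a0; have va0 : val a != 0 by apply: contraNneq a0 => e; apply/eqP/val_inj.
have := O_pge a; rewrite /pge (negPf va0) /=.
case E : (v (val a)) => [n|//] _; rewrite -E.
have an : val (loc_hat a) n = tpi n a by [].
have [] // := completion_val_pval an.
by rewrite an tpi_neq0// E.
Qed.

Lemma local_emb_neq0 f : f != 0 -> emb f != 0.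
Proof.
move=> f0; apply/eqP => e; have := local_embM v f f^-1.
by rewrite divff// local_emb1 e mul0r => /eqP; rewrite oner_eq0.
Qed.

Lemma local_emb_eq0 f : (emb f == 0) = (f == 0).
Proof.
have [->|f0] := eqVneq f 0; first by rewrite local_emb0 eqxx.
exact/negbTE/local_emb_neq0.
Qed.

Lemma local_embV f : emb f^-1 = (emb f)^-1.
Proof.
have [->|f0] := eqVneq f 0; first by rewrite invr0 local_emb0 invr0.
apply: (mulfI (local_emb_neq0 f0)).
by rewrite -local_embM !divff ?local_emb_neq0// local_emb1.
Qed.

Lemma local_emb_val f : f != 0 -> fval (@completion_val _ _ _ v) (emb f) = v f.
Proof.
move=> f0; have [a [b [b0 fe]]] := O_fracP v f.
have a0 : a != 0 by apply: contraNneq f0 => e; rewrite fe e mul0r.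
have va0 : val a != 0 by apply: contraNneq a0 => e; apply/eqP/val_inj.
have vb0 : val b != 0 by apply: contraNneq b0 => e; apply/eqP/val_inj.
rewrite (local_emb_frac b0 fe) (fval_frac cmul) ?loc_hat_eq0//.
by rewrite -!loc_hat_val// fe pvalM ?invr_eq0// pvalV.
Qed.

Lemma local_emb_ge n f : val_ge n (emb f) = pge v n f.
Proof.
rewrite /fge /pge local_emb_eq0; have [//|f0 /=] := eqVneq f 0.
by rewrite local_emb_val.
Qed.

Lemma local_emb_integral f : 0 <= v f -> integral (emb f).
Proof. by move=> vf; exists (loc_hat (insubd 0 f)); rewrite /local_emb vf. Qed.

Lemma tofrac_ge (a : Ohat) n : (forall i, (i < n)%N -> val a i = 0) -> val_ge n a%:F.
Proof.
move=> h; rewrite /fge tofrac_eq0; have [//|a0 /=] := eqVneq a 0.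
have o0 : (1 : Ohat) != 0 by exact: oner_neq0.
rewrite (fval_eq cmul a0 o0); last by rewrite tofrac1 divr1.
have -> : completion_val (1 : Ohat) = 0%N.
  have [_] := cmul o0 o0; rewrite mulr1 => /eqP.
  by rewrite -[X in X == _]addn0 eqn_add2l eq_sym => /eqP.
by rewrite subr0 lez_nat; apply/completion_val_ge.
Qed.

Lemma local_emb_loc_hat (a : O) : emb (val a) = (loc_hat a)%:F.
Proof.
have o0 : (1 : O) != 0 by exact: oner_neq0.
by rewrite (local_emb_frac (a := a) o0) ?divr1// loc_hat1 tofrac1 divr1.
Qed.

Lemma completion_dense (a : Ohat) n : exists x : O, val_ge n.+1 (a%:F - emb (val x)).
Proof.
have [x ax] := tpi_surj (val a n); exists x.
rewrite local_emb_loc_hat -tofracB; apply: tofrac_ge => i; rewrite ltnS => ni.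
have -> : val (a - loc_hat x) i = val a i - tpi i x by [].
by rewrite (coherent_le ni ax) subrr.
Qed.

Lemma completion_wM (al be : K) : al != 0 -> be != 0 ->
  fval (@completion_val _ _ _ v) (al * be) =
  fval (@completion_val _ _ _ v) al + fval (@completion_val _ _ _ v) be.
Proof. exact: (fvalM cmul). Qed.
Lemma completion_wD n (al be : K) : val_ge n al -> val_ge n be -> val_ge n (al + be).
Proof. exact: (fgeD cmul cadd). Qed.

Lemma local_dense (al : K) n : exists f, val_ge n (al - emb f).
Proof.
have [->|al0] := eqVneq al 0.
  by exists 0; rewrite local_emb0 subrr /fge eqxx.
have [a [b [a0 b0 ale]]] := fractionP al0.
have bF : b%:F != 0 by rewrite tofrac_eq0.
pose w := fval (@completion_val _ _ _ v).
(* The numerator and denominator are approximated to order N + 1; the term |w(b)| appears twice to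
   absorb the loss of 2 w(b) in the quotient. *)
pose N := (`|n| + `|w b%:F| + `|w b%:F|)%N.
have [x hx] := completion_dense a N; have [y hy] := completion_dense b N.
have va : val_ge 0 a%:F := fge_tofrac cmul a.
have vb : val_ge 0 b%:F := fge_tofrac cmul b.
exists (val x / val y); rewrite ale local_embM local_embV.
have h1 : n + 2 * w b%:F <= N.+1%:Z by rewrite /N; move: (w _) => q; lia.
have h2 : w b%:F < N.+1%:Z by rewrite /N; move: (w _) => q; lia.
exact: (wge_div completion_wM completion_wD bF va vb hx hy h1 h2).
Qed.
End LocalEmbedding.

Lemma inv_div_mul_div (K : fieldType) (r a b : K) : r != 0 -> (r / a)^-1 * (r / b) = a / b.
Proof. by move=> r0; rewrite invf_div mulrA divfK. Qed.

(** * Congruences and the topology of the idele class group *)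

Section IdeleClasses.
Variables (k F : fieldType) (iota : {rmorphism k -> F}) (X : set (subalg iota)).
Local Notation pt := (closed_point X).
Local Notation "x .-K" := (local_field (place_of x)) (at level 2, format "x .-K").
Local Notation emb x f := (@local_emb _ _ _ (place_of x) f).
Local Notation pv x f := (pval (place_of x) f).

Lemma kge_emb (x : pt) n f : kge n (emb x f) = pge (place_of x) n f.
Proof. exact: local_emb_ge. Qed.

Lemma kval_emb (x : pt) f : f != 0 -> kval (emb x f) = pv x f.
Proof. exact: local_emb_val. Qed.

Definition knear1 (x : pt) (n : int) (r : x.-K) : Prop := near1 (@kval _ _ _ X x) n r.

Let kM (x : pt) := @kvalM _ _ _ X x.
Let kD (x : pt) := @kgeD _ _ _ X x.

Lemma knear1_1 (x : pt) n : knear1 n (1 : x.-K). Proof. exact: near1_1. Qed.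
Lemma knear1V (x : pt) n (r : x.-K) : knear1 n r -> knear1 n r^-1.
Proof. exact: near1V. Qed.
Lemma knear1_le (x : pt) m n (r : x.-K) : m <= n -> knear1 n r -> knear1 m r.
Proof. exact: near1_le. Qed.
Lemma knear1M (x : pt) n (r s : x.-K) :
  0 <= n -> knear1 n r -> knear1 n s -> knear1 n (r * s).
Proof. exact: (near1M (@kM x) (@kD x)). Qed.
Lemma knear1_of_kge (x : pt) (r : x.-K) : kge 1 (r - 1) -> knear1 1 r.
Proof. exact: (near1_of_wge (@kM x) (@kD x)). Qed.

Lemma knear1_const (x : pt) c : knear1 1 (emb x (iota c)) -> c = 1.
Proof.
move=> [h _]; have : kge 1 (emb x (iota c - 1)).
  by rewrite local_embB local_emb1.
rewrite kge_emb -(rmorph1 iota) -rmorphB /pge pval_const fmorph_eq0 orbF subr_eq0.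
by move=> /eqP.
Qed.

Lemma knear1_div (x : pt) n (r : x.-K) f : 0 <= n -> r != 0 -> f != 0 ->
  knear1 n (r / emb x f) -> kval r = pv x f.
Proof.
move=> n0 r0 f0 h.
exact: (etrans (near1_div_val (@kM x) (@kD x) n0 r0 (local_emb_neq0 _ f0) h) (kval_emb x f0)).
Qed.

Lemma unit_residue (x : pt) (al : x.-K) (R : set F) : al != 0 -> kval al = 0 ->
  (forall f, pge (place_of x) 0 f -> exists2 a, R a & pge (place_of x) 1 (f - a)) ->
  exists2 a, R a & [/\ a != 0, pv x a = 0 & knear1 1 (al / emb x a)].
Proof.
move=> al0 kal cov; have [f hf] := local_dense al 1.
have [ef vf _] := near1_of_close (@kM x) (@kD x) al0 kal hf.
have f0 : f != 0 by move: ef; rewrite local_emb_eq0.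
have [|a Ra fa] := cov f.
  by rewrite /pge -(kval_emb x f0) -/(kval _) vf lexx orbT.
have hfa : kge 1 (emb x f - emb x a) by rewrite -local_embB kge_emb.
have [ea va ha] := near1_of_close (@kM x) (@kD x) al0 kal
  (wge_sub_trans (@kD x) hf hfa).
have a0 : a != 0 by move: ea; rewrite local_emb_eq0.
exists a; first exact: Ra.
by split; [exact: a0|exact: etrans (esym (kval_emb x a0)) va|exact: ha].
Qed.

Section IdeleOfFunctions.
Variable g : pt -> F.
Hypotheses (g0 : forall x, g x != 0) (gf : finite_set [set x | pv x (g x) != 0]).

Definition functions_prod : adele_prod X := fun x => emb x (g x).
Definition functions_inv_prod : adele_prod X := fun x => emb x (g x)^-1.

Lemma functions_almost_integral : almost_integral functions_prod.
Proof.
apply/asboolP; apply: sub_finite_set gf => x /= h; apply: contra_notN h => /eqP e.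
by apply: local_emb_integral; rewrite e.
Qed.
Lemma functions_inv_almost_integral :
  almost_integral functions_inv_prod.
Proof.
apply/asboolP; apply: sub_finite_set gf => x /= h; apply: contra_notN h => /eqP e.
by apply: local_emb_integral; rewrite pvalV e oppr0.
Qed.
Definition functions_adele : adele X := exist (fun a => is_true (almost_integral a)) _ functions_almost_integral.
Definition functions_inv_adele : adele X := exist (fun a => is_true (almost_integral a)) _ functions_inv_almost_integral.
Lemma functions_adeleK : functions_adele * functions_inv_adele = 1.
Proof.
apply: val_inj; apply: functional_extensionality_dep => x.
rewrite -[LHS]/(emb x (g x) * emb x (g x)^-1) -local_embM divff//.
exact: local_emb1.
Qed.
Definition functions_idele : idele X := Units functions_adeleK.

Lemma functions_idele_comp x : idele_comp functions_idele x = emb x (g x).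
Proof. by []. Qed.

Lemma functions_idele_degree : idele_degree functions_idele =
  \sum_(x \in [set: pt]) (degree (place_of x))%:Z * pv x (g x).
Proof. by apply: eq_fsbigr => x _; rewrite functions_idele_comp kval_emb. Qed.
End IdeleOfFunctions.

Lemma idele1_compM (u w : idele1 X) x : idele1_comp (u * w)%g x = idele1_comp u x * idele1_comp w x.
Proof. exact: (idele_compM (val u) (val w) x). Qed.
Lemma idele1_compV (u : idele1 X) x : idele1_comp u^-1%g x = (idele1_comp u x)^-1.
Proof. exact: (idele_compV (val u) x). Qed.
Lemma idele1_comp1 x : idele1_comp (1%g : idele1 X) x = 1.
Proof. exact: (idele_comp1 x). Qed.
Lemma idele1_comp_neq0 (u : idele1 X) x : idele1_comp u x != 0.
Proof. exact: (idele_comp_neq0 (val u) x). Qed.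

Lemma idele1_degree (u : idele1 X) : idele_degree (val u) = 0.
Proof. by have := valP u; rewrite inE. Qed.

Definition mk_idele1 (u : idele X) (h : idele_degree u = 0) : idele1 X := SigSub (mem_set h).

(** The function f has the same values as t at all points, so its support is finite and its degree
    is that of t, namely 0. *)
Lemma principal_idele1 (f : F) (t : idele1 X) : f != 0 ->
  (forall x, kval (idele1_comp t x) = pv x f) ->
  exists u : idele1 X, forall x, idele1_comp u x = emb x f.
Proof.
move=> f0 ht.
have gf : finite_set [set x : pt | pv x f != 0].
  apply: sub_finite_set (idele_val_divisor (val t)) => x /=.
  by rewrite -[idele_comp _ _]/(idele1_comp t x) ht.
have deg0 : idele_degree (functions_idele (fun=> f0) gf) = 0.
  rewrite -(idele1_degree t); apply: eq_fsbigr => x _.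
  by rewrite functions_idele_comp kval_emb// -ht.
by exists (mk_idele1 deg0).
Qed.

Local Notation G := (idele1_bar_mod_principal X).

Definition idele_class (u : idele1 X) : G := qpi (principal X) (qpi (one_units X) u).

(** Up to a principal idele, u and t differ by a unit at every point and by a one-unit at the points
    of S: the order [x \in S], read as 0 or 1, selects between the two. *)
Definition congruent (S : seq pt) (u t : idele1 X) : Prop :=
  exists2 f, f != 0 & forall x,
    knear1 (x \in S)%:Z (idele1_comp (u^-1 * t)%g x / emb x f).

Lemma congruent_refl S u : congruent S u u.
Proof.
exists 1; first exact: oner_neq0.
by move=> x; rewrite mulVg idele1_comp1 local_emb1 divr1; apply: knear1_1.
Qed.

Lemma congruent_sym S u t : congruent S u t -> congruent S t u.
Proof.
move=> [f f0 h]; exists f^-1; first by rewrite invr_eq0.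
move=> x; have := knear1V (h x).
by rewrite local_embV invf_div invrK -idele1_compV invgM invgK mulrC.
Qed.

Lemma congruent_trans S u t w : congruent S u t -> congruent S t w -> congruent S u w.
Proof.
move=> [f f0 hf] [g g0 hg]; exists (f * g); first by rewrite mulf_neq0.
move=> x; have := knear1M _ (hf x) (hg x).
by rewrite mulf_div -local_embM -idele1_compM -mulgA mulVKg; apply.
Qed.

Lemma idele_class_surj (c : G) : exists u, c = idele_class u.
Proof. by exists (repr (repr c)); rewrite /idele_class !qpi_repr. Qed.

(** From right to left, the condition makes f equal in value to u^-1 t everywhere, so
    [principal_idele1] turns f into an element of the group. *)
Lemma idele_class_eqP u t : idele_class u = idele_class t <->
  exists2 f, f != 0 & forall x, knear1 1 (idele1_comp (u^-1 * t)%g x / emb x f).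
Proof.
have e : ((qpi (one_units X) u)^-1 * qpi (one_units X) t)%g = qpi (one_units X) (u^-1 * t)%g.
  by rewrite -[_^-1%g]/(qinv _) qpiV -[(_ * _)%g]/(qmul _ _) qpiM.
rewrite /idele_class qpiP e; split=> [[f [w [f0 hw /qpiP h]]]|[f f0 h]].
  exists f; first exact: f0.
  move=> x; have e' : (idele1_comp (u^-1 * t)%g x / emb x f)^-1 = idele1_comp ((u^-1 * t)^-1 * w)%g x.
    by rewrite invf_div (idele1_compM _ w) idele1_compV hw mulrC.
  by rewrite -[X in knear1 _ X]invrK; apply: knear1V; rewrite e'; apply/knear1_of_kge/h.
have hv x : kval (idele1_comp (u^-1 * t)%g x) = pv x f.
  exact: (knear1_div _ (idele1_comp_neq0 (u^-1 * t)%g x) f0 (h x)).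
have [w hw] := principal_idele1 f0 hv.
exists f, w; split=> //; apply/qpiP => x.
have [h1 h2] := knear1V (h x).
by rewrite idele1_compM hw idele1_compV mulrC; move: h1; rewrite invf_div.
Qed.

Lemma idele_class_congruent S u t : idele_class u = idele_class t -> congruent S u t.
Proof.
move=> /idele_class_eqP[f f0 h]; exists f; first exact: f0.
move=> x; apply: knear1_le (h x).
by case: (x \in S).
Qed.

Lemma idele_class_continuous : continuous idele_class.
Proof.
apply: (@continuous_compT _ _ _ (qpi (one_units X)) (qpi (principal X))).
  exact: qpi_continuous.
exact: qpi_continuous.
Qed.

Lemma idele_class_open (A : set (idele1 X)) : open A -> open (idele_class @` A).
Proof.
move=> oA; rewrite /idele_class -(image_comp (qpi (one_units X)) (qpi (principal X))).
exact/qpi_open/qpi_open.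
Qed.

Definition near_one (S : seq pt) : set (idele1 X) :=
  [set u | forall x, knear1 (x \in S)%:Z (idele1_comp u x)].

Lemma near_one_open S : open (near_one S).
Proof.
pose D (x : pt) : int := (x \in S)%:Z.
have fD : divisor D.
  apply: (sub_finite_set _ (finite_seq S)) => x /=; rewrite /D.
  by case: (x \in S).
have cv : continuous (fun u : idele1 X => uval (val u)).
  exact: (continuous_compT (@sg_val_continuous _ _) (@uval_continuous _ _ _ X)).
have ci : continuous (fun u : idele1 X => uinv (val u)).
  exact: (continuous_compT (@sg_val_continuous _ _) (@uinv_continuous _ _ _ X)).
have -> : near_one S = (fun u : idele1 X => uval (val u)) @^-1` (adele_ball D 1) `&`
    (fun u : idele1 X => uinv (val u)) @^-1` (adele_ball D 1).
  apply/seteqP; split=> [u hu|u [h1 h2] x].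
    split=> x; have [h1 h2] := hu x; first exact: h1.
    by move: h2; rewrite -idele1_compV.
  split; first exact: h1.
  by rewrite -idele1_compV; apply: h2.
apply: openI.
  by move/continuousP: cv; apply; apply: adele_ball_open.
by move/continuousP: ci; apply; apply: adele_ball_open.
Qed.

(** Dividing t by the principal idele w of the comparing function does not change its class, so the
    set is the image of a translate of the open set [near_one S]. *)
Lemma congruence_class_open S u : open (idele_class @` [set t | congruent S u t]).
Proof.
have -> : idele_class @` [set t | congruent S u t] =
    idele_class @` ((fun t => u^-1 * t)%g @^-1` near_one S).
  apply/seteqP; split=> _ [t ht <-].
    have [f f0 h] := ht.
    have hv x : kval (idele1_comp (u^-1 * t)%g x) = pv x f.
      exact: (knear1_div _ (idele1_comp_neq0 (u^-1 * t)%g x) f0 (h x)).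
    have [w hw] := principal_idele1 f0 hv.
    exists (t / w)%g.
      by move=> x; rewrite /= mulgA idele1_compM idele1_compV hw; apply: h.
    apply/idele_class_eqP; exists f; first exact: f0.
    have tw : ((t / w)^-1 * t)%g = w by rewrite invgM invgK -mulgA mulVg mulg1.
    move=> x; have -> : idele1_comp ((t / w)^-1 * t)%g x / emb x f = 1.
      by rewrite tw hw; apply/divff/local_emb_neq0.
    exact: knear1_1.
  exists t => //; exists 1; first exact: oner_neq0.
  by move=> x; rewrite local_emb1 divr1; apply: ht.
apply: idele_class_open.
have cu : continuous (fun t : idele1 X => (u^-1 * t)%g).
  apply: (@continuous_compT _ _ _ (fun t => (u^-1, t)%g) (fun p => p.1 * p.2)%g);
    last exact: mulg_continuous.
  by apply: continuous_pair => [|x]; [exact: cst_continuous|exact: cvg_id].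
by move/continuousP: cu; apply; apply: near_one_open.
Qed.

Hypothesis regular_const : forall f, (forall x : pt, 0 <= pv x f) -> exists c, f = iota c.

Lemma knear1_ratio (x : pt) n (r : x.-K) f g : 0 <= n -> r != 0 ->
  knear1 n (r / emb x f) -> knear1 n (r / emb x g) -> knear1 n (emb x (f / g)).
Proof.
move=> n0 r0 hf hg.
have -> : emb x (f / g) = (r / emb x f)^-1 * (r / emb x g).
  by rewrite local_embM local_embV (inv_div_mul_div _ _ r0).
exact: knear1M n0 (knear1V hf) hg.
Qed.

(** The comparing function may depend on x, but all the sets contain P. The quotient of two such
    functions has no zeros or poles, so it is constant, and it is 1 at P: a single function works at
    all points. *)
Lemma idele_class_separated (P : pt) u t :
  (forall x, congruent [:: P; x] u t) -> idele_class u = idele_class t.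
Proof.
move=> h; have [f f0 hf] := h P; apply/idele_class_eqP; exists f; first exact: f0.
have r0 x : idele1_comp (u^-1 * t)%g x != 0 by apply: idele1_comp_neq0.
have inP x : (P \in [:: P; x])%:Z = 1 by rewrite inE eqxx.
have inx x : (x \in [:: P; x])%:Z = 1 by rewrite !inE eqxx orbT.
move=> x; have [g g0 hg] := h x.
have [y|c fgc] := regular_const (f := f / g).
  rewrite pvalM ?invr_eq0// pvalV.
  by rewrite -(knear1_div _ (r0 y) f0 (hf y))// -(knear1_div _ (r0 y) g0 (hg y))// subrr.
have c1 : c = 1.
  apply: (@knear1_const P); rewrite -fgc; apply: (knear1_ratio _ (r0 P)) => //.
    by have := hf P; rewrite inP.
  by have := hg P; rewrite inP.
have -> : f = g by rewrite -(divfK g0 f) fgc c1 rmorph1 mul1r.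
by have := hg x; rewrite inx.
Qed.

Lemma congruence_class_closed S u : closed (idele_class @` [set t | congruent S u t]).
Proof.
rewrite -[X in closed X]setCK; apply: open_closedC.
have -> : ~` (idele_class @` [set t | congruent S u t]) =
    \bigcup_(t in [set t | ~ congruent S u t]) (idele_class @` [set w | congruent S t w]).
  apply/seteqP; split=> c.
    have [t ->] := idele_class_surj c => h.
    by exists t; [move=> ht; apply: h; exists t|exists t => //; apply: congruent_refl].
  move=> [t ht [w /= hw <-]] [w' /= hw' /(idele_class_congruent S) e]; apply: ht.
  exact: congruent_trans (congruent_trans hw' e) (congruent_sym hw).
by apply: bigcup_open => t _; apply: congruence_class_open.
Qed.

Lemma idele_class_zero_dimensional (P : pt) : zero_dimensional G.
Proof.
move=> c d; have [u ->] := idele_class_surj c; have [t ->] := idele_class_surj d.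
move=> /eqP ut; have [x hx] : exists x, ~ congruent [:: P; x] u t.
  apply: contrapT => h; apply: ut; apply: (@idele_class_separated P) => x.
  by apply: contrapT => hx; apply: h; exists x.
exists (idele_class @` [set w | congruent [:: P; x] u w]); split.
- by split; [apply: congruence_class_open|apply: congruence_class_closed].
- by exists u => //; apply: congruent_refl.
- move=> [w /= hw /(idele_class_congruent [:: P; x]) e]; apply: hx.
  exact: congruent_trans hw e.
Qed.

Lemma idele_class_hausdorff (P : pt) : hausdorff_space G.
Proof.
move=> c d hcd; apply: contrapT => /eqP /(idele_class_zero_dimensional P)[U [[oU cU] Uc Ud]].
have [||e []//] := hcd U (~` U); first exact: open_nbhs_nbhs.
by apply: open_nbhs_nbhs; split=> //; apply: closed_openC.
Qed.

(* The finite subcover property is only available on pointed spaces. *)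
Definition pointed_classes : Type := G.
HB.instance Definition _ := Topological.on pointed_classes.
HB.instance Definition _ := isPointed.Build pointed_classes (1%g : G).

(** * Constants placed at one point, and the finiteness of k *)

Section PointUnits.
Variable x : pt.

Definition point_unit_fun (c : k) (y : pt) : F := if y == x then iota c else 1.

Lemma point_unit_val c y : pv y (point_unit_fun c y) = 0.
Proof. by rewrite /point_unit_fun; case: ifP => _; rewrite ?pval_const ?pval1. Qed.

Lemma point_unit_neq0 c : c != 0 -> forall y, point_unit_fun c y != 0.
Proof.
by move=> c0 y; rewrite /point_unit_fun; case: ifP => _; rewrite ?fmorph_eq0 ?oner_eq0.
Qed.

Lemma point_unit_support c : finite_set [set y | pv y (point_unit_fun c y) != 0].
Proof.
rewrite (_ : [set y | _] = set0)//; apply/seteqP; split=> // y /=.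
by rewrite point_unit_val eqxx.
Qed.

Lemma point_unit_idele c : c != 0 ->
  exists u : idele1 X, forall y, idele1_comp u y = emb y (point_unit_fun c y).
Proof.
move=> c0; have deg0 : idele_degree (functions_idele (point_unit_neq0 c0) (point_unit_support c)) = 0.
  rewrite functions_idele_degree; apply: fsbig1 => y _.
  by rewrite point_unit_val mulr0.
by exists (mk_idele1 deg0).
Qed.

Lemma point_unit_congruent (P : pt) c d u w : P != x -> c != 0 -> d != 0 ->
  (forall y, idele1_comp u y = emb y (point_unit_fun c y)) ->
  (forall y, idele1_comp w y = emb y (point_unit_fun d y)) ->
  congruent [:: P; x] u w -> c = d.
Proof.
move=> Px c0 d0 hu hw [f f0 hf].
pose q y := point_unit_fun d y / point_unit_fun c y.
have r_eq y : idele1_comp (u^-1 * w)%g y = emb y (q y).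
  by rewrite idele1_compM idele1_compV hu hw local_embM local_embV mulrC.
have r0 y : idele1_comp (u^-1 * w)%g y != 0 by apply: idele1_comp_neq0.
have q0 y : q y != 0 by rewrite mulf_neq0 ?invr_eq0 ?point_unit_neq0.
have [y|a fa] := regular_const (f := f).
  rewrite -(knear1_div _ (r0 y) f0 (hf y))// r_eq kval_emb//.
  by rewrite pvalM ?pvalV ?invr_eq0 ?point_unit_neq0// !point_unit_val subrr.
have hq y : y \in [:: P; x] -> knear1 1 (emb y (q y / f)).
  by move=> yS; have := hf y; rewrite yS r_eq -local_embV -local_embM.
have a1 : a = 1.
  have := hq P; rewrite inE eqxx /q /point_unit_fun (negPf Px) divr1 => /(_ isT) /knear1V.
  by rewrite div1r fa -local_embV invrK; apply: knear1_const.
have := hq x; rewrite !inE eqxx orbT /q /point_unit_fun eqxx fa a1 rmorph1 divr1 => /(_ isT).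
rewrite -fmorphV -rmorphM => /knear1_const e.
by rewrite -(divfK c0 d) e mul1r.
Qed.

Lemma compact_finite_constants (P : pt) : P != x -> compact [set: G] -> finite_set [set: k].
Proof.
move=> Px cG; have : compact [set: pointed_classes] := cG.
rewrite compact_cover => {}cG.
have [D _ cover] := cG _ setT (fun u => idele_class @` [set t | congruent [:: P; x] u t])
  (fun u _ => congruence_class_open [:: P; x] u)
  (fun c _ => let: ex_intro u e := idele_class_surj c in
     ex_intro2 _ _ u I (ex_intro2 _ _ u (congruent_refl [:: P; x] u) (esym e))).
(* Each c != 0 is assigned a member of the finite subcover containing the class of its idele; two
   constants with the same member have congruent ideles. *)
have ex (c : k) : exists i : idele1 X, c != 0 -> [set` D] i /\
    exists2 w : idele1 X, (forall y, idele1_comp w y = emb y (point_unit_fun c y)) &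
      congruent [:: P; x] i w.
  have [->|c0] := eqVneq c 0; first by exists 1%g.
  have [w hw] := point_unit_idele c0.
  have [i iD [t /= it /(idele_class_congruent [:: P; x]) e]] := cover (idele_class w) I.
  exists i => _; split; first exact: iD.
  by exists w; [exact: hw|exact: congruent_trans it e].
have [phi hphi] := choice ex.
have fD : finite_set (phi @` [set c | c != 0]).
  apply: sub_finite_set (finite_fset D) => _ [c c0 <-].
  by have [] := hphi _ c0.
have inj : {in [set c | c != 0] &, injective phi}.
  move=> c d; rewrite !inE => c0 d0 e.
  have [_ [w hw cw]] := hphi _ c0; have [_ [w' hw' cw']] := hphi _ d0.
  apply: (point_unit_congruent Px c0 d0 hw hw').
  by apply: congruent_trans (congruent_sym cw) _; rewrite e.
have f0 : finite_set [set c : k | c != 0] by rewrite -(eq_finite_set (inj_card_eq inj)).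
apply: sub_finite_set (_ : [set: k] `<=` [set 0] `|` [set c | c != 0]) _.
  by move=> c _; have [->|c0] := eqVneq c 0; [left|right].
by rewrite finite_setU; split=> //; apply: finite_set1.
Qed.
End PointUnits.
End IdeleClasses.

(** * Curves over a finite field *)

Section FiniteConstants.
Variables (k F : fieldType) (iota : {rmorphism k -> F}) (X : set (subalg iota)).
Hypotheses (perf : perfect_field k) (curveX : curve X) (smoothX : smooth_curve X)
  (completeX : complete_curve X) (ac : algebraically_closed_in iota).
Variable ks : seq k.
Hypothesis ksP : forall c, c \in ks.
Local Notation pt := (closed_point X).
Local Notation pv x f := (pval (place_of x) f).
Local Notation pge x n f := (pge (place_of x) n f).

Let tr1 : transcendence_degree1 iota. Proof. by case: curveX. Qed.

Lemma pt_curve (x : pt) : X (place_ring (place_of x)).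
Proof. by have := valP x; rewrite inE. Qed.

Lemma pgeE (x : pt) n f : f != 0 -> pge x n f = (n <= pv x f).
Proof. by rewrite /Defs.pge => /negPf ->. Qed.

Lemma nonunits_place (x : pt) f : nonunits (place_ring (place_of x)) f <-> pge x 1 f.
Proof.
rewrite /nonunits /=; have [->|f0] := eqVneq f 0.
  by rewrite !pge0; split=> // _; split=> //; left.
rewrite !pgeE ?invr_eq0// pvalV; split=> [[h1 [/eqP|h2]]|h].
- by rewrite (negPf f0).
- by rewrite oppr_ge0 in h2; rewrite -gtz0_ge1 ltNge; apply/negP.
split; first exact: le_trans h.
by right; rewrite oppr_ge0 => h'; have := le_trans h h'.
Qed.

Lemma place_of_inj (x y : pt) : place_ring (place_of x) = place_ring (place_of y) -> x = y.
Proof.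
move=> e; apply: val_inj; apply: place_ring_le_eq.
by rewrite -[val x]/(place_of x) e.
Qed.

(** All k-linear combinations of E, a finite list because [ks] exhausts k. *)
Fixpoint combinations (E : seq F) : seq F :=
  if E is e :: E' then [seq iota c * e + t | c <- ks, t <- combinations E'] else [:: 0].

Lemma spanmod_combinations E I f : spanmod iota E I f ->
  exists2 t, t \in combinations E & I (f - t).
Proof.
elim: E f => [f If|e E IH f [c /IH[t tE It]]] /=.
  by exists 0; rewrite ?inE ?subr0.
exists (iota c * e + t); last by rewrite opprD addrA.
by apply/allpairsP; exists (c, t).
Qed.

Lemma combinations_sub E (A : subalg iota) : (forall e, e \in E -> e \inS A) ->
  forall t, t \in combinations E -> t \inS A.
Proof.
elim: E => [_ t|e E IH hE t] /=; first by rewrite inE => /eqP ->; apply: sa0.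
move=> /allpairsP[[c u] /= [_ uE ->]]; apply: saD.
  by apply: saM; [apply: sa_const|apply: hE; rewrite inE eqxx].
by apply: IH uE => x xE; apply: hE; rewrite inE xE orbT.
Qed.

Definition in_chart (s : seq F) (x : pt) : Prop := exists2 p,
  prime_of (generated iota s) p &
  subalg_set (place_ring (place_of x)) = localization (generated iota s) p.

Lemma in_chart_ge0 s (x : pt) f : in_chart s x -> generated iota s f -> pge x 0 f.
Proof. by move=> [p pp e] Rf; apply: (chart_sub pp e). Qed.

(** For nonconstant b, the ring k[s]/b has finitely many classes. A point of the chart where b
    vanishes is determined by which representatives in T vanish there, since this determines its
    prime ideal and so its local ring. *)
Lemma chart_zeros_finite s b : generated iota s b -> b != 0 ->
  finite_set [set x | in_chart s x /\ pge x 1 b].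
Proof.
move=> Rb b0; have [/ac[c bc]|nb] := pselect (algebraicOver iota b).
  rewrite (_ : [set x | _] = set0)//; apply/seteqP; split=> // x [_].
  by rewrite pgeE// bc pval_const.
have [E hE RE] := gen_mod_finite tr1 (s := s) Rb nb.
pose T := combinations E.
have TR t : t \in T -> generated iota s t by apply: (combinations_sub hE).
pose phi (x : pt) : {ffun 'I_(size T) -> bool} := [ffun i => pge x 1 T`_(val i)].
set Z := [set x | _].
suff inj : {in Z &, injective phi}.
  by rewrite -(eq_finite_set (inj_card_eq inj)); apply: finite_finset.
have key x y : Z x -> Z y -> phi x = phi y -> forall f, generated iota s f ->
    pge x 1 f -> pge y 1 f.
  move=> [cx bx] [cy by_] e f Rf fx.
  have [t tT [r Rr fe]] := spanmod_combinations (RE _ Rf).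
  have br z : in_chart s z -> pge z 1 b -> pge z 1 (b * r).
    by move=> cz bz; have := pgeM bz (in_chart_ge0 cz Rr); rewrite addr0.
  have ty : pge y 1 t.
    have tx : pge x 1 t.
      rewrite (_ : t = f - b * r); last by rewrite -fe subKr.
      by apply: pgeB => //; apply: br.
    have it : (index t T < size T)%N by rewrite index_mem.
    have := congr1 (fun g : {ffun _ -> _} => g (Ordinal it)) e.
    by rewrite !ffunE /= nth_index// tx => /esym.
  rewrite (_ : f = t - (- (b * r))); last by rewrite opprK -fe addrC subrK.
  apply: pgeB => //; rewrite -sub0r; apply: pgeB; first exact: pge0.
  exact: br.
have loc x y : Z x -> Z y -> phi x = phi y ->
    subalg_set (place_ring (place_of x)) `<=` subalg_set (place_ring (place_of y)).
  move=> Zx Zy e f; have [[p pp ex] _] := Zx; have [[p' pp' ey] _] := Zy.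
  rewrite ex ey => -[a [b' [Ra Rb' npb ->]]]; exists a, b'; split=> //.
  apply: contra_not npb => /(prime_nonunit pp' ey Rb') /nonunits_place h.
  by apply/(prime_nonunit pp ex Rb')/nonunits_place; apply: (key y x).
move=> x y; rewrite !inE => Zx Zy e; apply: place_of_inj; apply: subalg_ext.
by apply/seteqP; split; apply: loc.
Qed.

(** On each of the finitely many charts f = a / b with a, b regular, so a zero or pole of f is a
    zero of a or of b. *)
Lemma finite_zeros_poles f : f != 0 -> finite_set [set x : pt | pv x f != 0].
Proof.
move=> f0; case: curveX => -[charts [hc Xc]] _ _.
have ab s : exists ab : F * F, s \in charts ->
    [/\ generated iota s ab.1, generated iota s ab.2, ab.1 != 0, ab.2 != 0 & f = ab.1 / ab.2].
  have [sc|] := boolP (s \in charts); last by exists (0, 0).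
  have [a [b [Ra Rb b0 fe]]] : fractions_of (generated iota s) f by rewrite hc.
  exists (a, b); split=> //; apply: contraNneq f0 => /= a0.
  by rewrite fe a0 mul0r.
have [g hg] := choice ab.
apply: (@sub_finite_set _ _ (\bigcup_(s in [set` charts])
   ([set x | in_chart s x /\ pge x 1 (g s).1] `|` [set x | in_chart s x /\ pge x 1 (g s).2]))).
  move=> x /= vf; have := pt_curve x; rewrite [X in X _ -> _]Xc /= => -[s [p [sc pp e]]].
  have [Ra Rb a0 b0 fe] := hg s sc.
  have cx : in_chart s x by exists p.
  exists s => //=; apply: contrapT => /not_orP[na nb].
  have := in_chart_ge0 cx Ra; have := in_chart_ge0 cx Rb; rewrite !pgeE// => vb va.
  have a1 : ~ (1 <= pv x (g s).1) by move=> h; apply: na; split=> //; rewrite pgeE.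
  have b1 : ~ (1 <= pv x (g s).2) by move=> h; apply: nb; split=> //; rewrite pgeE.
  by move: vf; rewrite fe pvalM ?invr_eq0// pvalV => /eqP; apply; lia.
apply: bigcup_finite; first exact: finite_seq.
move=> s /= sc; have [Ra Rb a0 b0 fe] := hg s sc.
by rewrite finite_setU; split; apply: chart_zeros_finite.
Qed.

Lemma residue_cover (x : pt) : exists T : seq F, (forall t, t \in T -> pge x 0 t) /\
  forall f, pge x 0 f -> exists2 t, t \in T & pge x 1 (f - t).
Proof.
have [s [p [fr pp hA]]] := curve_chart curveX (pt_curve x).
have [z vz] := pval_normalized (place_of x).
have z0 : z != 0 by apply/eqP => z0; move: vz; rewrite z0 pval0.
have mz : nonunits (place_ring (place_of x)) z by apply/nonunits_place; rewrite pgeE// vz.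
have [E hE AE] := chart_mod_finite pp hA tr1 ac mz z0.
exists (combinations E); split=> [t|f fx]; first exact: (combinations_sub hE).
have [t tE [r Ar e]] := spanmod_combinations (AE _ fx).
exists t => //; rewrite e -[1 : int]addr0; apply: pgeM => //.
by rewrite pgeE// vz.
Qed.
End FiniteConstants.

(** * Residue fields and degrees *)

Section ResidueDegree.
Variables (k F : fieldType) (iota : {rmorphism k -> F}) (v : place iota).
Variable ks : seq k.
Hypotheses (ks_uniq : uniq ks) (ksP : forall c, c \in ks).
Local Notation pge n f := (pge v n f).
Local Notation kap := (trunc v 0).
Local Notation q := (size ks).
Local Notation scal := (residue_scal v).

Lemma card_constants_gt1 : (1 < q)%N.
Proof.
have : (size [:: 0 : k; 1]%R <= size ks)%N; last by [].
apply: uniq_leq_size => [|c _]; last exact: ksP.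
by rewrite /= inE eq_sym oner_eq0.
Qed.

Lemma scalB c d : scal (c - d) = scal c - scal d.
Proof.
rewrite /residue_scal -tpiB; congr tpi; apply: val_inj.
by rewrite /= rmorphB.
Qed.

Lemma scal1 : scal 1 = 1.
Proof. by rewrite /residue_scal -tpi1; congr tpi; apply: val_inj; rewrite /= rmorph1. Qed.

Lemma scalM c d : scal (c * d) = scal c * scal d.
Proof.
rewrite /residue_scal -tpiM; congr tpi; apply: val_inj.
by rewrite /= rmorphM.
Qed.

Lemma scal0 : scal 0 = 0. Proof. by rewrite -(subrr 0) scalB subrr. Qed.

Variable T : seq F.
Hypotheses (T0 : forall t, t \in T -> pge 0 t)
  (Tcov : forall f, pge 0 f -> exists2 t, t \in T & pge 1 (f - t)).

Definition lincomb d (e : nat -> kap) (c : nat -> k) : kap := \sum_(i < d) scal (c i) * e i.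
Definition independent d e : Prop :=
  forall c c', lincomb d e c = lincomb d e c' -> forall i, (i < d)%N -> c i = c' i.

Lemma independent_bound d e : independent d e -> (d <= size T)%N.
Proof.
move=> ind; have ex i : exists t, t \in T /\ forall O_t : sa_mem (place_ring v) t,
    tpi 0 (exist _ t O_t : subalg_type (place_ring v)) = e i.
  have [y ey] := tpi_surj (e i); have [t tT ht] := Tcov (O_pge y).
  by exists t; split=> // Ot; rewrite ey; apply/esym/tpi_eq.
have [phi hphi] := choice ex.
rewrite -(size_iota 0 d) -(size_map phi); apply: uniq_leq_size => [|_ /mapP[i _ ->]]; last first.
  by have [] := hphi i.
rewrite map_inj_in_uniq ?iota_uniq// => i j; rewrite !mem_iota add0n => /andP[_ id] /andP[_ jd] eij.
have Oi : sa_mem (place_ring v) (phi i).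
  by rewrite /sa_mem inE; apply: T0; have [] := hphi i.
have Oj : sa_mem (place_ring v) (phi j).
  by rewrite /sa_mem inE; apply: T0; have [] := hphi j.
have ee : e i = e j.
  have [_ /(_ Oi) <-] := hphi i; have [_ /(_ Oj) <-] := hphi j.
  by congr tpi; apply: val_inj.
have del a : (a < d)%N -> lincomb d e (fun b => (b == a)%:R) = e a.
  move=> ad; rewrite /lincomb (bigD1 (Ordinal ad)) //= eqxx scal1 mul1r big1 ?addr0// => b.
  by rewrite -val_eqE /= => /negPf ->; rewrite scal0 mul0r.
have /(ind _ _)/(_ i id) : lincomb d e (fun b => (b == i)%:R) = lincomb d e (fun b => (b == j)%:R).
  by rewrite !del.
rewrite eqxx; case: eqP => // _ /eqP; by rewrite oner_eq0.
Qed.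

(** [degree] is some d admitting a basis of size d, with default 0, so a basis must be exhibited
    first. An independent family of greatest length provides one; the length is bounded by the
    number of residues. *)
Lemma degree_basis : exists e : nat -> kap, independent (degree v) e /\
  forall y, exists c, y = lincomb (degree v) e c.
Proof.
pose S d := `[< exists e, independent d e >].
have S0 : exists d, S d by exists 0%N; apply/asboolP; exists (fun=> 0) => c c' _ i.
have Sb d : S d -> (d <= size T)%N by move=> /asboolP[e]; apply: independent_bound.
case: (ex_maxnP S0 Sb) => d /asboolP[e ind] dmax.
have span y : exists c, y = lincomb d e c.
  apply: contrapT => ny; have : S d.+1; last by move=> /dmax; rewrite ltnn.
  apply/asboolP; exists (fun i => if (i < d)%N then e i else y) => c c'.
  have ext (b : nat -> k) : lincomb d.+1 (fun i => if (i < d)%N then e i else y) b =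
      lincomb d e b + scal (b d) * y.
    rewrite /lincomb big_ord_recr /= ltnn; congr (_ + _).
    by apply: eq_bigr => i _; rewrite ltn_ord.
  rewrite !ext => h.
  have [cd|ncd] := eqVneq (c d) (c' d).
    move: h; rewrite cd => /addIr /ind h i; rewrite ltnS leq_eqVlt.
    by move=> /predU1P[->//|/h].
  have cd0 : c d - c' d != 0 by rewrite subr_eq0.
  case: ny; exists (fun i => (c' i - c i) / (c d - c' d)).
  have : scal (c d - c' d) * y = lincomb d e (fun i => c' i - c i).
    rewrite scalB mulrBl; apply/eqP; rewrite subr_eq.
    have -> : lincomb d e (fun i => c' i - c i) = lincomb d e c' - lincomb d e c.
      rewrite /lincomb -sumrB; apply: eq_bigr => i _; rewrite scalB mulrBl //.
    by rewrite addrAC -h addrAC subrr add0r.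
  move=> /(congr1 (fun z => scal (c d - c' d)^-1 * z)).
  rewrite mulrA -scalM mulVf// scal1 mul1r => ->.
  rewrite /lincomb mulr_sumr; apply: eq_bigr => i _.
  by rewrite mulrA -scalM [X in scal X * _ = _]mulrC.
pose P := [set d' : nat | exists e' : 'I_d' -> residue_field v,
    forall y, exists! c : {ffun 'I_d' -> k}, y = \sum_i scal (c i) * e' i].
have Pd : P d.
  exists (fun i => e (val i)) => y; have [c yc] := span y.
  exists [ffun i : 'I_d => c (val i)]; split.
    by rewrite yc /lincomb; apply: eq_bigr => i _; rewrite ffunE.
  move=> c' yc'; apply/ffunP => i; rewrite ffunE.
  pose b j := if insub j is Some i then c' i else 0.
  have -> : c' i = b (val i) by rewrite /b valK.
  have hcb : lincomb d e c = lincomb d e b.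
    by rewrite -yc yc' /lincomb; apply: eq_bigr => j _; rewrite /b valK.
  exact: ind hcb _ (ltn_ord i).
have : P (degree v) by rewrite /degree -/P; apply: (xgetPex 0%N); exists d.
move=> [e' he'].
exists (fun j => if insub j is Some i then e' i else 0); split.
  move=> c c' h i id.
  have lc (b : nat -> k) : lincomb (degree v) (fun j => if insub j is Some i then e' i else 0) b =
      \sum_i scal ([ffun i : 'I_(degree v) => b (val i)] i) * e' i.
    by rewrite /lincomb; apply: eq_bigr => j _; rewrite ffunE valK.
  have [c0 [_ uc0]] := he' (lincomb (degree v) (fun j => if insub j is Some i then e' i else 0) c).
  have h1 := uc0 _ (lc c); have h2 := uc0 _ (etrans h (lc c')).
  have := congr1 (fun g : {ffun 'I_(degree v) -> k} => g (Ordinal id)) (etrans (esym h1) h2).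
  by rewrite !ffunE.
move=> y; have [c [yc _]] := he' y.
exists (fun j => if insub j is Some i then c i else 0).
by rewrite yc /lincomb; apply: eq_bigr => j _; rewrite valK.
Qed.

Fixpoint words (d : nat) : seq (seq k) :=
  if d is d'.+1 then [seq c :: w | c <- ks, w <- words d'] else [:: [::]].

Lemma size_words d : size (words d) = (q ^ d)%N.
Proof. by elim: d => [//|d IH] /=; rewrite size_allpairs IH expnS. Qed.

Lemma mem_words d w : (w \in words d) = (size w == d).
Proof.
elim: d w => [|d IH] [|c w] //=.
  by apply/negbTE/negP => /allpairsP[[c w] []].
apply/allpairsP/idP => [[[c' w'] /= [_ w'd [_ ->]]]|sw]; first by rewrite eqSS -IH.
by exists (c, w); split; rewrite ?ksP// IH.
Qed.

Lemma uniq_words d : uniq (words d).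
Proof.
elim: d => [//|d IH] /=; apply: allpairs_uniq => // -[c w] [c' w'] _ _ [-> ->] //.
Qed.

(** Lifts of all linear combinations of a basis; their number q^degree(v) translates degrees into
    cardinalities. *)
Lemma residue_system : exists r : seq F, [/\ uniq r, size r = (q ^ degree v)%N,
  (forall t, t \in r -> pge 0 t),
  (forall t t', t \in r -> t' \in r -> pge 1 (t - t') -> t = t') &
  forall f, pge 0 f -> exists2 t, t \in r & pge 1 (f - t)].
Proof.
have [e [ind span]] := degree_basis; set d := degree v in ind span *.
have lift y : exists z : subalg_type (place_ring v), y = tpi 0 z := tpi_surj y.
have [h hh] := choice lift.
pose g (w : seq k) := val (h (lincomb d e (nth 0 w))).
have gP w w' : w \in words d -> w' \in words d -> pge 1 (g w - g w') -> w = w'.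
  rewrite !mem_words => /eqP sw /eqP sw' hg; apply: (@eq_from_nth _ 0); first by rewrite sw sw'.
  rewrite sw; apply: ind; rewrite [LHS]hh [RHS]hh; exact/tpi_eq.
exists [seq g w | w <- words d]; split.
- rewrite map_inj_in_uniq ?uniq_words// => w w' hw hw' e'.
  by apply: gP => //; rewrite e' subrr; apply: pge0.
- by rewrite size_map size_words.
- by move=> _ /mapP[w _ ->]; apply: O_pge.
- by move=> _ _ /mapP[w hw ->] /mapP[w' hw' ->] /(gP _ _ hw hw') ->.
move=> f f0; have Of : sa_mem (place_ring v) f by rewrite /sa_mem inE.
have [c fc] := span (tpi 0 (exist _ f Of : subalg_type (place_ring v))).
exists (g (mkseq c d)); first by apply: map_f; rewrite mem_words size_mkseq.
have /tpi_eq : tpi 0 (exist _ f Of : subalg_type (place_ring v)) = tpi 0 (h (lincomb d e (nth 0 (mkseq c d)))).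
  rewrite -hh fc /lincomb; apply: eq_bigr => i _.
  by rewrite nth_mkseq.
exact.
Qed.
End ResidueDegree.

(** * Weak approximation *)

Section WeakApproximation.
Variables (k F : fieldType) (iota : {rmorphism k -> F}) (X : set (subalg iota)).
Local Notation pt := (closed_point X).
Local Notation pv x f := (pval (place_of x) f).
Local Notation pge x n f := (pge (place_of x) n f).

Lemma exists_upper_bound (I : eqType) (s : seq I) (g : I -> int) :
  exists M : nat, forall i, i \in s -> g i <= M%:Z.
Proof.
elim: s => [|i s [M hM]]; first by exists 0%N.
exists (`|g i| + M)%N => j; rewrite inE => /predU1P[->|/hM h].
  by rewrite PoszD; apply: le_trans (ler_norm _) _; rewrite lerDl.
by apply: le_trans h _; rewrite lez_nat leq_addl.
Qed.

Lemma pvalD_lt (v : place iota) f g : f != 0 -> v f < v g -> f + g != 0 /\ v (f + g) = v f.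
Proof.
have [->|g0] := eqVneq g 0; first by rewrite addr0.
move=> f0 fg; have s0 : f + g != 0.
  apply: contraTneq fg => /eqP; rewrite addr_eq0 => /eqP ->.
  by rewrite pvalN ltxx.
split=> //; have h1 := pvalD v f0 g0 s0.
have ng0 : - g != 0 by rewrite oppr_eq0.
have h2 : Num.min (v (f + g)) (v (- g)) <= v f.
  by have := pvalD v s0 ng0; rewrite addrK; apply.
move: h1 h2; rewrite pvalN; case: (leP (v f) (v g)); case: (leP (v (f + g)) (v g)); lia.
Qed.

(** Distinct places have incomparable rings. With a regular at x but not at y, and b regular at y
    but not at x, the function b / a has the required signs. *)
Lemma point_separation (x y : pt) : x != y -> exists f, [/\ f != 0, pv x f < 0 & 0 < pv y f].
Proof.
have sep (z t : pt) : z != t -> exists a, [/\ a != 0, 0 <= pv z a & pv t a < 0].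
  move=> zt; apply: contrapT => h; move/eqP: zt; apply; apply: val_inj.
  apply: place_ring_le_eq => a /=; rewrite /Defs.pge.
  have [//|a0 /= za] := eqVneq a 0; rewrite leNgt; apply/negP => ta.
  by apply: h; exists a.
move=> xy; have [a [a0 xa ya]] := sep _ _ xy.
have [|b [b0 yb xb]] := sep y x; first by rewrite eq_sym.
exists (b / a); rewrite mulf_neq0 ?invr_eq0// !pvalM ?invr_eq0// !pvalV.
by split=> //; lia.
Qed.

(** A unit where f has a pole, and a zero of m times the order of f where f vanishes: this removes
    poles while amplifying zeros. *)
Definition damp (f : F) (m : nat) : F := f ^+ m / (1 + f ^+ m).

Lemma damp_val_neg (v : place iota) f m : f != 0 -> (0 < m)%N -> v f < 0 ->
  damp f m != 0 /\ v (damp f m) = 0.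
Proof.
move=> f0 m0 vf; have fm0 : f ^+ m != 0 by rewrite expf_neq0.
have vfm : v (f ^+ m) < v 1 by rewrite pval1 pvalX -mulr_natr natz; nia.
have [s0 sv] := pvalD_lt fm0 vfm.
rewrite /damp addrC mulf_neq0 ?invr_eq0// pvalM ?invr_eq0// pvalV sv subrr.
by [].
Qed.

Lemma damp_val_pos (v : place iota) f m : f != 0 -> (0 < m)%N -> 0 < v f ->
  damp f m != 0 /\ v (damp f m) = v f *+ m.
Proof.
move=> f0 m0 vf; have fm0 : f ^+ m != 0 by rewrite expf_neq0.
have vfm : v 1 < v (f ^+ m) by rewrite pval1 pvalX -mulr_natr natz; nia.
have [s0 sv] := pvalD_lt (oner_neq0 F) vfm.
by rewrite /damp mulf_neq0 ?invr_eq0// pvalM ?invr_eq0// pvalV sv pval1 subr0 pvalX.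
Qed.

(** Induction on the points: g separates x from the new point y. If f has value 0 at y, multiply g
    by a high power of f; if f has a pole at y, multiply g by [damp f M.+1]. M bounds the poles of g
    at the earlier points. *)
Lemma points_separation (x : pt) (ys : seq pt) : x \notin ys ->
  exists f, [/\ f != 0, pv x f < 0 & forall y, y \in ys -> 0 < pv y f].
Proof.
elim: ys => [_|y ys IH].
  have [t vt] := pval_normalized (place_of x).
  have t0 : t != 0 by apply/eqP => t0; move: vt; rewrite t0 pval0.
  by exists t^-1; rewrite invr_eq0 pvalV vt; split.
rewrite inE negb_or => /andP[xy /IH[f [f0 xf yf]]].
have [g [g0 xg yg]] := point_separation xy.
have [M hM] := exists_upper_bound ys (fun z => - pv z g).
have [fy|fy|fy] := ltgtP (pv y f) 0; last first.
- exists (f ^+ M.+1 * g); rewrite mulf_neq0 ?expf_neq0//; split=> //.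
    by rewrite pvalM ?expf_neq0// pvalX -mulr_natr natz; nia.
  move=> z; rewrite inE => /predU1P[->|zys]; rewrite pvalM ?expf_neq0// pvalX -mulr_natr natz.
    by rewrite fy mul0r add0r.
  by have := yf z zys; have := hM z zys; nia.
- by exists f; split=> // z; rewrite inE => /predU1P[->|/yf].
have [d0 dx] := damp_val_neg f0 (ltn0Sn M) xf.
have [_ dy] := damp_val_neg f0 (ltn0Sn M) fy.
exists (damp f M.+1 * g); rewrite mulf_neq0//; split=> //.
  by rewrite pvalM// dx add0r.
move=> z; rewrite inE => /predU1P[->|zys]; rewrite pvalM//.
  by rewrite dy add0r.
have [_ ->] := damp_val_pos f0 (ltn0Sn M) (yf z zys).
by rewrite -mulr_natr natz; have := yf z zys; have := hM z zys; nia.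
Qed.

Lemma weak_approximation (x : pt) (ys : seq pt) (M : nat) : x \notin ys ->
  exists w, [/\ w != 0, pv x w = 0 & forall y, y \in ys -> M%:Z <= pv y w].
Proof.
move=> /points_separation[f [f0 xf yf]].
have [d0 dx] := damp_val_neg f0 (ltn0Sn M) xf.
exists (damp f M.+1); split=> // y /yf vy.
have [_ ->] := damp_val_pos f0 (ltn0Sn M) vy.
by rewrite -mulr_natr natz; nia.
Qed.
End WeakApproximation.

(** * Counting elements of Riemann-Roch spaces *)

Section RiemannRochSpaces.
Variables (k F : fieldType) (iota : {rmorphism k -> F}) (X : set (subalg iota)).
Hypotheses (perf : perfect_field k) (curveX : curve X) (smoothX : smooth_curve X)
  (completeX : complete_curve X) (ac : algebraically_closed_in iota).
Variable ks : seq k.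
Hypotheses (ks_uniq : uniq ks) (ksP : forall c, c \in ks).
Local Notation pt := (closed_point X).
Local Notation pv x f := (pval (place_of x) f).
Local Notation pge x n f := (pge (place_of x) n f).
Local Notation deg x := (degree (place_of x)).
Local Notation q := (size ks).

Lemma pt_residue_system (x : pt) : exists r : seq F, [/\ uniq r, size r = (q ^ deg x)%N,
  (forall t, t \in r -> pge x 0 t),
  (forall t t', t \in r -> t' \in r -> pge x 1 (t - t') -> t = t') &
  forall f, pge x 0 f -> exists2 t, t \in r & pge x 1 (f - t)].
Proof.
have [T [T0 Tcov]] := residue_cover curveX ac ksP x.
exact: (residue_system ks_uniq ksP T0 Tcov).
Qed.

Lemma degree_gt0 (x : pt) : (0 < deg x)%N.
Proof.
have [r [_ sr _ _ cov]] := pt_residue_system x.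
rewrite lt0n; apply/eqP => d0; move: sr; rewrite d0 expn0.
case: r cov => // t [|//] cov _.
have [|t1] := cov 1; first by rewrite pgeE ?oner_eq0// pval1.
rewrite inE => /eqP -> h1; have [|t0] := cov 0; first exact: pge0.
rewrite inE => /eqP -> h0; have := pgeB h1 h0.
by rewrite opprB subr0 subrK pgeE ?oner_eq0// pval1.
Qed.

Lemma degree_rational_point (x : pt) : rational_point x -> deg x = 1%N.
Proof.
move=> rat; apply/eqP; rewrite eqn_leq degree_gt0 andbT.
have [r [ur sr r0 rinj _]] := pt_residue_system x.
rewrite -(leq_exp2l _ _ (card_constants_gt1 ksP)) expn1 -sr.
have ex t : exists c, t \in r -> pge x 1 (t - iota c).
  have [tr|] := boolP (t \in r); last by exists 0.
  have Ot : sa_mem (place_ring (place_of x)) t by rewrite /sa_mem inE; apply: r0.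
  have [c hc] := rat (tpi 0 (exist _ t Ot : subalg_type (place_ring (place_of x)))).
  by exists c => _; have /tpi_eq := hc.
have [phi hphi] := choice ex.
rewrite -(size_map phi); apply: uniq_leq_size => [|c _]; last exact: ksP.
rewrite map_inj_in_uniq// => t t' tr tr' e; apply: rinj => //.
have := pgeB (hphi _ tr) (hphi _ tr').
by rewrite e opprB addrA subrK.
Qed.

(** Effective divisors are represented by sequences of points, and [cnt] gives the
    multiplicities. *)
Definition degs (s : seq pt) : nat := \sum_(x <- s) deg x.
Definition cnt (s : seq pt) (x : pt) : int := (count_mem x s)%:Z.

Lemma cnt_cat s t x : cnt (s ++ t) x = cnt s x + cnt t x.
Proof. by rewrite /cnt count_cat PoszD. Qed.
Lemma degs_cat s t : degs (s ++ t) = (degs s + degs t)%N.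
Proof. by rewrite /degs big_cat. Qed.
Lemma cnt_ge0 s x : 0 <= cnt s x. Proof. by []. Qed.
Lemma cnt_gt0 s x : (0 < cnt s x) = (x \in s).
Proof. by rewrite -has_pred1 has_count. Qed.
Lemma degs_cnt s t : (forall x, cnt s x = cnt t x) -> degs s = degs t.
Proof.
move=> h; rewrite /degs; apply: perm_big; apply/permP => p.
by apply/permP; rewrite /perm_eq; apply/allP => x _ /=; have [->] := h x.
Qed.

Fixpoint repeat (m : nat) (s : seq pt) : seq pt := if m is m'.+1 then s ++ repeat m' s else [::].
Lemma cnt_repeat m s x : cnt (repeat m s) x = cnt s x *+ m.
Proof. by elim: m => [|m IH] //=; rewrite cnt_cat IH mulrS. Qed.
Lemma degs_repeat m s : degs (repeat m s) = (m * degs s)%N.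
Proof. by elim: m => [|m IH] /=; rewrite ?degs_cat ?IH ?mulSn// /degs big_nil. Qed.

Lemma exists_seq_of_support (N : pt -> nat) : finite_set [set x | N x != 0%N] ->
  exists s, forall x, count_mem x s = N x.
Proof.
move=> /finite_seqP[l hl].
exists (flatten [seq nseq (N x) x | x <- undup l]) => x.
have cl (l' : seq pt) : uniq l' -> count_mem x (flatten [seq nseq (N y) y | y <- l']) =
    if x \in l' then N x else 0%N.
  elim: l' => [//|y l' IH] /= /andP[yl' ul']; rewrite count_cat count_nseq IH// inE.
  rewrite in_cons [x == y]eq_sym /=; have [<-|_] /= := eqVneq y x; last by rewrite mul0n.
  by rewrite mul1n (negPf yl') addn0.
rewrite cl ?undup_uniq// mem_undup; case: ifPn => // xl; apply/esym/eqP.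
apply: contraNT xl => Nx; have : [set` l] x by rewrite -hl.
by [].
Qed.

Definition Lspace (D : pt -> int) : set F := [set f | forall x, pge x (- D x) f].
(** A bound q^d on the cardinality stands for the bound d on the dimension over k. *)
Definition at_most (S : set F) (n : nat) : Prop :=
  exists2 s : seq F, (size s <= n)%N & forall f, S f -> f \in s.

Lemma at_most_uniq S n s : at_most S n -> uniq s -> (forall f, f \in s -> S f) -> (size s <= n)%N.
Proof.
move=> [t tn h] us hs; apply: leq_trans tn; apply: uniq_leq_size => // f /hs; exact: h.
Qed.

Lemma Lspace_ext D E n : (forall x, D x = E x) -> at_most (Lspace D) n -> at_most (Lspace E) n.
Proof. by move=> DE [s sn h]; exists s => // f hf; apply: h => x; rewrite DE. Qed.

Lemma Lspace_const : at_most (Lspace (fun=> 0)) q.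
Proof.
exists (map iota ks); first by rewrite size_map.
move=> f hf; have [x|c ->] := everywhere_regular perf curveX smoothX completeX ac (f := f).
  by have := hf x; rewrite oppr0 /Defs.pge => /orP[/eqP->|//]; rewrite pval0.
by apply: map_f; apply: ksP.
Qed.

Lemma Lspace_mul D n f : f != 0 -> at_most (Lspace D) n ->
  at_most (Lspace (fun x => D x - pv x f)) n.
Proof.
move=> f0 [s sn h]; exists [seq g * f | g <- s]; first by rewrite size_map.
move=> g hg; rewrite -(divfK f0 g); apply: map_f; apply: h => x.
have -> : - D x = - (D x - pv x f) + - pv x f by rewrite opprB addrC addKr.
by apply: pgeM => //; rewrite pgeE ?invr_eq0// pvalV.
Qed.

(** Allowing one more pole at x adds one leading coefficient, of which there are q^deg(x).
    Subtracting a fixed function with the same leading coefficient leads back to L(D). *)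
Lemma Lspace_add_point D n x : at_most (Lspace D) n ->
  at_most (Lspace (fun y => D y + cnt [:: x] y)) (n * q ^ deg x).
Proof.
move=> [s sn h]; set D' := fun y => _.
have [t vt] := pval_normalized (place_of x).
have t0 : t != 0 by apply/eqP => t0; move: vt; rewrite t0 pval0.
have [r [ur sr r0 rinj cov]] := pt_residue_system x.
(* Multiplication by N turns the leading coefficient at x into a residue. *)
pose N := t ^ (D x + 1); have N0 : N != 0 by rewrite expfz_neq0.
have vN : pv x N = D x + 1 by rewrite pvalZ vt mul1r.
have ex a : exists f, (exists2 g, Lspace D' g & pge x 1 (g * N - a)) ->
    Lspace D' f /\ pge x 1 (f * N - a).
  have [[g hg ha]|ng] := pselect (exists2 g, Lspace D' g & pge x 1 (g * N - a)).
    by exists g.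
  by exists 0.
have [phi hphi] := choice ex.
exists [seq phi a + l | l <- s, a <- r].
  by rewrite size_allpairs -sr leq_mul2r sn orbT.
move=> f hf; have fN : pge x 0 (f * N).
  have -> : 0 = - D' x + (D x + 1) by rewrite /D' /cnt /= eqxx; lia.
  by apply: pgeM; [apply: hf|rewrite pgeE// vN].
have [a ar fa] := cov _ fN.
have [hp pa] := hphi a (ex_intro2 _ _ f hf fa).
apply/allpairsP; exists (f - phi a, a); split=> //=; last by rewrite addrC subrK.
apply: h => y; have [->|yx] := eqVneq y x.
  have : pge x 1 ((f - phi a) * N).
    have := pgeB fa pa; rewrite opprB addrA subrK -mulrBl; exact.
  move=> hx; rewrite -(mulfK N0 (f - phi a)).
  have -> : - D x = 1 + - (D x + 1) by rewrite opprD addrCA subrr addr0.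
  by apply: pgeM => //; rewrite pgeE ?invr_eq0// pvalV vN.
have Dy : - D y = - D' y by rewrite /D' /cnt /= eq_sym (negPf yx) addr0.
by rewrite Dy; apply: pgeB; [apply: hf|apply: hp].
Qed.

Lemma Lspace_add D n s : at_most (Lspace D) n ->
  at_most (Lspace (fun y => D y + cnt s y)) (n * q ^ degs s).
Proof.
elim: s D n => [|x s IH] D n h.
  rewrite /degs big_nil muln1; apply: Lspace_ext h => x.
  by rewrite /cnt /= addr0.
have := IH _ _ (Lspace_add_point x h); rewrite /degs big_cons expnD mulnA.
apply: Lspace_ext => y; rewrite -addrA; congr (_ + _).
by rewrite -cnt_cat.
Qed.

(** Chinese remainder theorem by adding points one at a time: with n the multiplicity of x in the
    previous E, the function p^n a w carries the next digit a at x and vanishes to high order at the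
    other points of B. The set B stays fixed so that all functions are regular there. *)
Lemma residue_family (B E : seq pt) : {subset E <= B} -> exists T : seq F,
  [/\ uniq T, size T = (q ^ degs E)%N, (forall u x, u \in T -> x \in B -> pge x 0 u) &
      forall u u', u \in T -> u' \in T ->
        (forall x, x \in E -> pge x (cnt E x) (u - u')) -> u = u'].
Proof.
elim: E => [_|x E IH EB].
  exists [:: 0]; split=> //; first by rewrite /degs big_nil.
  - by move=> u y; rewrite inE => /eqP -> _; apply: pge0.
  - by move=> u u'; rewrite !inE => /eqP -> /eqP ->.
have [|T [uT sT T0 Tinj]] := IH; first by move=> y yE; apply: EB; rewrite inE yE orbT.
have [r [ur sr r0 rinj _]] := pt_residue_system x.
have [p vp] := pval_normalized (place_of x).
have p0 : p != 0 by apply/eqP => p0; move: vp; rewrite p0 pval0.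
pose n := count_mem x E; pose ys := [seq y <- B | y != x].
(* M lets w compensate, at the other points of B, the poles of every p^n a and still reach the
   multiplicity in the new divisor. *)
have [M hM] := exists_upper_bound [seq (y, a) | y <- ys, a <- r]
  (fun ya => cnt (x :: E) ya.1 - pv ya.1 (p ^+ n * ya.2)).
have [|w [w0 xw yw]] := @weak_approximation _ _ _ X x ys M; first by rewrite mem_filter eqxx.
pose e a := p ^+ n * a * w.
have ey a y : a \in r -> y \in B -> y != x -> pge y (cnt (x :: E) y) (e a).
  move=> ar yB yx; have [->|a0] := eqVneq a 0; first by rewrite /e mulr0 mul0r pge0.
  have pa0 : p ^+ n * a != 0 by rewrite mulf_neq0 ?expf_neq0.
  have yys : y \in ys by rewrite mem_filter yx.
  have ea0 : e a != 0 by rewrite mulf_neq0.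
  rewrite pgeE// /e pvalM//.
  have /hM /= : (y, a) \in [seq (y, a) | y <- ys, a <- r] by apply/allpairsP; exists (y, a).
  rewrite lerBlDr => h; apply: le_trans h _; rewrite addrC lerD2l; exact: yw.
have exn a : a \in r -> pge x n (e a).
  move=> ar; rewrite /e mulrAC -[n%:Z]addr0; apply: pgeM; last exact: r0.
  by rewrite pgeE ?mulf_neq0 ?expf_neq0// pvalM ?expf_neq0// xw addr0 pvalX vp natz.
pose T' := [seq u + e a | u <- T, a <- r].
have inj u a u' a' : u \in T -> a \in r -> u' \in T -> a' \in r ->
    (forall y, y \in x :: E -> pge y (cnt (x :: E) y) ((u + e a) - (u' + e a'))) ->
    u = u' /\ a = a'.
  move=> uu aa uu' aa' h.
  have eE y b : b \in r -> y \in x :: E -> pge y (cnt E y) (e b).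
    move=> br yE; have [->|yx] := eqVneq y x; first exact: exn.
    have := ey b y br (EB _ yE) yx; apply: pge_le; rewrite /cnt /= lez_nat.
    exact: leq_addl.
  have euu' : u = u'.
    apply: Tinj => // y yE; have yxE : y \in x :: E by rewrite inE yE orbT.
    have -> : u - u' = ((u + e a) - (u' + e a')) - (e a - e a') by ring.
    apply: pgeB; last by apply: pgeB; apply: eE.
    by apply: pge_le (h y yxE); rewrite /cnt /= lez_nat leq_addl.
  split=> //; apply: rinj => //.
  have := h x; rewrite inE eqxx => /(_ isT).
  rewrite /cnt /= eqxx add1n -/n euu' opprD addrACA subrr add0r.
  have -> : e a - e a' = (a - a') * (p ^+ n * w) by rewrite /e; ring.
  have pw0 : p ^+ n * w != 0 by rewrite mulf_neq0 ?expf_neq0.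
  move=> hx; rewrite -(mulfK pw0 (a - a')).
  have one : (1 : int) = n.+1%:Z + - n%:Z by rewrite -addn1 PoszD addrAC subrr add0r.
  rewrite [X in Defs.pge _ X _]one.
  apply: pgeM => //; rewrite pgeE ?invr_eq0// pvalV pvalM ?expf_neq0// xw addr0 pvalX vp.
  by rewrite natz.
exists T'; split.
- apply: allpairs_uniq => // -[u a] [u' a'] /allpairsP[[u1 a1] /= [h1 h2 [-> ->]]].
  move=> /allpairsP[[u2 a2] /= [h3 h4 [-> ->]]] eq12.
  have [|-> -> //] := inj _ _ _ _ h1 h2 h3 h4.
  by move=> y _; rewrite eq12 subrr; apply: pge0.
- by rewrite size_allpairs sT sr /degs big_cons expnD mulnC.
- move=> _ y /allpairsP[[u a] /= [uu aa ->]] yB.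
  have he : pge y 0 (e a).
    have [->|yx] := eqVneq y x; first exact: pge_le (exn a aa).
    exact: pge_le (ey a y aa yB yx).
  rewrite -[e a]opprK -[- e a]sub0r; apply: pgeB; first exact: T0.
  by apply: pgeB => //; apply: pge0.
move=> _ _ /allpairsP[[u a] /= [uu aa ->]] /allpairsP[[u' a'] /= [uu' aa' ->]] h.
by have [-> ->] := inj _ _ _ _ uu aa uu' aa' h.
Qed.
End RiemannRochSpaces.

Section Riemann.
Variables (k F : fieldType) (iota : {rmorphism k -> F}) (X : set (subalg iota)).
Hypotheses (perf : perfect_field k) (curveX : curve X) (smoothX : smooth_curve X)
  (completeX : complete_curve X) (ac : algebraically_closed_in iota).
Variable ks : seq k.
Hypotheses (ks_uniq : uniq ks) (ksP : forall c, c \in ks).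
Local Notation pt := (closed_point X).
Local Notation pv x f := (pval (place_of x) f).
Local Notation pge x n f := (pge (place_of x) n f).
Local Notation q := (size ks).

Lemma exists_zeros_seq f : f != 0 -> exists Z : seq pt, forall x, cnt Z x = Num.max 0 (pv x f).
Proof.
move=> f0; pose N (x : pt) : nat := absz (Num.max 0 (pv x f)).
have [|Z hZ] := @exists_seq_of_support _ _ _ X N.
  apply: sub_finite_set (finite_zeros_poles curveX ac ksP f0) => x /=.
  by apply: contra_neqN => /eqP e; rewrite /N e maxxx.
by exists Z => x; rewrite /cnt hZ /N gez0_abs// le_max lexx.
Qed.

Lemma exists_poles_seq f : f != 0 -> exists E : seq pt, forall x, cnt E x = Num.max 0 (- pv x f).
Proof.
move=> f0; have fi0 : f^-1 != 0 by rewrite invr_eq0.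
by have [E hE] := exists_zeros_seq fi0; exists E => x; rewrite hE pvalV.
Qed.

Lemma exists_common_poles (T : seq F) : exists C : seq pt,
  forall u x, u \in T -> pge x (- cnt C x) u.
Proof.
elim: T => [|u T [C hC]]; first by exists [::].
have [->|u0] := eqVneq u 0.
  exists C => w x; rewrite inE => /predU1P[->|]; [exact: pge0|exact: hC].
have [E hE] := exists_poles_seq u0; exists (E ++ C) => w x.
rewrite inE cnt_cat => /predU1P[->|/hC h]; last first.
  by apply: pge_le (h x); rewrite opprD gerDr oppr_le0.
rewrite pgeE// opprD hE; apply: le_trans (_ : - Num.max 0 (- pv x u) <= _).
  by rewrite gerDl oppr_le0.
by rewrite lerNl le_max lexx orbT.
Qed.

Lemma pgeX (x : pt) n f m : pge x n f -> pge x (n *+ m) (f ^+ m).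
Proof.
move=> h; elim: m => [|m IH]; first by rewrite expr0 mulr0n pgeE ?oner_eq0// pval1.
by rewrite exprS mulrS; apply: pgeM.
Qed.

(* With T a system of residues modulo the pole divisor E of t, the sums of the
   u_j t^j (j <= m, u_j in T) are distinct and have poles bounded by mE + C. *)
Lemma Lspace_lower t (E : seq pt) : t != 0 -> (forall x, cnt E x = Num.max 0 (- pv x t)) ->
  exists C : seq pt, forall m n,
    at_most (Lspace (fun x : pt => cnt E x *+ m + cnt C x)) n -> (q ^ (m.+1 * degs E) <= n)%N.
Proof.
move=> t0 hE.
have [T [uT sT T0 Tinj]] := residue_family curveX ac ks_uniq ksP (B := E) (E := E) (fun x => id).
have [C hC] := exists_common_poles T; exists C.
have tge x : pge x (- cnt E x) t.
  by rewrite pgeE// hE lerNl le_max lexx orbT.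
have tE x : x \in E -> pv x t = - cnt E x.
  by rewrite -cnt_gt0 hE; case: (leP 0 (- pv x t)) => //; rewrite ?ltxx// opprK.
have tXE x m : x \in E -> pge x (- (cnt E x *+ m)) (t ^+ m).
  by move=> xE; rewrite -mulNrn; apply: pgeX.
have [S hS] : exists S : nat -> seq F, forall m, [/\ uniq (S m), size (S m) = (q ^ (m.+1 * degs E))%N,
    (forall w x, w \in S m -> pge x (- (cnt E x *+ m + cnt C x)) w) &
    (forall w x, w \in S m -> x \in E -> pge x (- (cnt E x *+ m)) w)].
  (* Besides the pole bound mE + C everywhere, the induction records the sharper bound mE on the
     support of E, where the digits are regular. *)
  pose S := fix S m := if m is m'.+1 then [seq u * t ^+ m'.+1 + w | u <- T, w <- S m'] else T.
  exists S; elim=> [|m [uS sS S1 S2]].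
    split; [exact: uT|by rewrite mul1n| |].
      by move=> w x wT; rewrite mulr0n add0r; apply: hC.
    by move=> w x wT xE; rewrite mulr0n oppr0; apply: T0.
  have SE : S m.+1 = [seq u * t ^+ m.+1 + w | u <- T, w <- S m] by [].
  have tm x : pge x (- (cnt E x *+ m.+1)) (t ^+ m.+1).
    by rewrite -mulNrn; apply: pgeX.
  have add x n f g : pge x n f -> pge x n g -> pge x n (f + g).
    move=> hf hg; rewrite -[g]opprK -[- g]sub0r; apply: pgeB => //.
    by apply: pgeB => //; apply: pge0.
  rewrite SE; split.
  - apply: allpairs_uniq => // -[u w] [u' w'] /allpairsP[[u1 w1] /= [h1 h2 [-> ->]]].
    move=> /allpairsP[[u2 w2] /= [h3 h4 [-> ->]]] /= e.
    have eu : u1 = u2; last by move: e; rewrite eu => /addrI ->.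
    apply: Tinj => // x xE.
    (* Along E the right side has poles at most mE, while t^(m+1) has poles exactly (m+1)E; hence u1
       - u2 vanishes to the orders of E. *)
    have e' : (u1 - u2) * t ^+ m.+1 = w2 - w1.
      by apply/eqP; rewrite mulrBl subr_eq addrAC eq_sym subr_eq addrC e addrC.
    have tm0 : t ^+ m.+1 != 0 by rewrite expf_neq0.
    rewrite -(mulfK tm0 (u1 - u2)) e'.
    have -> : cnt E x = - (cnt E x *+ m) + cnt E x *+ m.+1 by rewrite mulrS addrCA addNr addr0.
    apply: pgeM; first by apply: pgeB; apply: S2.
    by rewrite pgeE ?invr_eq0// pvalV pvalX tE// mulNrn opprK.
  - by rewrite size_allpairs sT sS -expnD.
  - move=> _ x /allpairsP[[u w] /= [uT' wS ->]]; apply: add.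
      rewrite opprD addrC; apply: pgeM => //; exact: hC.
    by apply: pge_le (S1 w x wS); rewrite lerN2 lerD2r mulrS lerDr.
  - move=> _ x /allpairsP[[u w] /= [uT' wS ->]] xE; apply: add.
      by rewrite -[- _]add0r; apply: pgeM => //; apply: T0.
    by apply: pge_le (S2 w x wS xE); rewrite lerN2 mulrS lerDr.
move=> m n hn; have [uS sS S1 _] := hS m; rewrite -sS.
by apply: at_most_uniq hn uS _ => w wS x; apply: S1.
Qed.

(** * Degrees of principal divisors and polynomials vanishing at given points *)

Lemma degree_poles_le_zeros f (Z E : seq pt) : f != 0 ->
  (forall x, cnt Z x = Num.max 0 (pv x f)) -> (forall x, cnt E x = Num.max 0 (- pv x f)) ->
  (degs E <= degs Z)%N.
Proof.
move=> f0 hZ hE; have [C low] := Lspace_lower f0 hE.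
have [n hn] : exists n, at_most (Lspace (cnt C)) n.
  exists (q * q ^ degs C)%N.
  apply: Lspace_ext (Lspace_add curveX ac ks_uniq ksP C (Lspace_const perf curveX smoothX completeX ac ksP)) => x.
  by rewrite add0r.
(* Multiplication by a power of f identifies L(C - div f^m) with L(C), and adding mZ to the former
   divisor gives mE + C. The growth rates in m thus compare deg E with deg Z. *)
have key m : (q ^ (m.+1 * degs E) <= n * q ^ (m * degs Z))%N.
  apply: low; have fm0 : f ^+ m != 0 by rewrite expf_neq0.
  rewrite -degs_repeat.
  apply: Lspace_ext (Lspace_add curveX ac ks_uniq ksP (repeat m Z) (Lspace_mul fm0 hn)) => x.
  rewrite cnt_repeat pvalX hZ hE -addrA addrC; congr (_ + _).
  rewrite -mulNrn -mulrnDl; congr (_ *+ _).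
  by case: (leP 0 (pv x f)); case: (leP 0 (- pv x f)); lia.
rewrite leqNgt; apply/negP => lt.
have q1 := card_constants_gt1 ksP.
(* Taking m = n works because n < q^n: if deg Z + 1 <= deg E, then n q^(n deg Z) < q^((n+1) deg
   E). *)
have := key n; rewrite leqNgt => /negP; apply.
have qn : (n < q ^ n)%N by apply: ltn_expl.
apply: (@leq_trans (q ^ n * q ^ (n * degs Z))%N).
  by rewrite ltn_mul2r expn_gt0 (ltnW q1) qn.
rewrite -expnD leq_exp2l//; nia.
Qed.

Lemma degree_zeros_eq_poles f (Z E : seq pt) : f != 0 ->
  (forall x, cnt Z x = Num.max 0 (pv x f)) -> (forall x, cnt E x = Num.max 0 (- pv x f)) ->
  degs Z = degs E.
Proof.
move=> f0 hZ hE; apply/eqP; rewrite eqn_leq; apply/andP; split; last exact: degree_poles_le_zeros hZ hE.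
have fi0 : f^-1 != 0 by rewrite invr_eq0.
by apply: (degree_poles_le_zeros fi0) => x; rewrite pvalV ?opprK ?hE ?hZ.
Qed.

(** At a point where t is regular, two powers of t have the same residue, by the pigeonhole
    principle, so some X^j - X^i vanishes there; the product over B has the required orders. *)
Lemma exists_vanishing_poly t (B : seq pt) : exists2 p : {poly k}, p != 0 &
  forall x, 0 <= pv x t -> pge x (cnt B x) (ev iota t p).
Proof.
elim: B => [|x B [p p0 hp]].
  by exists 1; [exact: oner_neq0|move=> x _; rewrite rmorph1 pgeE ?oner_eq0// pval1].
have [r r0 hr] : exists2 r : {poly k}, r != 0 & 0 <= pv x t -> pge x 1 (ev iota t r).
  have [tx|] := leP 0 (pv x t); last by exists 1; rewrite ?oner_eq0.
  have [T [T0 Tcov]] := residue_cover curveX ac ksP x.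
  have txO n : pge x 0 (t ^+ n).
    rewrite -(mul0rn _ n); apply: pgeX; rewrite /Defs.pge tx orbT //.
  have ex n : exists a, a \in T /\ pge x 1 (t ^+ n - a).
    by have [a aT ha] := Tcov _ (txO n); exists a.
  have [phi hphi] := choice ex.
  have [i [j [ij eij]]] : exists i j, (i < j)%N /\ phi i = phi j.
    apply: contrapT => h; suff : (size (map phi (seq.iota 0 (size T).+1)) <= size T)%N.
      by rewrite size_map size_iota ltnn.
    apply: uniq_leq_size => [|_ /mapP[n _ ->]]; last by have [] := hphi n.
    rewrite map_inj_in_uniq ?iota_uniq// => i j _ _ e.
    have [ij|ji|//] := ltngtP i j; case: h; first by exists i, j.
    by exists j, i.
  exists ('X^j - 'X^i).
    apply/eqP => /(congr1 (fun p : {poly k} => p`_j)); rewrite coefB !coefXn eqxx coef0.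
    by rewrite gtn_eqF// subr0 => /eqP; rewrite oner_eq0.
  move=> _; rewrite rmorphB !rmorphXn /= evX.
  have [_ hi] := hphi i; have [_ hj] := hphi j.
  by have := pgeB hj hi; rewrite eij opprB addrA subrK.
exists (r * p); first by rewrite mulf_neq0.
move=> y ty; rewrite rmorphM /cnt /= PoszD; apply: pgeM; last exact: hp.
have [xy|_] := eqVneq x y; first by rewrite -xy; apply: hr; rewrite xy.
apply: (@sa_ev _ _ _ (place_ring (place_of y))).
by rewrite /= /Defs.pge ty orbT.
Qed.
End Riemann.

Lemma max0_sub (n : int) : Num.max 0 n - Num.max 0 (- n) = n.
Proof. by case: (leP 0 n); case: (leP 0 (- n)); lia. Qed.

(** * Riemann's inequality *)

Section FiniteDivisorClasses.
Variables (k F : fieldType) (iota : {rmorphism k -> F}) (X : set (subalg iota)).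
Hypotheses (perf : perfect_field k) (curveX : curve X) (smoothX : smooth_curve X)
  (completeX : complete_curve X) (ac : algebraically_closed_in iota).
Variable ks : seq k.
Hypotheses (ks_uniq : uniq ks) (ksP : forall c, c \in ks).
Local Notation pt := (closed_point X).
Local Notation pv x f := (pval (place_of x) f).
Local Notation pge x n f := (pge (place_of x) n f).
Local Notation deg x := (degree (place_of x)).

Lemma pv_transcendental (x : pt) f : pv x f != 0 -> ~ algebraicOver iota f.
Proof. by move=> vf /ac[c fc]; move: vf; rewrite fc pval_const eqxx. Qed.

Lemma ev_poles t (E : seq pt) (p : {poly k}) x : t != 0 -> (forall x, cnt E x = Num.max 0 (- pv x t)) ->
  pge x (- (cnt E x *+ size p)) (ev iota t p).
Proof.
move=> t0 hE; have tge : pge x (- cnt E x) t.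
  by rewrite pgeE// hE lerNl le_max lexx orbT.
elim/poly_ind: p => [|p c IH]; first by rewrite rmorph0 pge0.
have [-> |p0] := eqVneq p 0.
  by rewrite mul0r add0r evC; apply: pge_le (pge_const _ c); rewrite oppr_le0 mulrn_wge0.
rewrite evMXaddC size_MXaddC (negPf p0) /= mulrS opprD.
have add n f g : pge x n f -> pge x n g -> pge x n (f + g).
  move=> hf hg; rewrite -[g]opprK -[- g]sub0r; apply: pgeB => //.
  by apply: pgeB => //; apply: pge0.
apply: add; first by rewrite addrC; apply: pgeM.
by apply: pge_le (pge_const _ c); rewrite -opprD oppr_le0 addr_ge0// mulrn_wge0.
Qed.

Variable P : pt.
Hypothesis degP : deg P = 1%N.

(* Riemann's inequality, for divisors of degree zero. *)
Lemma riemann : exists c : nat, forall B1 B2 : seq pt, degs B1 = degs B2 ->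
  exists2 f, f != 0 & forall x, 0 <= pv x f + (cnt B1 x - cnt B2 x + cnt [:: P] x *+ c).
Proof.
have [t vt] := pval_normalized (place_of P).
have t0 : t != 0 by apply/eqP => t0; move: vt; rewrite t0 pval0.
have nt : ~ algebraicOver iota t by apply: (@pv_transcendental P); rewrite vt.
have [Z hZ] := exists_zeros_seq curveX ac ksP t0.
have [E hE] := exists_poles_seq curveX ac ksP t0.
have [C low] := Lspace_lower curveX ac ks_uniq ksP t0 hE.
have degE : (0 < degs E)%N.
  rewrite -(degree_zeros_eq_poles perf curveX smoothX completeX ac ks_uniq ksP t0 hZ hE).
  have : P \in Z by rewrite -cnt_gt0 hZ vt.
  by move=> PZ; rewrite /degs (big_rem P) //= degP.
(* The constant is the degree of the divisor C attached by [Lspace_lower] to a uniformizer t at P;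
   it depends only on t. *)
exists (degs C) => B1 B2 degB.
have [B [cntB degBC]] : exists B : seq pt,
    (forall x, cnt B x = cnt B1 x + cnt [:: P] x *+ degs C) /\ degs B = (degs B2 + degs C)%N.
  exists (B1 ++ repeat (degs C) [:: P]); split=> [x|]; first by rewrite cnt_cat cnt_repeat.
  by rewrite degs_cat degs_repeat degB {3}/degs big_seq1 degP muln1.
have [p p0 hp] := exists_vanishing_poly curveX ac ksP t B.
(* h vanishes to the orders of B where t is regular, and its poles are confined to those of t. *)
pose h := ev iota t p; have h0 : h != 0 by apply: ev0_notin.
have [Zh hZh] := exists_zeros_seq curveX ac ksP h0.
have [Eh hEh] := exists_poles_seq curveX ac ksP h0.
have degh := degree_zeros_eq_poles perf curveX smoothX completeX ac ks_uniq ksP h0 hZh hEh.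
have hv x : pv x h = cnt Zh x - cnt Eh x by rewrite hZh hEh max0_sub.
(* At the poles of t the divisor mE must bound B, with multiplicities at most [size B], and the
   poles of h, at most (size p) E. *)
pose m := (size B + size p)%N.
pose N x := cnt E x *+ m + cnt C x - (cnt B x - cnt B2 x - pv x h).
have N0 x : 0 <= N x.
  rewrite /N subr_ge0; apply: (@le_trans _ _ (cnt B x - pv x h)).
    by rewrite lerD2r gerDl oppr_le0.
  apply: (@le_trans _ _ (cnt E x *+ m)); last by rewrite lerDl.
  have [tx|tx] := leP 0 (pv x t).
    have := hp x tx; rewrite -/h pgeE// -subr_le0 => hx.
    by apply: le_trans hx _; rewrite mulrn_wge0.
  have E1 : 1 <= cnt E x.
    by rewrite hE le_max -[1 <= - _]gtz0_ge1 oppr_gt0 tx orbT.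
  rewrite /m mulrnDr; apply: lerD.
    apply: (@le_trans _ _ (size B)%:Z); first by rewrite lez_nat count_size.
    by rewrite -[X in X <= _]natz lerMn2r E1 orbT.
  by have := ev_poles p x t0 hE; rewrite -/h pgeE// lerNl.
have [s hs] : exists s : seq pt, forall x, cnt s x = N x.
  have [|s hs] := @exists_seq_of_support _ _ _ X (fun x => absz (N x)).
    apply: sub_finite_set (finite_seq (E ++ C ++ B ++ B2 ++ Zh ++ Eh)) => x /=.
    apply: contraNT => /=; rewrite -cnt_gt0 !cnt_cat /N hv => hx.
    have : [/\ cnt E x = 0, cnt C x = 0, cnt B x = 0, cnt B2 x = 0 & cnt Zh x = 0 /\ cnt Eh x = 0].
      move: (cnt_ge0 E x) (cnt_ge0 C x) (cnt_ge0 B x) (cnt_ge0 B2 x) (cnt_ge0 Zh x) (cnt_ge0 Eh x) hx.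
      move: (cnt E x) (cnt C x) (cnt B x) (cnt B2 x) (cnt Zh x) (cnt Eh x) => a1 a2 a3 a4 a5 a6.
      by clear; split; [lia|lia|lia|lia|split; lia].
    by move=> [-> -> -> -> [-> ->]]; rewrite mul0rn !subrr.
  by exists s => x; rewrite /cnt hs gez0_abs.
(* The degree of C cancels against deg B - deg B2, and h has degree 0. *)
have degS : degs s = (m * degs E)%N.
  have e : degs (s ++ B ++ Eh) = degs (repeat m E ++ C ++ B2 ++ Zh).
    apply: degs_cnt => x; rewrite !cnt_cat hs cnt_repeat /N hv; ring.
  move: e; rewrite !degs_cat !degs_repeat degh degBC.
  by clear; lia.
pose D x := cnt B x - cnt B2 x.
have [[f Lf f0]|nf] := pselect (exists2 f, Lspace D f & f != 0).
  exists f => // x; have := Lf x; rewrite pgeE// /D cntB => hx.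
  by rewrite addrC -[X in X + _]addrAC -lerBlDl sub0r.
(* If L(B - B2) were zero, adding s to the divisor B - B2 - div h would give at most q^(m deg E)
   elements in L(mE + C), fewer than the q^((m+1) deg E) supplied by the lower bound. *)
have D1 : at_most (Lspace D) 1.
  exists [:: 0] => // f Lf; rewrite inE; apply: contrapT => /negP f0.
  by apply: nf; exists f.
have := low m _ (Lspace_ext (fun x => _) (Lspace_add curveX ac ks_uniq ksP s (Lspace_mul h0 D1))).
rewrite mul1n degS => /(_ _)/wrap[x|].
  by rewrite hs /N /D; ring.
rewrite leq_exp2l ?(card_constants_gt1 ksP)// mulSn => le.
by exfalso; move: le degE; clear; lia.
Qed.
End FiniteDivisorClasses.

(** * Compactness for finite constant fields *)

Section CompactClasses.
Variables (k F : fieldType) (iota : {rmorphism k -> F}) (X : set (subalg iota)).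
Hypotheses (perf : perfect_field k) (curveX : curve X) (smoothX : smooth_curve X)
  (completeX : complete_curve X) (ac : algebraically_closed_in iota).
Variable ks : seq k.
Hypotheses (ks_uniq : uniq ks) (ksP : forall c, c \in ks).
Local Notation pt := (closed_point X).
Local Notation "x .-K" := (local_field (place_of x)) (at level 2, format "x .-K").
Local Notation emb x f := (@local_emb _ _ _ (place_of x) f).
Local Notation pv x f := (pval (place_of x) f).
Local Notation pge x n f := (pge (place_of x) n f).
Local Notation deg x := (degree (place_of x)).
Local Notation q := (size ks).
Local Notation G := (idele1_bar_mod_principal X).

(** A residue field with at most q^d elements cannot separate the powers t^0, ..., t^(q^d). So every
    such point is a pole of t or a zero of one of finitely many differences t^j - t^i. *)
Lemma finite_points_of_degree (P : pt) d : finite_set [set x : pt | (deg x <= d)%N].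
Proof.
have [t vt] := pval_normalized (place_of P).
have t0 : t != 0 by apply/eqP => t0; move: vt; rewrite t0 pval0.
have nt : ~ algebraicOver iota t by apply: (@pv_transcendental _ _ _ X ac P); rewrite vt.
pose w (ij : nat * nat) := t ^+ ij.2 - t ^+ ij.1.
have w0 i j : (i < j)%N -> w (i, j) != 0.
  move=> ij; have := ev0_notin nt (p := 'X^j - 'X^i); rewrite rmorphB !rmorphXn /= evX; apply.
  apply/eqP => /(congr1 (fun p : {poly k} => p`_j)); rewrite coefB !coefXn eqxx coef0.
  by rewrite gtn_eqF// subr0 => /eqP; rewrite oner_eq0.
pose I := [seq ij <- [seq (i, j) | i <- seq.iota 0 (q ^ d).+1, j <- seq.iota 0 (q ^ d).+1] | (ij.1 < ij.2)%N].
apply: (@sub_finite_set _ _ ([set x | pv x t != 0] `|`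
    \bigcup_(ij in [set` I]) [set x | pv x (w ij) != 0])).
  move=> x /= dx; have [tx|tx] := leP 0 (pv x t); last by left; rewrite lt_eqF.
  right; have [r [ur sr r0 rinj cov]] := pt_residue_system curveX ac ks_uniq ksP x.
  have txO n : pge x 0 (t ^+ n).
    rewrite -(mul0rn _ n); apply: pgeX; rewrite /Defs.pge tx orbT //.
  have ex n : exists a, a \in r /\ pge x 1 (t ^+ n - a).
    by have [a aT ha] := cov _ (txO n); exists a.
  have [phi hphi] := choice ex.
  have [i [j [ij jr eij]]] : exists i j, [/\ (i < j)%N, (j < (q ^ d).+1)%N & phi i = phi j].
    apply: contrapT => h; suff : (size (map phi (seq.iota 0 (q ^ d).+1)) <= size r)%N.
      rewrite size_map size_iota sr leqNgt ltnS leq_exp2l ?dx//.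
      exact: card_constants_gt1 ksP.
    apply: uniq_leq_size => [|_ /mapP[n _ ->]]; last by have [] := hphi n.
    rewrite map_inj_in_uniq ?iota_uniq// => i j; rewrite !mem_iota !add0n => /andP[_ hi] /andP[_ hj] e.
    have [ij|ji|//] := ltngtP i j; case: h; first by exists i, j.
    by exists j, i.
  exists (i, j) => /=.
    rewrite mem_filter ij; apply/allpairsP; exists (i, j); split=> //; rewrite mem_iota add0n //.
    exact: ltn_trans ij jr.
  have [_ hi] := hphi i; have [_ hj] := hphi j.
  have := pgeB hj hi; rewrite eij opprB addrA subrK -[_ - _]/(w (i, j)) pgeE ?w0//.
  by move=> h; rewrite gt_eqF//; apply: lt_le_trans h.
rewrite finite_setU; split; first exact: (finite_zeros_poles curveX ac ksP t0).
apply: bigcup_finite; first exact: finite_seq.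
move=> [i j] /=; rewrite mem_filter => /andP[/= ij _].
exact: (finite_zeros_poles curveX ac ksP (w0 i j ij)).
Qed.

Lemma finite_seqs_over (T : choiceType) (A : set T) n : finite_set A ->
  finite_set [set s : seq T | size s = n /\ forall x, x \in s -> A x].
Proof.
move=> fA; elim: n => [|n IH].
  by apply: sub_finite_set (finite_set1 [::]) => s /= [/size0nil ->].
apply: sub_finite_set (finite_image2 (@cons T) fA IH) => -[|x s] /= [] // [ss] hs.
exists x; first by apply: hs; rewrite inE eqxx.
by exists s => //; split=> // y ys; apply: hs; rewrite inE ys orbT.
Qed.

(** Points have degree at least 1, so both the length of s and the degrees of its points are at most
    c. *)
Lemma finite_effective_divisors (P : pt) c : finite_set [set s : seq pt | degs s = c].
Proof.
have fA := finite_points_of_degree P c.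
apply: (@sub_finite_set _ _ (\bigcup_(n in [set` seq.iota 0 c.+1])
    [set s : seq pt | size s = n /\ forall x, x \in s -> (deg x <= c)%N])).
  move=> s /= ds; exists (size s); last first.
    split=> // x xs; rewrite -ds /degs (big_rem x)//=; exact: leq_addr.
  have : size s \in seq.iota 0 c.+1; last by [].
  rewrite mem_iota add0n ltnS -ds /degs; elim: (s) => [|x t IH]; first by rewrite big_nil.
  rewrite big_cons /=; have := degree_gt0 curveX ac ks_uniq ksP x.
  by move: IH; clear; lia.
apply: bigcup_finite; first exact: finite_seq.
by move=> n _; apply: finite_seqs_over.
Qed.

Lemma sum_cnt (l s : seq pt) : uniq l -> {subset s <= l} ->
  \sum_(x <- l) (deg x)%:Z * cnt s x = (degs s)%:Z.
Proof.
move=> ul; elim: s => [_|y s IH ysl].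
  by rewrite /degs big_nil big1// => x _; rewrite mulr0.
have yl : y \in l by apply: ysl; rewrite inE eqxx.
rewrite /degs big_cons PoszD -/(degs s) -IH; last first.
  by move=> x xs; apply: ysl; rewrite inE xs orbT.
rewrite (bigD1_seq y)//= [in RHS](bigD1_seq y)//= /cnt /= eqxx add1n.
rewrite addrA; congr (_ + _); first by rewrite -addn1 PoszD mulrDr mulr1 addrC.
apply: eq_bigr => x xy; congr (_ * _).
by rewrite eq_sym (negPf xy).
Qed.

Lemma fsum_degree (D : pt -> int) (B1 B2 : seq pt) : (forall x, D x = cnt B1 x - cnt B2 x) ->
  \sum_(x \in [set: pt]) (deg x)%:Z * D x = (degs B1)%:Z - (degs B2)%:Z.
Proof.
move=> hD; pose l := undup (B1 ++ B2).
have ul : uniq l by apply: undup_uniq.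
have l1 : {subset B1 <= l} by move=> x xB; rewrite mem_undup mem_cat xB.
have l2 : {subset B2 <= l} by move=> x xB; rewrite mem_undup mem_cat xB orbT.
rewrite -(@fsbig_widen _ _ _ _ [set` l] [set: pt])//; last first.
  move=> x [_ /= /negP xl]; rewrite hD /cnt.
  have /count_memPn -> : x \notin B1 by apply: contra xl; apply: l1.
  have /count_memPn -> : x \notin B2 by apply: contra xl; apply: l2.
  by rewrite subrr mulr0.
rewrite -fsbig_seq// -(sum_cnt ul l1) -(sum_cnt ul l2) -sumrB.
by apply: eq_bigr => x _; rewrite hD mulrBr.
Qed.

Lemma principal_degree0 (f : F) : f != 0 ->
  \sum_(x \in [set: pt]) (deg x)%:Z * pv x f = 0.
Proof.
move=> f0; have [Z hZ] := exists_zeros_seq curveX ac ksP f0.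
have [E hE] := exists_poles_seq curveX ac ksP f0.
rewrite (@fsum_degree _ Z E) => [|x]; last by rewrite hZ hE max0_sub.
by rewrite (degree_zeros_eq_poles perf curveX smoothX completeX ac ks_uniq ksP f0 hZ hE) subrr.
Qed.

Lemma principal_idele1_exists (f : F) : f != 0 ->
  exists u : idele1 X, forall x, idele1_comp u x = emb x f.
Proof.
move=> f0.
have deg0 : idele_degree (functions_idele (fun _ : pt => f0) (finite_zeros_poles curveX ac ksP f0)) = 0.
  by rewrite functions_idele_degree principal_degree0.
by exists (mk_idele1 deg0).
Qed.

Lemma idele1_divisor (u : idele1 X) : exists B1 B2 : seq pt,
  (forall x, kval (idele1_comp u x) = cnt B1 x - cnt B2 x) /\ degs B1 = degs B2.
Proof.
pose D x := kval (idele1_comp u x).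
have sup (g : int -> int) : g 0 = 0 -> exists B : seq pt, forall x, count_mem x B = absz (g (D x)).
  move=> g0; apply: exists_seq_of_support.
  apply: sub_finite_set (idele_val_divisor (val u)) => x /=.
  by apply: contraNN => /eqP; rewrite -/(D x) => ->; rewrite g0.
have [B1 h1] := sup (fun n => Num.max 0 n) (maxxx 0).
have [|B2 h2] := sup (fun n => Num.max 0 (- n)); first by rewrite oppr0 maxxx.
have hD x : D x = cnt B1 x - cnt B2 x.
  by rewrite /cnt h1 h2 !gez0_abs ?le_max ?lexx// max0_sub.
exists B1, B2; split=> //; apply/eqP; rewrite -eqz_nat -subr_eq0.
by rewrite -(fsum_degree hD); apply/eqP; apply: (idele1_degree u).
Qed.

(** A choice of a function for every point, with the product topology of discrete spaces;
    Tychonoff's theorem applies to the choices within finite residue systems. *)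
Definition discrete_functions := prod_topology (fun _ : pt => discrete_topology F).

Lemma eq_on_seq_nbhs (g : discrete_functions) (l : seq pt) :
  nbhs g [set h : discrete_functions | forall x, x \in l -> h x = g x].
Proof.
elim: l => [|x l IH]; first by apply: filterS filterT.
have hx : nbhs g [set h : discrete_functions | h x = g x].
  exact: (@proj_continuous _ (fun _ : pt => discrete_topology F) x g _ (discrete_set1 _)).
apply: filterS (filterI hx IH) => h [/= hgx hl] y; rewrite inE => /predU1P[->//|]; exact: hl.
Qed.

Section UnitFamilies.
Variable h : F -> pt -> F.
Hypothesis h_ge0 : forall a x, 0 <= pv x (h a x).

(** The family h is a parameter because continuity into the ideles needs both a unit family and its
    inverse. *)
Definition family_prod (g : discrete_functions) : adele_prod X := fun x => emb x (h (g x) x).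
Lemma family_almost_integral g : almost_integral (family_prod g).
Proof.
apply/asboolP; rewrite (_ : [set x | _] = set0)//; apply/seteqP; split=> // x.
by apply; apply: local_emb_integral.
Qed.
Definition family_adele (g : discrete_functions) : adele X :=
  exist (fun a => is_true (almost_integral a)) _ (family_almost_integral g).

(** A neighborhood given by D constrains finitely many points, where g' and g may be taken equal; at
    the others D is 0 and both components are integral. *)
Lemma family_adele_continuous : continuous family_adele.
Proof.
move=> g W /= /adele_nbhsP[D fD sDW].
have [l hl] : exists l : seq pt, [set x | D x != 0] = [set` l] by apply/finite_seqP.
apply: filterS (eq_on_seq_nbhs g l) => g' hg'; apply: sDW => x.
rewrite -[val (family_adele g') x]/(emb x (h (g' x) x)) -[val (family_adele g) x]/(emb x (h (g x) x)).
rewrite -local_embB kge_emb; have [Dx|Dx] := eqVneq (D x) 0.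
  have ge0 a : pge x 0 (h a x) by rewrite /Defs.pge h_ge0 orbT.
  by rewrite Dx; apply: pgeB.
have xl : x \in l by have : [set` l] x by rewrite -hl.
by rewrite hg'// subrr pge0.
Qed.
End UnitFamilies.

(** The default 1 makes the map to unit ideles total on [discrete_functions]. *)
Definition unit_at (a : F) (x : pt) : F := if (a != 0) && (pv x a == 0) then a else 1.

Lemma unit_at_neq0 a x : unit_at a x != 0.
Proof. by rewrite /unit_at; case: ifP => [/andP[]//|_]; apply: oner_neq0. Qed.
Lemma unit_at_val a x : pv x (unit_at a x) = 0.
Proof. by rewrite /unit_at; case: ifP => [/andP[_ /eqP]//|_]; apply: pval1. Qed.
Lemma unit_at_ge0 a x : 0 <= pv x (unit_at a x).
Proof. by rewrite unit_at_val. Qed.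
Lemma unit_at_inv_ge0 a x : 0 <= pv x (unit_at a x)^-1.
Proof. by rewrite pvalV unit_at_val. Qed.

Lemma unit_ideleK (g : discrete_functions) :
  family_adele unit_at_ge0 g * family_adele unit_at_inv_ge0 g = 1.
Proof.
apply: val_inj; apply: functional_extensionality_dep => x.
rewrite -[LHS]/(emb x (unit_at (g x) x) * emb x (unit_at (g x) x)^-1).
rewrite -local_embM divff ?unit_at_neq0//; exact: local_emb1.
Qed.

Definition unit_idele (g : discrete_functions) : idele X := Units (unit_ideleK g).

Lemma unit_idele_comp g x : idele_comp (unit_idele g) x = emb x (unit_at (g x) x).
Proof. by []. Qed.

Lemma unit_idele_degree g : idele_degree (unit_idele g) = 0.
Proof.
apply: fsbig1 => x _; rewrite unit_idele_comp kval_emb ?unit_at_neq0//.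
by rewrite unit_at_val mulr0.
Qed.

Definition unit_idele1 (g : discrete_functions) : idele1 X := mk_idele1 (unit_idele_degree g).

Lemma unit_idele1_comp g x : idele1_comp (unit_idele1 g) x = emb x (unit_at (g x) x).
Proof. exact: unit_idele_comp. Qed.

Lemma unit_idele_continuous : continuous unit_idele.
Proof.
apply: (@initial_continuousP _ _ _ (@idele_emb _ _ _ X)).
have h := continuous_pair (@family_adele_continuous _ unit_at_ge0)
  (@family_adele_continuous _ unit_at_inv_ge0).
exact: h.
Qed.

Lemma unit_idele1_continuous : continuous unit_idele1.
Proof.
apply: (@initial_continuousP _ _ _ (set_val : idele_degree0 X -> idele X)).
have -> : set_val \o unit_idele1 = unit_idele by apply/funext.
exact: unit_idele_continuous.
Qed.

Lemma compact_bigcup_seq (T : topologicalType) (I : eqType) (l : seq I) (C : I -> set T) :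
  (forall i, compact (C i)) -> compact (\bigcup_(i in [set` l]) C i).
Proof.
move=> cC; elim: l => [|i l IH].
  rewrite (_ : \bigcup_(_ in _) _ = set0); first exact: compact0.
  by apply/seteqP; split=> // x [].
rewrite (_ : \bigcup_(_ in _) _ = C i `|` \bigcup_(j in [set` l]) C j).
  exact: compactU.
apply/seteqP; split=> [x [j /=]|x [Cx|[j /= jl Cx]]].
- by rewrite inE => /predU1P[->|jl] Cx; [left|right; exists j].
- by exists i => //=; rewrite inE eqxx.
- by exists j => //=; rewrite inE jl orbT.
Qed.

Lemma shift_quotient (K : fieldType) (a b c d : K) :
  a^-1 * (b * c) / d = (a * d)^-1 * b / c^-1.
Proof. by rewrite invfM invrK; ring. Qed.

Variable P : pt.
Hypothesis ratP : rational_point P.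

Lemma idele_class_compact : compact [set: G].
Proof.
have degP := degree_rational_point curveX ac ks_uniq ksP ratP.
have [c rc] := riemann perf curveX smoothX completeX ac ks_uniq ksP degP.
have [r hr] := choice (fun x => pt_residue_system curveX ac ks_uniq ksP x).
pose K : set discrete_functions := [set g | forall x, [set` r x] (g x)].
have cK : compact K.
  apply: (@tychonoff _ (fun _ : pt => discrete_topology F) (fun x => [set` r x])) => x.
  exact/finite_compact/finite_seq.
have [l hl] : exists l : seq (seq pt), [set s : seq pt | degs s = c] = [set` l].
  by apply/finite_seqP; apply: finite_effective_divisors P c.
(* For every effective E, an idele with divisor E - cP when there is one, and 1 otherwise; these
   give the finitely many translates. *)
have ex (E : seq pt) : exists b : idele1 X, (exists b' : idele1 X,
    forall x, kval (idele1_comp b' x) = cnt E x - cnt [:: P] x *+ c) ->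
    forall x, kval (idele1_comp b x) = cnt E x - cnt [:: P] x *+ c.
  have [[b hb]|nb] := pselect (exists b' : idele1 X,
    forall x, kval (idele1_comp b' x) = cnt E x - cnt [:: P] x *+ c).
    by exists b => _; exact: hb.
  by exists 1%g.
have [beta hbeta] := choice ex.
pose C E := (fun g => idele_class (beta E * unit_idele1 g)%g) @` K.
have cC E : compact (C E).
  apply: continuous_compact cK; apply: continuous_subspaceT.
  apply: (@continuous_compT _ _ _ (fun g => (beta E * unit_idele1 g)%g) (@idele_class _ _ _ X)).
    apply: (@continuous_compT _ _ _ (fun g => (beta E, unit_idele1 g)%g) (fun p => p.1 * p.2)%g);
      last exact: mulg_continuous.
    by apply: continuous_pair; [exact: cst_continuous|exact: unit_idele1_continuous].
  exact: idele_class_continuous.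
suff -> : [set: G] = \bigcup_(E in [set` l]) C E by apply: compact_bigcup_seq.
apply/seteqP; split=> // cl _; have [u ->] := idele_class_surj cl.
have [B1 [B2 [hu dB]]] := idele1_divisor u.
have [f f0 hf] := rc B1 B2 dB.
have [w hw] := principal_idele1_exists f0.
have kuw x : kval (idele1_comp (u * w)%g x) = pv x f + (cnt B1 x - cnt B2 x).
  rewrite idele1_compM (kvalM (idele1_comp_neq0 u x) (idele1_comp_neq0 w x)).
  by rewrite hu hw kval_emb// addrC.
have [E hE] : exists E : seq pt, forall x,
    cnt E x = pv x f + (cnt B1 x - cnt B2 x) + cnt [:: P] x *+ c.
  have [|E hE] := @exists_seq_of_support _ _ _ X
      (fun x => absz (pv x f + (cnt B1 x - cnt B2 x) + cnt [:: P] x *+ c)).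
    apply: (sub_finite_setU (idele_val_divisor (val (u * w)%g)) (finite_seq [:: P])) => x /=.
    rewrite -[idele_comp _ x]/(idele1_comp (u * w)%g x) kuw => h.
    apply: contrapT => /not_orP[/negP/negPn/eqP e /negP xP]; move: h; rewrite e add0r.
    by rewrite /cnt; move/count_memPn: xP => ->; rewrite mul0rn.
  by exists E => x; rewrite /cnt hE gez0_abs// -addrA; apply: hf.
(* The divisors B1 - B2 and div f both have degree 0, so only cP contributes. *)
have dE : degs E = c.
  have [Z hZ] := exists_zeros_seq curveX ac ksP f0.
  have [Y hY] := exists_poles_seq curveX ac ksP f0.
  have dZY := degree_zeros_eq_poles perf curveX smoothX completeX ac ks_uniq ksP f0 hZ hY.
  have : degs (E ++ Y ++ B2) = degs (Z ++ B1 ++ repeat c [:: P]).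
    apply: degs_cnt => x; rewrite !cnt_cat hE cnt_repeat -(max0_sub (pv x f)) -hZ -hY.
    ring.
  have dP : degs [:: P] = 1%N by rewrite /degs big_seq1.
  rewrite !degs_cat degs_repeat dZY dB dP muln1.
  by move: (degs E) (degs Y) (degs B2); clear; lia.
have El : [set` l] E by rewrite -hl.
have hb : forall x, kval (idele1_comp (beta E) x) = cnt E x - cnt [:: P] x *+ c.
  apply: hbeta; exists (u * w)%g => x; rewrite kuw hE addrK //.
pose t := ((beta E)^-1 * (u * w))%g.
have kt x : kval (idele1_comp t x) = 0.
  rewrite /t idele1_compM (kvalM (idele1_comp_neq0 _ x) (idele1_comp_neq0 _ x)).
  by rewrite idele1_compV kvalV hb kuw hE addrK addNr.
(* t is a unit everywhere; at each point a residue representative agrees with it up to a one-unit,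
   and [g] collects these representatives into an element of K. *)
have exg x : exists a, [set` r x] a /\ [/\ a != 0, pv x a = 0 & knear1 1 (idele1_comp t x / emb x a)].
  have [_ _ _ _ cov] := hr x.
  have [a ar ha] := unit_residue (idele1_comp_neq0 t x) (kt x) (R := [set` r x]) cov.
  by exists a; split; [exact: ar|exact: ha].
have [g hg] := choice exg.
exists E => //; exists g.
  by move=> x /=; have [] := hg x.
(* The inverse of f undoes the factor w used to make the divisor of u w + cP effective. *)
apply/idele_class_eqP; exists f^-1; first by rewrite invr_eq0.
move=> x; have [_ [gx0 vgx hn]] := hg x.
have ug : unit_at (g x) x = g x by rewrite /unit_at gx0 vgx eqxx.
have <- : idele1_comp t x / emb x (g x) =
    idele1_comp ((beta E * unit_idele1 g)^-1 * u)%g x / emb x f^-1.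
  rewrite /t !idele1_compM !idele1_compV !idele1_compM hw unit_idele1_comp ug local_embV.
  exact: shift_quotient.
exact: hn.
Qed.
End CompactClasses.

Theorem proposition4p6 (k F : fieldType) (iota : {rmorphism k -> F})
    (X : set (subalg iota)) :
  perfect_field k ->
  curve X -> smooth_curve X -> complete_curve X ->
  algebraically_closed_in iota ->
  (exists x : closed_point X, rational_point x) ->
  (profinite (idele1_bar_mod_principal X) <-> finite_set [set: k]).
Proof.
move=> perf curveX smoothX completeX ac [P ratP].
have regular_const := everywhere_regular perf curveX smoothX completeX ac.
split=> [[cG _ _]|/finite_seqP[s ks]].
  (* A uniformizer at P is the nonconstant function with a zero at P; constants have value 0. *)
  have [t vt] := pval_normalized (place_of P).
  have nt : ~ algebraicOver iota t by apply: (pv_transcendental ac (x := P)); rewrite vt.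
  have [x vx] := exists_pole perf curveX smoothX completeX ac nt.
  have Px : P != x by apply/eqP => e; move: vx; rewrite -e vt.
  exact: (compact_finite_constants regular_const Px cG).
have ks_all c : c \in undup s.
  by rewrite mem_undup; change ([set` s] c); rewrite -ks.
split.
- exact: (idele_class_compact perf curveX smoothX completeX ac (undup_uniq s) ks_all ratP).
- exact: (idele_class_hausdorff regular_const P).
- exact: (zero_dimension_totally_disconnected (idele_class_zero_dimensional regular_const P)).
Qed.
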